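(* Let $d\in\mathbb N$, let $\mathcal F=\{\mathbf 1_{[0,x]} : x\in[0,1]^d\}$, and let $\mathcal G$ be the closure of $\mathcal F$ under monotone convergence, i.e. $\mathcal G$ consists of all functions $g:[0,1]^d\to\mathbb R$ for which there exists a sequence $f_k\in\mathcal F$, $k\in\mathbb N$, with $f_k\uparrow g$ as $k\to\infty$. Suppose $X_n$, $n\in\mathbb N$, is a sequence of real-valued linear processes on $\mathrm{span}(\mathcal G)$ such that every $X_n$ satisfies the following assumptions: (a) All sample paths of $X_n$ are continuous with respect to monotone convergence in $\mathcal F$, i.e. if $f_k$, $k\in\mathbb N$, is a sequence in $\mathcal F$ such that $f_k\uparrow g$ for some $g\in\mathcal G$, then $X_n(f_k)\to X_n(g)$ as $k\to\infty$. (b) All sample paths of $X_n$ are continuous with respect to the supremum norm on the entire space $\mathrm{span}(\mathcal G)$. (c) $X_n(\mathbf 1_{[0,1]^d})=0$. Then every $X_n$ can be uniquely extended to a continuous (with respect to the supremum norm) linear operator $\bar X_n$ on the space $\mathcal{HK}(\infty)$ of functions of bounded Hardy-Krause variation. Moreover, let $0<c<\infty$. If the restrictions of $X_n$ to $\mathcal F$ weakly converge to some tight process $X$, i.e. $X_n\rightsquigarrow X$ in $\ell^\infty(\mathcal F)$, then there exists a copy $X'$ of $X$ with the following properties: 1. $X'$ can be extended to some Borel measurable and tight $\bar X'\in\ell^\infty[\mathcal{HK}(c)]$. 2. $\bar X_n\rightsquigarrow\bar X'$ in $\ell^\infty[\mathcal{HK}(c)]$ as $n\to\infty$. 3. Almost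 all sample paths of the extension $\bar X'$ are continuous with respect to monotone convergence in $\mathcal F$ (in the sense of (a)), and uniformly continuous with respect to the supremum norm on $\mathcal{HK}(c)$. 4. $\bar X'$ is obtained by applying a continuous linear operator to $X'$. In particular, if $X$ and thus $X'$ is mean-zero and/or Gaussian, then so is its extension $\bar X'$.
   Context: For $x\in[0,1]^d$, $[0,x]=\prod_{i=1}^d[0,x_i]$. The notation $f_k\uparrow g$ means pointwise monotone increasing convergence. Hardy-Krause variation. For $f:[0,1]^k\to\mathbb R$ and a box $B=\prod_{i=1}^k[a_i,b_i]$ put $\Delta^{(k)}(f;B)=\sum_{j_1,\dots,j_k\in\{0,1\}}(-1)^{j_1+\cdots+j_k}f\big(b_1+j_1(a_1-b_1),\dots,b_k+j_k(a_k-b_k)\big)$. The Vitali variation is $V^{(k)}(f)=\sup_{\mathcal P}\sum_{B\in\mathcal P}|\Delta^{(k)}(f;\bar B)|$, the supremum being over all finite partitions $\mathcal P$ of $[0,1]^k$ into hyperrectangles ($\bar B$ = closure). For $h:[0,1]^d\to\mathbb R$ and $1\le i_1<\dots<i_r\le d$ let $f_{i_1,\dots,i_r}:[0,1]^r\to\mathbb R$ be the restriction of $h$ to the face $\{x\in[0,1]^d: x_j=1\text{ for }j\notin\{i_1,\dots,i_r\}\}$, identified with $[0,1]^r$ in the natural way. Then $\|h\|_{\mathrm{HK}}=\sum_{r=1}^d\sum_{1\le i_1<\dots<i_r\le d}V^{(r)}(f_{i_1,\dots,i_r})$. For $0<c\le\infty$, $\mathcal{HK}(c)$ is the set of all $h:[0,1]^d\to\mathbb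 R$ with $\|h\|_{\mathrm{HK}}<c$ and $\|h\|_\infty\le c$. Every function of bounded Hardy-Krause variation is bounded, so $\mathcal{HK}(\infty)$ is the linear space of all functions of bounded Hardy-Krause variation. $\ell^\infty(T)$ is the space of bounded real functions on $T$ with the supremum norm. A (stochastic) process indexed by $T$ is a (not necessarily Borel measurable) random function on $T$ whose evaluation at each fixed $t\in T$ is a random variable; it is linear if every sample path is linear. Weak convergence $X_n\rightsquigarrow X$ in $\ell^\infty(T)$ is in the Hoffmann-Jørgensen sense: $X$ is Borel measurable and $\mathbb E^*f(X_n)\to\mathbb Ef(X)$ for all bounded continuous $f:\ell^\infty(T)\to\mathbb R$, where $\mathbb E^*$ is outer expectation. A copy of $X$ is a random element with the same distribution as $X$, possibly defined on a different probability space. Meaning of ''extension'' of $X'$: almost every sample path of $X'$ (a function on $\mathcal F$) is extended to a linear map on $\mathcal{HK}(\infty)$, which contains both $\mathcal F$ and $\mathcal{HK}(c)$; the restriction of this extension to $\mathcal{HK}(c)$ is the element $\bar X'$ of $\ell^\infty[\mathcal{HK}(c)]$, and the same symbol is used for both. This matters only for small $c$, where $\mathcal F$ need not be contained in $\mathcal{HK}(c)$. Likewise, in 2, $\bar X_n$ is understood as restricted to $\mathcal{HK}(c)$.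
   Formalization: In 4, ''mean-zero'' for X not assumed Gaussian is taken to mean that every continuous linear functional of X is integrable with mean zero, since pointwise mean zero need not pass to the extension; for Gaussian X it is pointwise. *)

(* Defs.v *)
From HB Require Import structures.
From mathcomp Require Import all_boot all_order all_algebra.
From mathcomp Require Import interval_inference.
From mathcomp Require Import all_classical all_reals all_analysis.
From mathcomp Require Import measurable_realfun.

Set Implicit Arguments.
Unset Strict Implicit.
Unset Printing Implicit Defensive.

Import Order.TTheory GRing.Theory Num.Theory.
Import numFieldNormedType.Exports.

Local Open Scope classical_set_scope.
Local Open Scope ring_scope.

(** * The space of bounded functions with the supremum norm *)

Section Linfty.
Context (R : realType) (T : Type).

Definition linfty_pred : {pred (T -> R^o)} :=
  mem [set f : T -> R^o | exists M : R, forall t, `|f t| <= M].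

Record linfty := Linfty {
  linfty_fun :> T -> R^o ;
  linfty_bounded : linfty_fun \in linfty_pred }.

HB.instance Definition _ := [isSub for linfty_fun].
HB.instance Definition _ := [Choice of linfty by <:].

Lemma linfty_submod_closed : submod_closed linfty_pred.
Proof.
split; first by apply: mem_set; exists 0 => t; rewrite normr0.
move=> a f g /set_mem[M fM] /set_mem[N gN].
apply: mem_set; exists (`|a| * M + N) => t.
rewrite (le_trans (ler_normD _ _))// lerD//.
by rewrite normrM ler_wpM2l.
Qed.

HB.instance Definition _ :=
  GRing.isSubmodClosed.Build _ _ linfty_pred linfty_submod_closed.
HB.instance Definition _ := [SubChoice_isSubLmodule of linfty by <:].

Definition linfty_norm (f : linfty) : R := sup (range (fun t => `|f t|)).

Lemma linfty_norm_ubound (f : linfty) (t : T) : `|f t| <= linfty_norm f.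
Proof.
have /set_mem[M fM] := linfty_bounded f.
apply: ub_le_sup; last by exists t.
by exists M => _ [s _ <-].
Qed.

Lemma linfty_norm_ge0 (f : linfty) : 0 <= linfty_norm f.
Proof.
have [[t _]|T0] := pselect (exists t : T, True).
  exact: le_trans (linfty_norm_ubound f t).
rewrite /linfty_norm.
have -> : range (fun t => `|f t|) = set0; last by rewrite sup0.
rewrite -subset0 => r [t _ _]; apply: T0; exact: (ex_intro _ t).
Qed.

Lemma linfty_norm_le (f : linfty) (M : R) :
  0 <= M -> (forall t, `|f t| <= M) -> linfty_norm f <= M.
Proof.
move=> M0 fM; have [[t _]|T0] := pselect (exists t : T, True).
  by apply: ge_sup; [exists `|f t|, t|move=> _ [s _ <-]].
rewrite /linfty_norm.
have -> : range (fun t => `|f t|) = set0; last by rewrite sup0.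
rewrite -subset0 => r [t _ _]; apply: T0; exact: (ex_intro _ t).
Qed.

Let ler_normD (f g : linfty) :
  linfty_norm (f + g) <= linfty_norm f + linfty_norm g.
Proof.
apply: linfty_norm_le => [|t]; first by rewrite addr_ge0// linfty_norm_ge0.
by rewrite (le_trans (ler_normD _ _))// lerD// linfty_norm_ubound.
Qed.

Let normrZ (a : R) (f : linfty) : linfty_norm (a *: f) = `|a| * linfty_norm f.
Proof.
have le_scale b g : linfty_norm (b *: g) <= `|b| * linfty_norm g.
  apply: linfty_norm_le => [|t]; first by rewrite mulr_ge0// linfty_norm_ge0.
  by rewrite normrM ler_wpM2l// linfty_norm_ubound.
apply/eqP; rewrite eq_le le_scale/=.
have [->|a0] := eqVneq a 0; first by rewrite normr0 mul0r linfty_norm_ge0.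
rewrite -ler_pdivlMl ?normr_gt0// -normfV.
by rewrite (le_trans _ (le_scale _ _))// scalerA mulVf// scale1r.
Qed.

Let normr0_eq0 (f : linfty) : linfty_norm f = 0 -> f = 0.
Proof.
move=> f0; apply/val_inj/funext => t /=; apply/eqP.
by rewrite -normr_le0 -f0 linfty_norm_ubound.
Qed.

HB.instance Definition _ :=
  @Lmodule_isNormed.Build R linfty linfty_norm ler_normD normrZ normr0_eq0.

End Linfty.

(** * The unit cube and Hardy-Krause variation *)

Section HardyKrause.
Context (R : realType).

Definition cube (k : nat) : Type := 'I_k -> {i01 R}.

Definition sup_norm (k : nat) (f : cube k -> R) : \bar R :=
  ereal_sup (range (fun x => `|f x|%:E)).

(* A hyperrectangle, i.e. a product of intervals each of which may or may not
   contain its endpoints: [hr_lopen i] (resp. [hr_ropen i]) says that the [i]-th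
   interval omits its left (resp. right) endpoint. *)
Record hrect (k : nat) := Hrect {
  hr_lo : cube k ;
  hr_hi : cube k ;
  hr_lopen : 'I_k -> bool ;
  hr_ropen : 'I_k -> bool }.

Definition hrect_set (k : nat) (B : hrect k) : set (cube k) :=
  [set x | forall i, (x i)%:num \in
     Interval (BSide (~~ hr_lopen B i) (hr_lo B i)%:num)
              (BSide (hr_ropen B i) (hr_hi B i)%:num)].

(* The closure of a nonempty [B] is the box with corners [hr_lo B] and
   [hr_hi B]; this is the box over which the increment is taken. *)
Definition increment (k : nat) (f : cube k -> R) (B : hrect k) : R :=
  \sum_(j : {ffun 'I_k -> bool})
    (-1) ^+ (\sum_(i < k) j i) *
    f (fun i => if j i then hr_lo B i else hr_hi B i).

Definition hrect_partition (k n : nat) (B : 'I_n -> hrect k) : Prop :=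
  [/\ forall l, hrect_set (B l) !=set0,
      trivIset [set: 'I_n] (fun l => hrect_set (B l)) &
      \bigcup_l hrect_set (B l) = [set: cube k]].

Definition vitali_variation (k : nat) (f : cube k -> R) : \bar R :=
  ereal_sup [set v | exists n (B : 'I_n -> hrect k), hrect_partition B /\
    v = (\sum_(l < n) `|increment f (B l)|)%:E].

(* [enum_val] lists the elements of [S] in increasing order. *)
Definition face_embed (d : nat) (S : {set 'I_d}) (y : cube #|S|) : cube d :=
  fun j => if [pick l : 'I_#|S| | enum_val l == j] is Some l
           then y l else 1%:i01.

Definition hk_norm (d : nat) (h : cube d -> R) : \bar R :=
  (\sum_(S : {set 'I_d} | (0 < #|S|)%N)
     vitali_variation (fun y : cube #|S| => h (face_embed y)))%E.

Definition HK (d : nat) (c : \bar R) : set (cube d -> R) :=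
  [set h | (hk_norm h < c)%E /\ (sup_norm h <= c)%E].

(** * Indicators of anchored boxes and functionals on sets of functions *)

Definition anchored_box (d : nat) (x : cube d) : set (cube d) :=
  [set y | forall i, (y i)%:num <= (x i)%:num].

Definition box_indicators (d : nat) : set (cube d -> R) :=
  range (fun x : cube d => \1_(anchored_box x)).

Definition mono_cvg (d : nat) (f : nat -> cube d -> R) (g : cube d -> R) :
    Prop :=
  forall x, nondecreasing_seq (fun k => f k x) /\
            (fun k => f k x) @ \oo --> g x.

Definition mono_closure (d : nat) (A : set (cube d -> R)) :
    set (cube d -> R) :=
  [set g | exists f : nat -> cube d -> R, (forall k, A (f k)) /\ mono_cvg f g].

Definition fun_span (d : nat) (A : set (cube d -> R)) : set (cube d -> R) :=
  [set f | exists n (a : 'I_n -> R) (g : 'I_n -> cube d -> R),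
     (forall i, A (g i)) /\ f = (fun x => \sum_(i < n) a i * g i x)].

(* Functionals are total on [cube d -> R]; only their values on the indicated
   set are meaningful. *)
Definition linear_on (d : nat) (A : set (cube d -> R))
    (phi : (cube d -> R) -> R) : Prop :=
  forall (a b : R) f g, A f -> A g ->
    phi (fun x => a * f x + b * g x) = a * phi f + b * phi g.

Definition sup_continuous_on (d : nat) (A : set (cube d -> R))
    (phi : (cube d -> R) -> R) : Prop :=
  forall f, A f -> forall e : R, 0 < e -> exists2 r : R, 0 < r &
    forall g, A g -> (sup_norm (fun x => g x - f x)%R < r%:E)%E ->
      `|phi g - phi f| < e.

Definition sup_unif_continuous_on (d : nat) (A : set (cube d -> R))
    (phi : (cube d -> R) -> R) : Prop :=
  forall e : R, 0 < e -> exists2 r : R, 0 < r &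
    forall f g, A f -> A g -> (sup_norm (fun x => g x - f x)%R < r%:E)%E ->
      `|phi g - phi f| < e.

Definition mono_continuous_on (d : nat) (A : set (cube d -> R))
    (phi : (cube d -> R) -> R) : Prop :=
  forall (f : nat -> cube d -> R) g, (forall k, A (f k)) -> mono_cvg f g ->
    (fun k => phi (f k)) @ \oo --> phi g.

Definition continuous_linear_extension (d : nat) (A B : set (cube d -> R))
    (phi psi : (cube d -> R) -> R) : Prop :=
  [/\ forall f, A f -> psi f = phi f, linear_on B psi &
      sup_continuous_on B psi].

Definition restriction_of (d : nat) (A : set (cube d -> R))
    (phi : (cube d -> R) -> R) (z : linfty R A) : Prop :=
  forall f : A, z f = phi (val f).

Definition process_on (d : nat) (A : set (cube d -> R))
    (dsp : measure_display) (Om : measurableType dsp)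
    (X : Om -> (cube d -> R) -> R) : Prop :=
  forall f, A f -> measurable_fun [set: Om] (fun w => X w f).

Definition linear_process_on (d : nat) (A : set (cube d -> R))
    (dsp : measure_display) (Om : measurableType dsp)
    (X : Om -> (cube d -> R) -> R) : Prop :=
  process_on A X /\ forall w, linear_on A (X w).

End HardyKrause.

(** * Random elements of the space of bounded functions *)

Section RandomElements.
Context (R : realType) (T : Type).
Local Notation L := (linfty R T).

Definition borel : set (set L) := <<s (@open L) >>.

Definition borel_measurable (dsp : measure_display) (Om : measurableType dsp)
    (X : Om -> L) : Prop :=
  forall B, borel B -> measurable (X @^-1` B).

Definition tight (dsp : measure_display) (Om : measurableType dsp)
    (P : probability Om R) (X : Om -> L) : Prop :=
  forall e : R, 0 < e ->
    exists2 K : set L, compact K & ((1 - e)%:E <= P (X @^-1` K))%E.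

Definition copy_of (dsp : measure_display) (Om : measurableType dsp)
    (P : probability Om R) (X : Om -> L)
    (dsp' : measure_display) (Om' : measurableType dsp')
    (P' : probability Om' R) (X' : Om' -> L) : Prop :=
  borel_measurable X' /\
  forall B, borel B -> P' (X' @^-1` B) = P (X @^-1` B).

(* The infimum ranges over the measurable majorants whose integral exists,
   possibly with an infinite value. *)
Definition outer_expectation (dsp : measure_display) (Om : measurableType dsp)
    (P : probability Om R) (Z : Om -> R) : \bar R :=
  ereal_inf [set (\int[P]_w U w)%E | U in
    [set U : Om -> \bar R |
      [/\ measurable_fun [set: Om] U,
          (\int[P]_w (U^\+ w) < +oo)%E \/ (\int[P]_w (U^\- w) < +oo)%E &
          forall w, ((Z w)%:E <= U w)%E]]].

Definition weak_cvg (dsp : nat -> measure_display)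
    (Om : forall n, measurableType (dsp n))
    (P : forall n, probability (Om n) R) (X : forall n, Om n -> L)
    (dsp0 : measure_display) (Om0 : measurableType dsp0)
    (P0 : probability Om0 R) (X0 : Om0 -> L) : Prop :=
  borel_measurable X0 /\
  forall phi : L -> R, continuous phi ->
    (exists M : R, forall z, `|phi z| <= M) ->
    outer_expectation (P n) (fun w => phi (X n w)) @[n --> \oo] -->
      (\int[P0]_w (phi (X0 w))%:E)%E.

(* One-dimensional normal law; variance [0], i.e. a point mass, is allowed. *)
Definition normal_rv (dsp : measure_display) (Om : measurableType dsp)
    (P : probability Om R) (Z : Om -> R) : Prop :=
  measurable_fun [set: Om] Z /\
  exists m s : R, forall A : set R, measurable A ->
    P (Z @^-1` A) = if s == 0 then \d_m A else normal_prob m s A.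

(* All finite-dimensional marginals are multivariate normal, i.e. all their
   linear combinations are normal. *)
Definition gaussian_process (dsp : measure_display) (Om : measurableType dsp)
    (P : probability Om R) (X : Om -> L) : Prop :=
  forall n (t : 'I_n -> T) (a : 'I_n -> R),
    normal_rv P (fun w => \sum_(i < n) a i * X w (t i)).

Definition mean_zero_rv (dsp : measure_display) (Om : measurableType dsp)
    (P : probability Om R) (Z : Om -> R) : Prop :=
  P.-integrable [set: Om] (EFin \o Z) /\ ('E_P[Z] = 0)%E.

Definition mean_zero_process (dsp : measure_display) (Om : measurableType dsp)
    (P : probability Om R) (X : Om -> L) : Prop :=
  forall t, mean_zero_rv P (fun w => X w t).

(* Mean zero as a random element of a Banach space, in the Pettis sense.
   Without Gaussianity, a mean-zero process need not be a mean-zero element: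
   the image of [X] under a continuous linear functional may fail to be
   integrable even if all evaluations of [X] are. *)
Definition mean_zero_element (dsp : measure_display) (Om : measurableType dsp)
    (P : probability Om R) (X : Om -> L) : Prop :=
  forall phi : {linear L -> R^o}, continuous phi ->
    mean_zero_rv P (fun w => phi (X w)).

End RandomElements.

(* Weak convergence of the restrictions to [A] of the processes [X n]. The maps
   [Y n] are the sample paths of [X n] seen as elements of the space of bounded
   functions on [A]; they are determined by [X n]. *)
Definition restricted_weak_cvg (R : realType) (d : nat)
    (A : set (cube R d -> R)) (dsp : nat -> measure_display)
    (Om : forall n, measurableType (dsp n))
    (P : forall n, probability (Om n) R)
    (X : forall n, Om n -> (cube R d -> R) -> R)
    (dsp0 : measure_display) (Om0 : measurableType dsp0)
    (P0 : probability Om0 R) (X0 : Om0 -> linfty R A) : Prop :=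
  exists Y : forall n, Om n -> linfty R A,
    (forall n w, restriction_of (X n w) (Y n w)) /\ weak_cvg P Y P0 X0.

(* Main.v *)
Require Import Defs.
From HB Require Import structures.
From mathcomp Require Import all_boot all_order all_algebra.
From mathcomp Require Import interval_inference.
From mathcomp Require Import all_classical all_reals all_analysis.
From mathcomp Require Import measurable_realfun.
From mathcomp Require Import zify ring lra.

Set Implicit Arguments.
Unset Strict Implicit.
Unset Printing Implicit Defensive.

Import Order.TTheory GRing.Theory Num.Theory.
Import numFieldNormedType.Exports.

Local Open Scope classical_set_scope.
Local Open Scope ring_scope.

(** The argument is integration by parts against the process, carried out on
    finite grids.

    Let K be the Hardy-Krause norm of h plus the modulus of h(1,...,1). A sum of
    one-coordinate increments of h along increasing values of the coordinate is
    at most d K, since every finite grid sum of increments over all faces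
    touching the corner (1,...,1) is at most K ([sum_grid_delta_le]). Hence the
    largest such sum from a given level upwards is a bounded monotone function
    of the level, and cutting its range into short intervals gives a finite grid
    on whose cells h oscillates little ([cell_oscillation]). Freezing h on the
    cells of such a grid gives a uniform approximation of h. Multidimensional
    summation by parts ([grid_inversion]) rewrites the frozen function as a
    linear combination of indicators of boxes, closed or half open in each
    coordinate, whose coefficients are the grid increments of h, and so have
    absolute sum at most K ([hk_approximation]). The half-open boxes are the
    monotone limits of closed ones. Indicators of boxes have variation at most
    one on every face, so the span of G consists of functions of bounded Hardy-
    Krause variation.

    Density gives existence and uniqueness of the extension of a functional that
    is linear and continuous in the supremum norm. The bound on the coefficients
    gives more: on restrictions z to F of such functionals that are continuous
    along monotone sequences in F, the value of the extension at h is a linear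
    function of z of norm at most K. To have this functional on all bounded
    functions z on F, the two limits in its definition (from closed to half-open
    boxes, and along the approximations of h) are taken along an ultrafilter
    ([hk_functional]). For h in HK(c) the number K is at most 2c, so these
    functionals form a bounded operator into the bounded functions on HK(c)
    ([dual_operator]), and weak convergence is preserved by composition with it.

    The limit X of the processes lies almost surely in the closure of the set of
    their restrictions: the test function given by the truncated distance to
    that set has expectation zero along the sequence, hence in the limit
    ([weak_cvg_closure]). Linearity, continuity along monotone sequences and
    uniform continuity on HK(c) pass to this closure because the operator is
    bounded, so X itself can serve as its copy. On the closure the extension is
    a limit of finite linear combinations of evaluations of X. Almost sure
    limits of normal variables are normal: tightness bounds the means and
    deviations, along a subsequence they converge, and the limit law is
    identified on intervals ([normal_rv_limit]). This gives the Gaussian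
    statements; the one on mean zero elements is composition with the adjoint. *)

(** * Summation by parts on a grid *)

Section GridTransform.
Context (R : realType) (d m : nat).
Local Notation idx := {ffun 'I_d -> 'I_m.+1}.

(** The coefficient of the grid value number [b] in the decrement from [a] to
    its successor; reading the increment as a row of a matrix avoids treating
    the last grid point, whose successor does not exist, as a special case. *)
Definition diff_coef (a b : nat) : R := (b == a)%:R - (b == a.+1)%:R.

(** For a multi-index with some coordinates equal to the last index this is,
    up to sign, the increment over a box of the face on which these
    coordinates are fixed to the last grid point; on the other boxes it is the
    ordinary increment. *)
Definition grid_delta (H : idx -> R) (j : idx) : R :=
  \sum_(l : idx) (\prod_i diff_coef (j i) (l i)) * H l.

Lemma sum_diff_coef (k l : 'I_m.+1) :
  \sum_(a < m.+1) (k <= a)%N%:R * diff_coef a l = (k == l)%:R.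
Proof.
rewrite /diff_coef; under eq_bigr do rewrite mulrBr.
rewrite sumrB (bigD1 l)//= eqxx mulr1 big1 ?addr0; last first.
  by move=> a /negPf al; rewrite eq_sym [(_ == _ :> nat)]al mulr0.
have -> : \sum_(a < m.+1) (k <= a)%N%:R * (l == a.+1 :> nat)%:R = (k < l)%N%:R :> R.
  case: l => -[|l] lm /=; first by rewrite big1// => a _; rewrite mulr0.
  rewrite (bigD1 (Ordinal (ltnW lm)))//= eqxx mulr1 big1 ?addr0//.
  by move=> a al; rewrite eqSS eq_sym [(_ == _ :> nat)](negPf al) mulr0.
by rewrite -val_eqE/=; case: ltngtP; rewrite /= ?subrr ?subr0.
Qed.

(** The matrix of increments is a tensor power of the one-dimensional
    bidiagonal matrix, whose inverse is the matrix of partial sums;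
    distributing the product over the sum reduces the claim to
    [sum_diff_coef]. *)
Lemma grid_inversion (H : idx -> R) (k : idx) :
  H k = \sum_(j : idx) (\prod_i (k i <= j i)%N%:R) * grid_delta H j.
Proof.
rewrite /grid_delta; under eq_bigr do rewrite mulr_sumr.
rewrite exchange_big/=.
have coefE (l : idx) : \sum_(j : idx) (\prod_i (k i <= j i)%N%:R) *
    ((\prod_i diff_coef (j i) (l i)) * H l) = (\prod_i (k i == l i)%:R) * H l.
  transitivity (\sum_(j : idx)
      (\prod_i ((k i <= j i)%N%:R * diff_coef (j i) (l i))) * H l).
    by apply: eq_bigr => j _; rewrite mulrA -big_split.
  rewrite -mulr_suml -(bigA_distr_bigA (fun i (a : 'I_m.+1) =>
    (k i <= a)%N%:R * diff_coef a (l i)))/=.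
  by congr (_ * _); apply: eq_bigr => i _; rewrite sum_diff_coef.
under eq_bigr do rewrite coefE.
rewrite (bigD1 k)//= [X in X * _]big1 ?mul1r => [|i _]; last by rewrite eqxx.
rewrite big1 ?addr0// => l lk.
have [i kli] : exists i, k i != l i.
  apply/existsP; rewrite -negb_forall; apply: contra lk => /forallP kl.
  by apply/eqP/ffunP => i; rewrite (eqP (kl i)).
by rewrite (bigD1 i)//= (negPf kli) !mul0r.
Qed.

(** Expanding both values by [grid_inversion], only the increments whose index
    separates them in coordinate [i0] survive. *)
Lemma grid_increment_le (H : idx -> R) (k k' : idx) (i0 : 'I_d) :
  (forall i, i != i0 -> k i = k' i) -> (k i0 <= k' i0)%N ->
  `|H k - H k'| <= \sum_(j : idx | (k i0 <= j i0 < k' i0)%N) `|grid_delta H j|.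
Proof.
move=> kk' kk0; rewrite (grid_inversion H k) (grid_inversion H k').
rewrite -sumrB (le_trans (ler_norm_sum _ _ _))// [leRHS]big_mkcond/=.
apply: ler_sum => j _; rewrite -mulrBl normrM.
rewrite (bigD1 i0)//= [X in _ - X](bigD1 i0)//=.
rewrite [X in _ - _ * X](eq_bigr (fun i => (k i <= j i)%N%:R)); last first.
  by move=> i /kk' ->.
rewrite -mulrBl normrM.
have p1 : `|\prod_(i < d | i != i0) (k i <= j i)%N%:R| <= 1 :> R.
  rewrite normr_prod; elim/big_rec: _ => // i x _ x1.
  by case: (_ <= _)%N; rewrite ?normr0 ?mul0r// normr1 mul1r.
case: ifPn => [_|].
  rewrite ler_piMl// mulr_ile1//.
  by case: (_ <= _)%N; case: (_ <= _)%N; rewrite ?subrr ?subr0 ?sub0r ?normrN ?normr0 ?normr1.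
rewrite negb_and -ltnNge -leqNgt => /orP[jk|jk].
  rewrite (ltn_geF jk) (ltn_geF (leq_trans jk kk0)).
  by rewrite subrr normr0 !mul0r.
by rewrite jk (leq_trans kk0 jk) subrr normr0 !mul0r.
Qed.

End GridTransform.

(** * Increments of a function on the faces of the cube *)

Section FaceExtension.
Context (d : nat) (S : {set 'I_d}) (T : Type).

(** [face_embed] is this function with default value 1; the same indexing is
    needed for multi-indices, where the default is the last index. *)
Definition face_extension (t0 : T) (y : 'I_#|S| -> T) (i : 'I_d) : T :=
  if [pick l : 'I_#|S| | enum_val l == i] is Some l then y l else t0.

Lemma face_extension_in t0 y l : face_extension t0 y (enum_val l) = y l.
Proof.
rewrite /face_extension; case: pickP => [l' /eqP /enum_val_inj->//|/(_ l)].
by rewrite eqxx.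
Qed.

Lemma face_extension_out t0 y i : i \notin S -> face_extension t0 y i = t0.
Proof.
rewrite /face_extension => iS; case: pickP => // l /eqP li.
by rewrite -li enum_valP in iS.
Qed.

Lemma face_extensionP (i : 'I_d) : (exists l : 'I_#|S|, i = enum_val l) \/ i \notin S.
Proof.
have [iS|] := boolP (i \in S); last by right.
by left; exists (enum_rank_in iS i); rewrite enum_rankK_in.
Qed.

End FaceExtension.

Lemma face_embedE (R : realType) (d : nat) (S : {set 'I_d}) (y : cube R #|S|) :
  face_embed y = face_extension 1%:i01 y.
Proof. by []. Qed.

Definition is_grid (R : realType) (m : nat) (s : nat -> {i01 R}) : Prop :=
  [/\ (0 < m)%N, (s 0)%:num = 0, (s m)%:num = 1 &
      forall a b, (a < b <= m)%N -> (s a)%:num < (s b)%:num].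

Section GridBoxes.
Context (R : realType) (m : nat) (s : nat -> {i01 R}).
Hypothesis s_grid : is_grid m s.

Definition grid_box (k : nat) (c : 'I_k -> 'I_m) : hrect R k :=
  Hrect (fun l => s (c l)) (fun l => s (c l).+1) (fun=> false)
    (fun l => (c l).+1 < m)%N.

(** The cells are closed on the left and open on the right, except the last
    one, so that they partition the unit interval. *)
Definition in_cell (a : nat) (x : R) : bool :=
  ((s a)%:num <= x) && (if (a.+1 < m)%N then x < (s a.+1)%:num else x <= 1).

Lemma grid_box_setP k (c : 'I_k -> 'I_m) (x : cube R k) :
  hrect_set (grid_box c) x <-> forall l, in_cell (c l) (x l)%:num.
Proof.
have [m0 s0 sm sh] := s_grid.
split => + l => /(_ l); rewrite in_itv/= /in_cell; case: ifPn => // cm.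
  by rewrite /= -sm (_ : (c l).+1 = m)//; apply/eqP; rewrite eqn_leq ltn_ord leqNgt.
rewrite /= (_ : (c l).+1 = m) ?sm//; apply/eqP.
by rewrite eqn_leq ltn_ord leqNgt.
Qed.

Lemma in_cell_uniq a b x : (a < m)%N -> (b < m)%N ->
  in_cell a x -> in_cell b x -> a = b.
Proof.
have [m0 s0 sm sh] := s_grid.
wlog ab : a b / (a < b)%N => [H|] am bm.
  have [ab|ab|//] := ltngtP a b; first exact: H.
  by move=> ax bx; apply/esym; exact: H.
move=> /andP[_ xa] /andP[bx _]; exfalso; move: xa.
rewrite (leq_ltn_trans ab bm) => xa.
have : (s a.+1)%:num <= (s b)%:num.
  move: ab; rewrite leq_eqVlt => /orP[/eqP->//|ab].
  by rewrite ltW// sh// ab ltnW.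
by rewrite leNgt (le_lt_trans bx xa).
Qed.

Lemma in_cell_ex (x : {i01 R}) : exists a : 'I_m, in_cell a x%:num.
Proof.
have [m0 s0 sm sh] := s_grid.
have P0 : exists a, (a < m)%N && ((s a)%:num <= x%:num).
  by exists 0%N; rewrite m0 s0 ge0.
have Pm a : (a < m)%N && ((s a)%:num <= x%:num) -> (a <= m)%N.
  by move=> /andP[/ltnW].
case: (ex_maxnP P0 Pm) => a /andP[am sax] amax.
exists (Ordinal am); rewrite /in_cell sax/=; case: ifPn => a1m; last exact: le1.
rewrite ltNge; apply/negP => sa1.
by have := amax a.+1; rewrite a1m sa1 ltnn => /(_ isT).
Qed.

Lemma grid_partition (k : nat) :
  hrect_partition (fun e : 'I_#|{ffun 'I_k -> 'I_m}| => grid_box (enum_val e)).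
Proof.
have [m0 s0 sm sh] := s_grid.
split.
- move=> e; exists (fun l => s (enum_val e l)); apply/grid_box_setP => l.
  rewrite /in_cell lexx/=; case: ifPn => am; last exact: le1.
  by apply: sh; rewrite ltnSn ltnW.
- apply/trivIsetP => e e' _ _; apply: contraNeq => /set0P[x [/grid_box_setP xe /grid_box_setP xe']].
  apply/eqP/enum_val_inj/ffunP => l; apply/val_inj.
  exact: in_cell_uniq (xe l) (xe' l).
- apply/seteqP; split => // x _.
  have /choice[c cP] : forall l, exists a : 'I_m, in_cell a (x l)%:num.
    by move=> l; exact: in_cell_ex.
  exists (enum_rank [ffun l => c l]) => //; apply/grid_box_setP => l.
  by rewrite enum_rankK ffunE.
Qed.

Lemma sum_grid_increment_le (k : nat) (f : cube R k -> R) :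
  ((\sum_(c : {ffun 'I_k -> 'I_m}) `|increment f (grid_box c)|)%:E
    <= vitali_variation f)%E.
Proof.
apply: ereal_sup_ubound; exists #|{ffun 'I_k -> 'I_m}|,
  (fun e : 'I_#|{ffun 'I_k -> 'I_m}| => grid_box (enum_val e)).
split; first exact: grid_partition.
by congr EFin; rewrite -(big_enum_val (A := {: {ffun 'I_k -> 'I_m}})
  (fun c : {ffun 'I_k -> 'I_m} => `|increment f (grid_box c)|)).
Qed.

End GridBoxes.

Section GridFaces.
Context (R : realType) (d m : nat) (s : nat -> {i01 R}).
Hypothesis s_grid : is_grid m s.
Variable h : cube R d -> R.
Local Notation idx := {ffun 'I_d -> 'I_m.+1}.

Definition on_grid (j : idx) : R := h (fun i => s (j i)).

Lemma grid_top : s m = 1%:i01.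
Proof. by have [_ _ sm _] := s_grid; apply/val_inj. Qed.

Definition face_idx (S : {set 'I_d}) (c : {ffun 'I_#|S| -> 'I_m}) : idx :=
  [ffun i => face_extension ord_max (fun l => widen_ord (leqnSn m) (c l)) i].

Lemma face_idx_in (S : {set 'I_d}) (c : {ffun 'I_#|S| -> 'I_m}) l :
  face_idx c (enum_val l) = c l :> nat.
Proof. by rewrite ffunE face_extension_in. Qed.

Lemma face_idx_out (S : {set 'I_d}) (c : {ffun 'I_#|S| -> 'I_m}) i :
  i \notin S -> face_idx c i = m :> nat.
Proof. by move=> iS; rewrite ffunE face_extension_out. Qed.

(** The terms of the grid increment that do not vanish are those of the
    corners of the box: in each coordinate of the face one chooses the lower
    or the upper endpoint.  The sign of a corner differs from the one in
    [increment] by a factor that depends on the face only. *)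
Lemma grid_delta_face (S : {set 'I_d}) (c : {ffun 'I_#|S| -> 'I_m}) :
  `|grid_delta on_grid (face_idx c)| =
  `|increment (fun y : cube R #|S| => h (face_embed y)) (grid_box s c)|.
Proof.
pose j := face_idx c; rewrite -/j /grid_delta.
pose near (l : idx) := [forall i, (l i == j i :> nat) || (l i == (j i).+1 :> nat)].
pose corner (b : {ffun 'I_#|S| -> bool}) : idx :=
  [ffun i => face_extension ord_max (fun l => if b l then widen_ord (leqnSn m) (c l)
    else lift ord0 (c l)) i].
pose side (l : idx) : {ffun 'I_#|S| -> bool} :=
  [ffun t => l (enum_val t) == j (enum_val t) :> nat].
have cornerE b t : corner b (enum_val t) = (if b t then c t : nat else (c t).+1) :> nat.
  by rewrite ffunE face_extension_in; case: (b t).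
have corner_out b i : i \notin S -> corner b i = m :> nat.
  by move=> iS; rewrite ffunE face_extension_out.
have near_corner b : near (corner b).
  apply/forallP => i; have [[t ->]|iS] := face_extensionP S i.
    by rewrite cornerE face_idx_in; case: (b t); rewrite eqxx ?orbT.
  by rewrite corner_out// face_idx_out// eqxx.
have side_corner b : side (corner b) = b.
  apply/ffunP => t; rewrite ffunE cornerE face_idx_in.
  by case: (b t); rewrite ?eqxx// eqn_leq ltnn.
(* A multi-index that is not a corner of the box has coefficient zero. *)
rewrite (bigID near)/= [X in _ + X]big1 ?addr0; last first.
  move=> l /forallPn[i]; rewrite negb_or => /andP[l1 l2].
  by rewrite (bigD1 i)//= /diff_coef (negPf l1) (negPf l2) subrr !mul0r.
rewrite (reindex_onto corner side)/=; last first.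
  move=> l /forallP nl; apply/ffunP => i; apply/val_inj.
  have [[t ->]|iS] := face_extensionP S i.
    rewrite /= cornerE ffunE; have := nl (enum_val t).
    by rewrite /j face_idx_in; case: eqP => [->|_ /= /eqP].
  rewrite /= corner_out//; have := nl i; rewrite /j face_idx_out//.
  by case/orP => /eqP // lm; have := ltn_ord (l i); rewrite lm ltnn.
rewrite (eq_bigl xpredT); last by move=> b; rewrite near_corner side_corner eqxx.
rewrite /increment.
have -> : \sum_(b : {ffun 'I_#|S| -> bool})
      (\prod_i diff_coef R (j i) (corner b i)) * on_grid (corner b) =
    (-1) ^+ #|S| * \sum_(b : {ffun 'I_#|S| -> bool})
      (-1) ^+ (\sum_(t < #|S|) b t) * h (face_embed (fun t =>
      if b t then hr_lo (grid_box s c) t else hr_hi (grid_box s c) t)).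
  rewrite mulr_sumr; apply: eq_bigr => b _; rewrite mulrA; congr (_ * _).
    rewrite (bigID (mem S))/= [X in _ * X]big1 ?mulr1; last first.
      move=> i iS; rewrite corner_out// /j face_idx_out// /diff_coef.
      by rewrite eqxx eqn_leq ltnn andbF subr0.
    rewrite (big_enum_val (fun i => diff_coef R (j i) (corner b i)))/=.
    rewrite -[in RHS]prodrXr.
    rewrite -[X in _ ^+ X]card_ord -prodr_const -big_split/=.
    apply: eq_bigr => t _; rewrite cornerE face_idx_in /diff_coef.
    case: (b t).
      by rewrite eqxx eqn_leq ltnn andbF subr0 expr1 mulrNN mulr1.
    by rewrite eqxx [(_.+1 == _)]eqn_leq ltnn sub0r expr0 mulr1.
  rewrite /on_grid; congr (h _); apply/funext => i.
  rewrite face_embedE; have [[t ->]|iS] := face_extensionP S i.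
    by rewrite face_extension_in/= cornerE; case: (b t).
  by rewrite face_extension_out// corner_out// grid_top.
by rewrite normrM normrX normrN1 expr1n mul1r.
Qed.

Definition low_set (j : idx) : {set 'I_d} := [set i | (j i < m)%N].

Lemma sum_grid_delta_face (S : {set 'I_d}) :
  \sum_(j : idx | low_set j == S) `|grid_delta on_grid j| =
  \sum_(c : {ffun 'I_#|S| -> 'I_m}) `|grid_delta on_grid (face_idx c)|.
Proof.
have [m0 _ _ _] := s_grid.
pose back (j : idx) : {ffun 'I_#|S| -> 'I_m} :=
  [ffun t => insubd (Ordinal m0) (j (enum_val t) : nat)].
have low_face (c : {ffun 'I_#|S| -> 'I_m}) : low_set (face_idx c) = S.
  apply/setP => i; rewrite inE; have [[t ->]|iS] := face_extensionP S i.
    by rewrite face_idx_in ltn_ord enum_valP.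
  by rewrite face_idx_out// ltnn (negPf iS).
rewrite (reindex_onto (@face_idx S) back)/=; last first.
  move=> j /eqP lowS; apply/ffunP => i; apply/val_inj => /=.
  have [[t ->]|iS] := face_extensionP S i.
    rewrite face_idx_in ffunE val_insubd.
    by have := enum_valP t; rewrite -{2}lowS inE => ->.
  rewrite face_idx_out//; move: iS; rewrite -lowS inE -leqNgt => jm.
  by apply/eqP; rewrite eqn_leq jm -ltnS ltn_ord.
apply: eq_bigl => c; rewrite low_face eqxx/=; apply/eqP/ffunP => t.
by apply/val_inj; rewrite ffunE val_insubd face_idx_in ltn_ord.
Qed.

(** Grouping the multi-indices by the set of coordinates that are not last,
    each group is a sum over the boxes of a grid partition of the
    corresponding face, and the empty face contributes the value at (1,...,1). *)
Lemma sum_grid_delta_le : (hk_norm h < +oo)%E ->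
  \sum_(j : idx) `|grid_delta on_grid j| <= fine (hk_norm h) + `|h (fun=> 1%:i01)|.
Proof.
move=> hfin; have [m0 _ _ _] := s_grid.
rewrite (partition_big low_set xpredT)//= (bigD1 (@finset.set0 'I_d))//= addrC lerD//; last first.
  rewrite (bigD1 [ffun=> ord_max])/=; last first.
    by apply/eqP/setP => i; rewrite !inE ffunE/= ltnn.
  rewrite big1 ?addr0; last first.
    move=> j /andP[/eqP/setP j0] /eqP; case.
    apply/ffunP => i; apply/val_inj; rewrite ffunE/=.
    have := j0 i; rewrite !inE => /negbT; rewrite -leqNgt => mj.
    by apply/eqP; rewrite eqn_leq mj -ltnS ltn_ord.
  have -> : [ffun=> ord_max] = @face_idx (@finset.set0 'I_d) [ffun=> Ordinal m0].
    apply/ffunP => i; apply/val_inj => /=; rewrite [RHS]face_idx_out ?inE//.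
    by rewrite ffunE.
  rewrite grid_delta_face /increment.
  have S0 (t : 'I_#|@finset.set0 'I_d|) : False by case: t => t; rewrite cards0.
  have all_eq (b : {ffun 'I_#|@finset.set0 'I_d| -> bool}) : b = [ffun=> false].
    by apply/ffunP => t; case: (S0 t).
  rewrite (bigD1 [ffun=> false])//= [X in _ + X]big1 ?addr0; last first.
    by move=> b; rewrite (all_eq b) eqxx.
  rewrite big1 ?expr0 ?mul1r; last by move=> t _; case: (S0 t).
  by rewrite le_eqVlt; apply/orP; left; apply/eqP; congr (`|h _|);
    apply/funext => i; rewrite face_embedE face_extension_out// inE.
have Hle : ((\sum_(S : {set 'I_d} | S != finset.set0)
    \sum_(j : idx | low_set j == S) `|grid_delta on_grid j|)%:E <= hk_norm h)%E.
  rewrite -sumEFin /hk_norm.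
  rewrite [leRHS](eq_bigl (fun S : {set 'I_d} => S != finset.set0)); last first.
    by move=> S; rewrite card_gt0.
  apply: lee_sum => S _; rewrite sum_grid_delta_face.
  under eq_bigr do rewrite grid_delta_face.
  exact: sum_grid_increment_le.
rewrite -lee_fin fineK//; rewrite ge0_fin_numE//.
apply: le_trans Hle; rewrite lee_fin.
by apply: sumr_ge0 => S _; apply: sumr_ge0.
Qed.

End GridFaces.

(** * Oscillation in one coordinate *)

Section GridThroughPoints.
Context (R : realType).

Lemma is_grid_le m (s : nat -> {i01 R}) a b : is_grid m s ->
  (a <= m)%N -> (b <= m)%N -> s a <= s b -> (a <= b)%N.
Proof.
move=> [_ _ _ sh] am bm; rewrite [(_ <= _)%N]leqNgt; apply: contraTN => ba.
by rewrite -ltNge; apply: sh; rewrite ba.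
Qed.

Lemma is_grid_homo m (s : nat -> {i01 R}) a b : is_grid m s ->
  (a <= b <= m)%N -> s a <= s b.
Proof.
move=> [_ _ _ sh] /andP[]; rewrite leq_eqVlt => /orP[/eqP->//|ab] bm.
by rewrite ltW//; apply: sh; rewrite ab.
Qed.

(** Sorting the given points together with 0 and 1. *)
Lemma grid_through (pts : seq {i01 R}) : exists m s, is_grid m s /\
  forall p, p \in pts -> exists2 a, (a <= m)%N & s a = p.
Proof.
pose zero : {i01 R} := Itv01 (lexx 0) ler01.
pose one : {i01 R} := Itv01 ler01 (lexx 1).
pose u := undup [:: zero, one & pts].
pose l := sort <=%O u; pose s := nth one l.
have lu : uniq l by rewrite sort_uniq undup_uniq.
have lmem p : p \in l = (p \in [:: zero, one & pts]).
  by rewrite mem_sort mem_undup.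
have lsort : sorted <%O l by rewrite lt_sorted_uniq_le lu sort_le_sorted.
have sh a b : (a < b < size l)%N -> s a < s b.
  move=> /andP[ab bl]; apply: (sorted_ltn_nth lt_trans) => //.
  by rewrite inE (ltn_trans ab).
have shle a b : (a <= b < size l)%N -> s a <= s b.
  move=> /andP[]; rewrite leq_eqVlt => /orP[/eqP->//|ab bl].
  by rewrite ltW// sh// ab.
have sP p : p \in l -> exists2 a, (a < size l)%N & s a = p.
  by move=> /(nthP one).
have [a0 a0l a0E] : exists2 a, (a < size l)%N & s a = zero.
  by apply: sP; rewrite lmem inE eqxx.
have [a1 a1l a1E] : exists2 a, (a < size l)%N & s a = one.
  by apply: sP; rewrite lmem !inE eqxx orbT.
have a01 : (a0 < a1)%N.
  rewrite [(_ < _)%N]ltnNge; apply/negP => a10.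
  have := shle a1 a0; rewrite a10 a0l => /(_ isT).
  by rewrite a0E a1E -num_le/= ler10.
have l1 : (1 < size l)%N by rewrite (leq_ltn_trans _ a1l)// (leq_ltn_trans _ a01).
exists (size l).-1, s; split.
  split.
  - by rewrite -ltnS prednK// ltnW.
  - apply/eqP; rewrite eq_le ge0 andbT.
    have := shle 0 a0; rewrite a0l => /(_ isT); rewrite a0E -num_le//.
  - apply/eqP; rewrite eq_le le1/=.
    have := shle a1 (size l).-1; rewrite prednK ?(ltnW l1)//.
    rewrite leqnn andbT -ltnS prednK ?(ltnW l1)// => /(_ a1l).
    by rewrite a1E -num_le.
  - by move=> a b /andP[ab bm]; apply: sh; rewrite ab (leq_ltn_trans bm)// prednK// ltnW.
move=> p pp; have [|a al <-] := sP p; first by rewrite lmem !inE pp !orbT.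
by exists a => //; rewrite -ltnS prednK// ltnW.
Qed.

End GridThroughPoints.

Section CoordinateVariation.
Context (R : realType) (d : nat) (h : cube R d -> R).

Definition upd (x : cube R d) (i : 'I_d) (t : {i01 R}) : cube R d :=
  fun k => if k == i then t else x k.

Fixpoint chain_ok (a : {i01 R}) (l : seq ({i01 R} * cube R d * 'I_d)) : Prop :=
  if l is (t, x, i) :: l' then a <= t /\ chain_ok t l' else True.

(** A chain records a nondecreasing sequence of levels; at each step the point
    and the coordinate in which it is moved between two consecutive levels are
    arbitrary. *)
Fixpoint chain_sum (a : {i01 R}) (l : seq ({i01 R} * cube R d * 'I_d)) : R :=
  if l is (t, x, i) :: l' then
    `|h (upd x i t) - h (upd x i a)| + chain_sum t l'
  else 0.

Fixpoint chain_points (l : seq ({i01 R} * cube R d * 'I_d)) : seq {i01 R} :=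
  if l is (t, x, i) :: l' then
    t :: [seq x k | k : 'I_d] ++ chain_points l' else [::].

(** The constant of the summation by parts: all faces and the corner
    (1,...,1). *)
Definition hk_bound : R := fine (hk_norm h) + `|h (fun=> 1%:i01)|.

Hypothesis hfin : (hk_norm h < +oo)%E.

(** On a grid containing all the levels and all the coordinates of the points
    of the chain, a step of the chain is bounded by the grid increments whose
    index in the moving coordinate lies between the two levels.  For a given
    coordinate these are disjoint for different steps, whence the factor [d]. *)
Lemma chain_sum_le a l : chain_ok a l -> chain_sum a l <= d%:R * hk_bound.
Proof.
have [m [s [s_grid sP]]] := grid_through (a :: chain_points l).
pose D (b : nat) := \sum_(i < d) \sum_(j : {ffun 'I_d -> 'I_m.+1} | (b <= j i)%N)
  `|grid_delta (on_grid s h) j|.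
have D_ub b : D b <= d%:R * hk_bound.
  rewrite mulr_natl -[X in _ *+ X]card_ord -sumr_const; apply: ler_sum => i _.
  rewrite (le_trans _ (sum_grid_delta_le s_grid hfin))//.
  by rewrite [leLHS]big_mkcond; apply: ler_sum => j _; case: ifP.
have Dstep b b' i : (b <= b')%N ->
    \sum_(j : {ffun 'I_d -> 'I_m.+1} | (b <= j i < b')%N)
      `|grid_delta (on_grid s h) j| + D b' <= D b.
  move=> bb'; rewrite /D (bigD1 i)//= [leRHS](bigD1 i)//= addrA lerD//.
    rewrite le_eqVlt; apply/orP; left; apply/eqP.
    rewrite [in RHS](bigID (fun j : {ffun 'I_d -> 'I_m.+1} => (j i < b')%N))/=.
    congr (_ + _); apply: eq_bigl => j; rewrite -leqNgt.
    by case: leqP => //= b'j; rewrite ?andbF// (leq_trans bb').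
  apply: ler_sum => k _; rewrite big_mkcond [leRHS]big_mkcond.
  by apply: ler_sum => j _; case: (leqP b' (j k)) => [/(leq_trans bb') ->//|]; case: ifP.
have [ka kam sa] := sP a (mem_head _ _).
have {}sP p : p \in chain_points l -> exists2 b, (b <= m)%N & s b = p.
  by move=> pl; apply: sP; rewrite inE pl orbT.
suff H : chain_ok a l -> chain_sum a l <= D ka by move=> /H/le_trans; exact.
elim: l a ka sP kam sa => [|[[t x] i] l IH] a ka sP kam sa /=.
  by move=> _; apply: sumr_ge0 => i _; apply: sumr_ge0.
move=> [at_ ok].
have [kt ktm st] : exists2 b, (b <= m)%N & s b = t.
  by apply: sP; rewrite /= mem_head.
have kat : (ka <= kt)%N by apply: (is_grid_le s_grid) => //; rewrite sa st.
have /choice[kx kxP] : forall k, exists b : 'I_m.+1, s b = x k.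
  move=> k; have [|b bm sb] := sP (x k).
    by rewrite /= inE mem_cat map_f ?orbT// mem_enum.
  by exists (inord b); rewrite inordK.
pose K (b : nat) : {ffun 'I_d -> 'I_m.+1} :=
  [ffun k => if k == i then inord b else kx k].
have KE b : (b <= m)%N -> h (upd x i (s b)) = on_grid s h (K b).
  move=> bm; rewrite /on_grid; congr (h _); apply/funext => k.
  by rewrite /upd ffunE; case: eqP => // _; rewrite inordK.
rewrite (le_trans _ (Dstep ka kt i kat))// lerD//; last first.
  by apply: IH => // p pl; apply: sP; rewrite /= inE mem_cat pl !orbT.
rewrite -sa -st !KE// distrC.
rewrite (le_trans (@grid_increment_le _ _ _ _ (K ka) (K kt) i _ _))//.
- by move=> k ki; rewrite !ffunE (negPf ki).
- by rewrite !ffunE eqxx !inordK.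
- by rewrite !ffunE eqxx !inordK.
Qed.

Definition chain_sums (a : {i01 R}) : set R :=
  [set v | exists2 l, chain_ok a l & v = chain_sum a l].

(** The chains go upwards from [a] so that a step is added at the front of a
    chain. *)
Definition upward_variation (a : {i01 R}) : R := sup (chain_sums a).

Lemma chain_sums_has_sup a : has_sup (chain_sums a).
Proof.
split; first by exists 0, [::].
by exists (d%:R * hk_bound) => _ [l ok ->]; exact: chain_sum_le.
Qed.

Lemma upward_variation_ge0 a : 0 <= upward_variation a.
Proof.
by apply: ub_le_sup; [exact: (chain_sums_has_sup a).2|exists [::]].
Qed.

Lemma upward_variation_le a : upward_variation a <= d%:R * hk_bound.
Proof.
apply: ge_sup; first exact: (chain_sums_has_sup a).1.
by move=> _ [l ok ->]; exact: chain_sum_le.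
Qed.

Lemma upward_variation_step a b x i : a <= b ->
  `|h (upd x i b) - h (upd x i a)| <= upward_variation a - upward_variation b.
Proof.
move=> ab; rewrite lerBrDl -lerBrDr; apply: ge_sup.
  exact: (chain_sums_has_sup b).1.
move=> _ [l ok ->]; rewrite lerBrDl.
apply: ub_le_sup; first exact: (chain_sums_has_sup a).2.
by exists ((b, x, i) :: l).
Qed.

Lemma upward_variation_anti a b : (0 < d)%N -> a <= b ->
  upward_variation b <= upward_variation a.
Proof.
move=> d0 ab; rewrite -subr_ge0.
exact: le_trans (upward_variation_step (fun=> a) (Ordinal d0) ab).
Qed.

(** The points are the levels at which the antitone function
    [upward_variation] falls below a multiple of [e].  At two arguments not
    separated by such a point its values differ by at most [e]. *)
Lemma cell_oscillation (e : R) : 0 < e -> exists pts : seq {i01 R},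
  forall i x u v, u <= v -> (forall p, p \in pts -> p < u \/ v < p) ->
    `|h (upd x i v) - h (upd x i u)| <= e.
Proof.
move=> e0.
pose M := (Num.truncn (d%:R * hk_bound / e)).+1.
pose lev (k : nat) : set R := [set r : R | r = 0 \/
  exists2 t : {i01 R}, r = t%:num & k%:R * e <= upward_variation t].
have lev_sup k : has_sup (lev k).
  split; first by exists 0; left.
  by exists 1 => _ [->|[t -> _]].
have lev0 k : 0 <= sup (lev k) by apply: ub_le_sup; [exact: (lev_sup k).2|left].
have lev1 k : sup (lev k) <= 1.
  by apply: ge_sup; [exact: (lev_sup k).1|move=> _ [->|[t -> _]]].
exists [seq Itv01 (lev0 k) (lev1 k) | k <- iota 0 M.+1] => i x u v uv pts.
have d0 : (0 < d)%N by rewrite (leq_ltn_trans _ (ltn_ord i)).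
rewrite (le_trans (upward_variation_step x i uv))// lerBlDr.
pose n := Num.truncn (upward_variation v / e).
have Wv0 : 0 <= upward_variation v / e by rewrite divr_ge0// ?upward_variation_ge0// ltW.
have /andP[nW Wn] : n%:R <= upward_variation v / e < n.+1%:R by exact: truncn_itv.
have nM : (n.+1 < M.+1)%N.
  rewrite ltnS /M ltnS; apply: le_truncn.
  by rewrite ler_pM2r ?invr_gt0// upward_variation_le.
rewrite leNgt; apply/negP => Wu.
have {}Wu : n.+1%:R * e <= upward_variation u.
  rewrite ltW// (le_lt_trans _ Wu)// -natr1 mulrDl mul1r addrC lerD2l.
  by rewrite -ler_pdivlMr.
have {}Wn : upward_variation v < n.+1%:R * e by rewrite -ltr_pdivrMr.
have /pts : Itv01 (lev0 n.+1) (lev1 n.+1) \in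
    [seq Itv01 (lev0 k) (lev1 k) | k <- iota 0 M.+1].
  by apply: map_f; rewrite mem_iota.
rewrite -!num_lt/= => -[|].
  by apply/negP; rewrite -leNgt; apply: ub_le_sup; [exact: (lev_sup _).2|right; exists u].
apply/negP; rewrite -leNgt; apply: ge_sup; first exact: (lev_sup _).1.
move=> _ [->|[t -> Wt]]; first exact: ge0.
rewrite leNgt; apply/negP; rewrite num_lt => /ltW vt.
by have := upward_variation_anti d0 vt; rewrite leNgt (lt_le_trans Wn).
Qed.

End CoordinateVariation.

(** * Uniform approximation by boxes *)

Section HalfOpenBoxes.
Context (R : realType) (d : nat).

Definition half_open_box (t : cube R d) (o : 'I_d -> bool) : set (cube R d) :=
  [set y | forall i, if o i then (y i)%:num < (t i)%:num
                     else (y i)%:num <= (t i)%:num].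

Lemma indic_subset_le (T : Type) (A B : set T) x :
  A `<=` B -> \1_A x <= \1_B x :> R.
Proof.
move=> AB; rewrite !indicE ler_nat; have [/set_mem/AB/mem_set->//|//] := boolP (x \in A).
Qed.

Lemma shrink_subproof (t : {i01 R}) (k : nat) :
  0 <= t%:num * (1 - k.+1%:R^-1) /\ t%:num * (1 - k.+1%:R^-1) <= 1.
Proof.
have k1 : 0 <= 1 - k.+1%:R^-1 :> R by rewrite subr_ge0 invf_le1// ler1n.
split; first by rewrite mulr_ge0// ge0.
by rewrite mulr_ile1// ?ge0 ?le1// lerBlDr lerDl invr_ge0.
Qed.

Definition shrink (t : {i01 R}) (k : nat) : {i01 R} :=
  Itv01 (shrink_subproof t k).1 (shrink_subproof t k).2.

(** Shrinking the half-open sides slightly gives closed boxes, and a point of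
    the half-open box is in all but finitely many of them. *)
Lemma half_open_box_closure (t : cube R d) (o : 'I_d -> bool) :
  (forall i, o i -> 0 < (t i)%:num) ->
  mono_closure (@box_indicators R d) \1_(half_open_box t o).
Proof.
move=> t0; pose x k : cube R d := fun i => if o i then shrink (t i) k else t i.
exists (fun k => \1_(anchored_box (x k))); split; first by move=> k; exists (x k).
move=> y; split.
  move=> k l kl; apply: indic_subset_le => z zk i; apply: (le_trans (zk i)).
  rewrite /x; case: ifP => //= oi; rewrite ler_wpM2l ?ge0// lerB//.
  by rewrite lef_pV2 ?posrE ?ltr0n// ler_nat.
have [yB|yB] := pselect (half_open_box t o y).
  apply: cvg_near_cst.
  have : \forall k \near \oo, forall i, (y i)%:num <= (x k i)%:num.
    apply: filter_forall => i; have := yB i; rewrite /x; case: ifP => oi yi.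
      have ti := t0 _ oi.
      pose e := 1 - (y i)%:num / (t i)%:num.
      have e0 : 0 < e by rewrite subr_gt0 ltr_pdivrMr// mul1r.
      near=> k; rewrite /= mulrC -ler_pdivrMr// lerBrDl -lerBrDr -/e ltW//.
      near: k; exact: near_infty_natSinv_lt (PosNum e0).
    by near=> k.
  apply: filterS => k yk; rewrite !indicE !mem_set//.
rewrite [X in _ --> X](_ : _ = 0); last by rewrite indicE memNset.
rewrite (_ : (fun k => _) = cst 0); first exact: cvg_cst.
apply/funext => k; rewrite indicE memNset// => yk; apply: yB => i.
have := yk i; rewrite /x; case: ifP => // oi /=.
move/le_lt_trans; apply; rewrite gtr_pMr ?t0// gtrBl.
Unshelve. all: by end_near. Qed.

End HalfOpenBoxes.

Section Refinement.
Context (R : realType) (m : nat) (t : nat -> {i01 R}).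
Hypothesis t_grid : is_grid m t.

Lemma midpoint_subproof (u v : {i01 R}) :
  0 <= (u%:num + v%:num) / 2 /\ (u%:num + v%:num) / 2 <= 1.
Proof.
have u0 : 0 <= u%:num by [].
have u1 : u%:num <= 1 by [].
have v0 : 0 <= v%:num by [].
have v1 : v%:num <= 1 by [].
by split; lra.
Qed.

Definition midpoint (u v : {i01 R}) : {i01 R} :=
  Itv01 (midpoint_subproof u v).1 (midpoint_subproof u v).2.

(** The grid with the midpoints of its cells inserted: even indices are the
    points of the grid and odd ones represent the open cells between them. *)
Definition refine (k : nat) : {i01 R} :=
  if odd k then midpoint (t k./2) (t k./2.+1) else t k./2.

Lemma refine_grid : is_grid m.*2 refine.
Proof.
have [m0 t0 tm th] := t_grid; split.
- by rewrite double_gt0.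
- by rewrite /refine.
- by rewrite /refine odd_double doubleK.
- have step k : (k < m.*2)%N -> (refine k)%:num < (refine k.+1)%:num.
    move=> km; rewrite /refine /= uphalf_half.
    have k2 : (k./2 < m)%N by rewrite ltn_half_double.
    have := th k./2 k./2.+1; rewrite ltnSn k2 => /(_ isT).
    by case: (odd k) => /=; rewrite ?add0n ?add1n => ?; lra.
  move=> a b /andP[]; elim: b => // b IH; rewrite ltnS leq_eqVlt => /orP[/eqP->|ab] bm.
    exact: step.
  by rewrite (lt_trans (IH ab (ltnW bm)))// step.
Qed.

Definition cell_index (u : {i01 R}) (k : nat) : bool :=
  if odd k then (t k./2)%:num < u%:num < (t k./2.+1)%:num else u == t k./2.

Lemma cell_index_ex (u : {i01 R}) : exists k : 'I_m.*2.+1, cell_index u k.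
Proof.
have [m0 t0 tm th] := t_grid.
have [a /andP[]] := in_cell_ex t_grid u.
rewrite le_eqVlt => /orP[/eqP tau _|tau].
  have am : (a.*2 < m.*2.+1)%N by rewrite ltnS leq_double ltnW.
  exists (Ordinal am); rewrite /cell_index/= odd_double doubleK.
  by apply/eqP/val_inj.
have am : (a.*2.+1 < m.*2.+1)%N by rewrite ltnS ltn_double.
have uh : uphalf a.*2 = a by rewrite uphalf_half odd_double doubleK.
case: ifPn => [_ uta|a1m].
  by exists (Ordinal am); rewrite /cell_index/= odd_double/= uh tau.
have a1 : a.+1 = m by apply/eqP; rewrite eqn_leq ltn_ord leqNgt.
rewrite le_eqVlt => /orP[/eqP u1|u1].
  exists ord_max; rewrite /cell_index/= odd_double doubleK.
  by apply/eqP/val_inj; rewrite /= u1 -[LHS]tm.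
by exists (Ordinal am); rewrite /cell_index/= odd_double/= uh tau a1 tm.
Qed.

(** The points whose cell comes at or before a given one form an interval
    starting at 0, which is closed if that cell is a point and half open if it
    is an open interval. *)
Lemma cell_index_le u k l : (k <= m.*2)%N -> (l <= m.*2)%N -> cell_index u k ->
  (k <= l)%N <-> if odd l then u%:num < (t l./2.+1)%:num else u%:num <= (t l./2)%:num.
Proof.
move=> km lm; have [m0 t0 tm th] := t_grid.
have thle a b : (a <= b <= m)%N -> (t a)%:num <= (t b)%:num.
  by move=> ?; rewrite num_le (is_grid_homo t_grid).
have kd := odd_double_half k; have ld := odd_double_half l.
rewrite /cell_index; case: ifPn => ok; case: ifPn => ol.
- move=> /andP[u1 u2]; rewrite ok ol/= in kd ld; split=> [kl|ul].
    by rewrite (lt_le_trans u2)// thle//; lia.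
  rewrite leqNgt; apply/negP => lk.
  have : (t l./2.+1)%:num <= (t k./2)%:num by apply: thle; lia.
  by rewrite leNgt (lt_trans u1).
- move=> /andP[u1 u2]; rewrite ok (negPf ol)/= in kd ld; split=> [kl|ul].
    by rewrite ltW// (lt_le_trans u2)// thle//; lia.
  rewrite leqNgt; apply/negP => lk.
  have : (t l./2)%:num <= (t k./2)%:num by apply: thle; lia.
  by rewrite leNgt (lt_le_trans u1).
- move=> /eqP ->; rewrite ol (negPf ok)/= in kd ld; split=> [kl|ul].
    by apply: th; lia.
  rewrite leqNgt; apply/negP => lk.
  have : (t l./2.+1)%:num <= (t k./2)%:num by apply: thle; lia.
  by rewrite leNgt ul.
- move=> /eqP ->; rewrite (negPf ol) (negPf ok)/= in kd ld; split=> [kl|ul].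
    by apply: thle; lia.
  rewrite leqNgt; apply/negP => lk.
  have : (t l./2)%:num < (t k./2)%:num by apply: th; lia.
  by rewrite ltNge ul.
Qed.

Lemma cell_index_refine u k : (k <= m.*2)%N -> cell_index u k ->
  u = refine k \/ forall a, (a <= m)%N ->
    (t a)%:num < u%:num /\ (t a)%:num < (refine k)%:num \/
    u%:num < (t a)%:num /\ (refine k)%:num < (t a)%:num.
Proof.
have [m0 t0 tm th] := t_grid; have kd := odd_double_half k.
have thle a b : (a <= b <= m)%N -> (t a)%:num <= (t b)%:num.
  by move=> ?; rewrite num_le (is_grid_homo t_grid).
move=> km; rewrite /cell_index /refine; case: ifPn => ok; last by move=> /eqP ->; left.
rewrite ok/= in kd.
move=> /andP[u1 u2]; right=> a am; have tt : (t k./2)%:num < (t k./2.+1)%:num by apply: th; lia.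
have [ak|ka] := leqP a k./2.
  have tak : (t a)%:num <= (t k./2)%:num by apply: thle; lia.
  by left; rewrite /=; split; lra.
have tak : (t k./2.+1)%:num <= (t a)%:num by apply: thle; lia.
by right; rewrite /=; split; lra.
Qed.

End Refinement.

Section Approximation.
Context (R : realType) (d : nat) (h : cube R d -> R).
Hypothesis hfin : (hk_norm h < +oo)%E.

(** Replace the coordinates one at a time. *)
Lemma coordinatewise_le (r : {i01 R} -> {i01 R}) (e : R) :
  (forall i x u, `|h (upd x i u) - h (upd x i (r u))| <= e) ->
  forall x, `|h x - h (fun i => r (x i))| <= d%:R * e.
Proof.
move=> hr x; pose mix n : cube R d := fun i => if (i < n)%N then r (x i) else x i.
have -> : h (fun i => r (x i)) = h (mix d).
  by congr (h _); apply/funext => i; rewrite /mix ltn_ord.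
have -> : h x = h (mix 0%N) by congr (h _); apply/funext => i.
suff H n : (n <= d)%N -> `|h (mix 0%N) - h (mix n)| <= n%:R * e by exact: H.
elim: n => [|n IH] nd; first by rewrite subrr normr0 mul0r.
rewrite -(subrKA (h (mix n))) (le_trans (ler_normD _ _))//.
rewrite -natr1 mulrDl mul1r lerD//; first exact/IH/ltnW.
have := hr (Ordinal nd) (mix n) (x (Ordinal nd)).
congr (`|h _ - h _| <= e); apply/funext => i; rewrite /upd /mix -val_eqE/=.
  by case: eqP => // iE; rewrite iE ltnn; congr x; apply/val_inj.
rewrite ltnS; case: ltngtP => // iE.
by congr (r (x _)); apply/val_inj.
Qed.

(** The approximation is [h] composed in each coordinate with the map to the
    representative of the cell.  By [grid_inversion] it is a combination of
    products of indicators of initial intervals, with the grid increments as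
    coefficients. *)
Lemma hk_approximation (e : R) : 0 < e ->
  exists n (a : 'I_n -> R) (g : 'I_n -> cube R d -> R),
  [/\ forall i, mono_closure (@box_indicators R d) (g i),
      \sum_i `|a i| <= hk_bound h &
      forall x, `|h x - \sum_i a i * g i x| <= e].
Proof.
(* The factor d + 1 leaves the quotient meaningful for d = 0. *)
move=> e0; pose e' := e / d.+1%:R.
have e'0 : 0 < e' by rewrite divr_gt0.
have [pts osc] := cell_oscillation hfin e'0.
have [m [t [t_grid tP]]] := grid_through pts.
have s_grid := refine_grid t_grid; set s := refine t in s_grid.
have [k kP] := choice (cell_index_ex t_grid).
have km u : (k u <= m.*2)%N by rewrite -ltnS ltn_ord.
pose idx := {ffun 'I_d -> 'I_m.*2.+1}.
have jm (j : idx) i : (j i <= m.*2)%N by rewrite -ltnS ltn_ord.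
pose top (j : idx) : cube R d :=
  fun i => if odd (j i) then t (j i)./2.+1 else t (j i)./2.
pose box (j : idx) := half_open_box (top j) (fun i => odd (j i)).
pose delta := grid_delta (m := m.*2) (on_grid s h).
have boxE x (j : idx) : \prod_i (k (x i) <= j i)%N%:R = \1_(box j) x :> R.
  have boxP : box j x <-> forall i, (k (x i) <= j i)%N.
    split=> xj i; have := xj i; rewrite /top.
      move=> xi; apply/(cell_index_le t_grid (km _) _ (kP (x i))).
        by rewrite -ltnS.
      by move: xi; case: (odd _).
    move=> /(cell_index_le t_grid (km _) (jm j i) (kP (x i))).
    by case: (odd _).
  rewrite indicE; have [/set_mem/boxP xj|xj] := boolP (x \in box j).
    by rewrite big1// => i _; rewrite xj.
  have [i xi] : exists i, ~~ (k (x i) <= j i)%N.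
    apply/existsP; rewrite -negb_forall; apply: contra xj => /forallP xj.
    by apply/mem_set/boxP.
  by rewrite (bigD1 i)//= (negPf xi) mul0r.
exists #|{: idx}|, (fun i : 'I_#|{: idx}| => delta (enum_val i)),
  (fun i : 'I_#|{: idx}| => \1_(box (enum_val i))).
split.
- move=> i; apply: half_open_box_closure => l; rewrite /top => ol; rewrite ol.
  have [m0 t0 _ th] := t_grid; rewrite -t0; apply: th => /=.
  rewrite ltn_half_double -ltnS.
  have := ltn_ord (enum_val i l); rewrite ltnS leq_eqVlt => /orP[/eqP E|//].
  by move: ol; rewrite E odd_double.
- rewrite -(big_enum_val (A := {: idx}) (fun j : idx => `|delta j|)).
  exact: sum_grid_delta_le.
- move=> x.
  rewrite -(big_enum_val (A := {: idx}) (fun j : idx => delta j * \1_(box j) x)).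
  have -> : \sum_(j in {: idx}) delta j * \1_(box j) x = h (fun i => s (k (x i))).
    transitivity (on_grid s h [ffun i => k (x i)]).
      rewrite (grid_inversion _ [ffun i => k (x i)]); apply: eq_bigr => j _.
      by rewrite mulrC -boxE; congr (_ * _); apply: eq_bigr => i _; rewrite ffunE.
    by rewrite /on_grid; congr (h _); apply/funext => i; rewrite ffunE.
  apply: (@le_trans _ _ (d%:R * e')); last first.
    by rewrite /e' mulrCA ler_piMr ?ltW// ltr_pdivrMr// mul1r ltr_nat ltnSn.
  apply: (@coordinatewise_le (fun u => s (k u))) => i y u.
  have [uE|cut] := cell_index_refine t_grid (km u) (kP u).
    by rewrite /s -uE subrr normr0 ltW.
  have [us|su] := leP u (s (k u)).
    rewrite distrC; apply: osc => // p /tP[a am <-].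
    by have [[]|[]] := cut a am; rewrite -!num_lt => *; [left|right].
  apply: osc => //; first exact: ltW.
  move=> p /tP[a am <-].
  by have [[]|[]] := cut a am; rewrite -!num_lt => *; [left|right].
Qed.

End Approximation.

(** * Functions of bounded Hardy-Krause variation *)

Section RealLimits.
Context (R : realType) (T : Type) (F : set_system T).

Lemma cvgr_sum {FF : Filter F} (I : Type) (r : seq I) (P : pred I)
    (f : I -> T -> R) (l : I -> R) :
  (forall i, P i -> f i x @[x --> F] --> l i) ->
  \sum_(i <- r | P i) f i x @[x --> F] --> \sum_(i <- r | P i) l i.
Proof.
move=> fl; elim: r => [|i r IH].
  by rewrite big_nil; under eq_fun do rewrite big_nil; exact: cvg_cst.
rewrite big_cons; under eq_fun do rewrite big_cons.
by case: ifP => // Pi; apply: cvgD => //; exact: fl.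
Qed.

Lemma cvgr_ub {FF : ProperFilter F} (u : T -> R) (l M : R) :
  u x @[x --> F] --> l -> (forall x, u x <= M) -> l <= M.
Proof.
move=> ul uM; apply: (closed_cvg (fun y => y <= M)) ul; first exact: closed_le.
exact: nearW.
Qed.

Lemma cvgr_norm_ub {FF : ProperFilter F} (u : T -> R) (l M : R) :
  u x @[x --> F] --> l -> (forall x, `|u x| <= M) -> `|l| <= M.
Proof. by move=> ul; exact: cvgr_ub (cvg_norm ul). Qed.

End RealLimits.

Section HKSpace.
Context (R : realType) (d : nat).

Definition variation_bounded (k : nat) (f : cube R k -> R) (M : R) : Prop :=
  forall n (B : 'I_n -> hrect R k), hrect_partition B ->
    \sum_(l < n) `|increment f (B l)| <= M.

Lemma variation_bounded_lty k (f : cube R k -> R) M :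
  variation_bounded f M -> (vitali_variation f < +oo)%E.
Proof.
move=> fM; apply: le_lt_trans (ltry M); apply: ge_ereal_sup => _ [n [B [pB ->]]].
by rewrite lee_fin fM.
Qed.

Lemma vitali_variation_ge0 k (f : cube R k -> R) : (0 <= vitali_variation f)%E.
Proof.
have [m [s [s_grid _]]] := @grid_through R [::].
apply: le_trans (sum_grid_increment_le s_grid f).
by rewrite lee_fin sumr_ge0.
Qed.

Lemma variation_lty_bounded k (f : cube R k -> R) :
  (vitali_variation f < +oo)%E -> exists M, variation_bounded f M.
Proof.
move=> fin; exists (fine (vitali_variation f)) => n B pB.
rewrite -lee_fin fineK ?ge0_fin_numE ?vitali_variation_ge0//.
by apply: ereal_sup_ubound; exists n, B.
Qed.

(** Variations are nonnegative, so their sum is finite exactly when all of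
    them are. *)
Lemma hk_norm_ltyP (h : cube R d -> R) :
  (forall S : {set 'I_d}, (0 < #|S|)%N -> exists M : R,
    variation_bounded (fun y : cube R #|S| => h (face_embed y)) M) <->
  (hk_norm h < +oo)%E.
Proof.
split=> [hb|hfin S S0].
  by apply: lte_sum_pinfty => S /hb[M /variation_bounded_lty].
apply: variation_lty_bounded; apply: le_lt_trans hfin.
rewrite /hk_norm (bigD1 S)//= leeDl// sume_ge0// => S' _.
exact: vitali_variation_ge0.
Qed.

Lemma increment_linear k (a b : R) (f g : cube R k -> R) B :
  increment (fun x => a * f x + b * g x) B = a * increment f B + b * increment g B.
Proof.
rewrite /increment !mulr_sumr -big_split/=; apply: eq_bigr => j _.
by rewrite mulrDr !(mulrCA _ (_ ^+ _)).
Qed.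

Lemma HK_ooE (h : cube R d -> R) : @HK R d +oo%E h <-> (hk_norm h < +oo)%E.
Proof. by split=> [[]//|hfin]; split => //; rewrite leey. Qed.

Lemma HK_linear (a b : R) f g : @HK R d +oo%E f -> @HK R d +oo%E g ->
  @HK R d +oo%E (fun x => a * f x + b * g x).
Proof.
move=> /HK_ooE/hk_norm_ltyP ff /HK_ooE/hk_norm_ltyP gf.
apply/HK_ooE/hk_norm_ltyP => S S0.
have [M fM] := ff S S0; have [N gN] := gf S S0.
exists (`|a| * M + `|b| * N) => n B pB.
apply: (@le_trans _ _ (\sum_(l < n)
    (`|a| * `|increment (fun y : cube R #|S| => f (face_embed y)) (B l)| +
     `|b| * `|increment (fun y : cube R #|S| => g (face_embed y)) (B l)|))).
  apply: ler_sum => l _; rewrite increment_linear -!normrM; exact: ler_normD.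
rewrite big_split/= -!mulr_sumr lerD// ler_wpM2l//; [exact: fM|exact: gN].
Qed.

Lemma HK_zero : @HK R d +oo%E (fun=> 0).
Proof.
apply/HK_ooE/hk_norm_ltyP => S S0; exists 0 => n B _.
rewrite big1// => l _; rewrite /increment big1 ?normr0// => j _.
by rewrite mulr0.
Qed.

Lemma HK_span (A : set (cube R d -> R)) :
  A `<=` @HK R d +oo%E -> fun_span A `<=` @HK R d +oo%E.
Proof.
move=> AH _ [n [a [g [Ag ->]]]]; elim: n a g Ag => [|n IH] a g Ag.
  by under eq_fun do rewrite big_ord0; exact: HK_zero.
under eq_fun do rewrite big_ord_recl -[X in _ + X]mul1r.
by apply: HK_linear; [exact/AH|apply: IH].
Qed.

(** The indicator of a box is a product of one-dimensional indicators, and so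
    is its increment; a factor differs from zero only if the box straddles the
    boundary in that coordinate. *)
Lemma box_face_increment (S : {set 'I_d}) (x : cube R d) (B : hrect R #|S|) :
  (forall t, (hr_lo B t)%:num <= (hr_hi B t)%:num) ->
  `|increment (fun y : cube R #|S| => \1_(anchored_box x) (face_embed y) : R) B| <=
  [forall t, (hr_lo B t)%:num <= (x (enum_val t))%:num < (hr_hi B t)%:num]%:R.
Proof.
move=> lohi.
pose c : R := [forall i, (i \notin S) ==> (1 <= (x i)%:num)]%:R.
have indE (y : cube R #|S|) : \1_(anchored_box x) (face_embed y) =
    c * \prod_t ((y t)%:num <= (x (enum_val t))%:num)%R%:R :> R.
  have boxP : anchored_box x (face_embed y) <->
      (forall i, i \notin S -> 1 <= (x i)%:num) /\
      (forall t, (y t)%:num <= (x (enum_val t))%:num).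
    split=> [yx|[H1 H2] i].
      split=> [i iS|t]; first by have := yx i; rewrite face_embedE face_extension_out.
      by have := yx (enum_val t); rewrite face_embedE face_extension_in.
    have [[t ->]|iS] := face_extensionP S i; first by rewrite face_embedE face_extension_in.
    by rewrite face_embedE face_extension_out//; exact: H1.
  rewrite indicE /c; case: (boolP (_ \in _)) => [/set_mem/boxP[H1 H2]|H].
    have -> : [forall i, (i \notin S) ==> (1 <= (x i)%:num)].
      by apply/forallP => i; apply/implyP => /H1.
    by rewrite big1 ?mul1r// => t _; rewrite H2.
  case: (boolP [forall i, (i \notin S) ==> (1 <= (x i)%:num)]) => [/forallP H1|_];
    last by rewrite mul0r.
  have [t xt] : exists t, ~~ ((y t)%:num <= (x (enum_val t))%:num).
    apply/existsP; rewrite -negb_forall; apply: contra H => /forallP H2.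
    by apply/mem_set/boxP; split=> // i iS; exact: implyP (H1 i) iS.
  by rewrite (bigD1 t)//= (negPf xt) mul0r mulr0.
rewrite /increment; under eq_bigr do rewrite indE mulrCA.
rewrite -mulr_sumr normrM.
have c1 : `|c| <= 1 by rewrite /c normr_nat lern1 leq_b1.
apply: le_trans (ler_wpM2r (normr_ge0 _) c1) _; rewrite mul1r.
have -> : \sum_(j : {ffun 'I_#|S| -> bool}) (-1) ^+ (\sum_(i < #|S|) j i) *
    \prod_t ((if j t then hr_lo B t else hr_hi B t)%:num <= (x (enum_val t))%:num)%R%:R
  = \prod_t \sum_(b : bool) ((-1) ^+ b *
    ((if b then hr_lo B t else hr_hi B t)%:num <= (x (enum_val t))%:num)%R%:R) :> R.
  rewrite bigA_distr_bigA/=; apply: eq_bigr => j _.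
  by rewrite -prodrXr -big_split.
rewrite normr_prod; case: (boolP [forall t, (hr_lo B t)%:num <= _ < _]) => [/forallP H|].
  rewrite big1// => t _; rewrite big_bool/= expr0 expr1 mul1r.
  have /andP[lx xh] := H t; rewrite lx (lt_geF xh) addr0 mulr1.
  by rewrite normrN1.
move=> /forallPn[t]; rewrite negb_and -ltNge -leNgt => H.
rewrite (bigD1 t)//= big_bool/= expr0 expr1 mul1r.
suff -> : -1 * ((hr_lo B t)%:num <= (x (enum_val t))%:num)%R%:R +
  ((hr_hi B t)%:num <= (x (enum_val t))%:num)%R%:R = 0 :> R by rewrite normr0 mul0r.
case/orP: H => H.
  by rewrite (lt_geF H) (lt_geF (lt_le_trans H (lohi t))) mulr0 addr0.
by rewrite H (le_trans (lohi t) H) mulr1 addNr.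
Qed.

Lemma hrect_nonempty_le k (B : hrect R k) : hrect_set B !=set0 ->
  forall t, (hr_lo B t)%:num <= (hr_hi B t)%:num.
Proof.
move=> [x xB] t; have := xB t; rewrite in_itv/= => /andP[l1 l2].
by apply: (@le_trans _ _ (x t)%:num); [move: l1; case: (hr_lopen B t)|
  move: l2; case: (hr_ropen B t)] => //= /ltW.
Qed.

(** All boxes straddling the corner [x] contain the points slightly above [x],
    so a partition contains at most one of them. *)
Lemma box_face_variation (S : {set 'I_d}) (x : cube R d) :
  variation_bounded (fun y : cube R #|S| =>
    \1_(anchored_box x) (face_embed y) : R) 1.
Proof.
move=> n B [Bne Bdisj _].
pose Q l := [forall t, (hr_lo (B l) t)%:num <= (x (enum_val t))%:num < (hr_hi (B l) t)%:num].
apply: (@le_trans _ _ (\sum_(l < n) (Q l)%:R)).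
  by apply: ler_sum => l _; apply: box_face_increment; exact: hrect_nonempty_le.
have [l0 Ql0|noQ] := pickP Q; last first.
  by rewrite big1 ?ler01// => l _; rewrite noQ.
rewrite (bigD1 l0)//= Ql0 big1 ?addr0// => l ll0.
case: (boolP (Q l)) => // Ql; exfalso.
move/trivIsetP: Bdisj => /(_ l l0 I I ll0); apply/eqP/set0P.
pose u (t : 'I_#|S|) := (x (enum_val t))%:num.
pose v t := Num.min (hr_hi (B l) t)%:num (hr_hi (B l0) t)%:num.
have uv t : u t < v t.
  by rewrite lt_min; have /andP[_ ->] := forallP Ql t; have /andP[_ ->] := forallP Ql0 t.
have z0 t : 0 <= (u t + v t) / 2.
  have : 0 <= u t by rewrite /u ge0.
  by have := uv t; lra.
have z1 t : (u t + v t) / 2 <= 1.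
  have : v t <= 1 by rewrite /v ge_min le1.
  by have := uv t; lra.
have vl t : v t <= (hr_hi (B l) t)%:num by rewrite ge_min lexx.
have vl0 t : v t <= (hr_hi (B l0) t)%:num by rewrite ge_min lexx orbT.
exists (fun t => Itv01 (z0 t) (z1 t)); split=> t; rewrite in_itv/=.
  have /andP[lu _] := forallP Ql t; have := uv t; have := vl t.
  rewrite -/(u t) in lu => ? ?.
  by apply/andP; split; [case: (hr_lopen _ _)|case: (hr_ropen _ _)]; rewrite /=; lra.
have /andP[lu _] := forallP Ql0 t; have := uv t; have := vl0 t.
rewrite -/(u t) in lu => ? ?.
by apply/andP; split; [case: (hr_lopen _ _)|case: (hr_ropen _ _)]; rewrite /=; lra.
Qed.

Lemma increment_cvg k (f : nat -> cube R k -> R) (g : cube R k -> R) B :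
  (forall x, f n x @[n --> \oo] --> g x) ->
  increment (f n) B @[n --> \oo] --> increment g B.
Proof.
by move=> fg; apply: cvgr_sum => j _; apply: cvgMl_tmp; exact: fg.
Qed.

(** Variation is lower semicontinuous under pointwise convergence. *)
Lemma mono_closure_HK : mono_closure (@box_indicators R d) `<=` @HK R d +oo%E.
Proof.
move=> g [f [Ff fg]]; apply/HK_ooE/hk_norm_ltyP => S S0; exists 1 => n B pB.
apply: (@cvgr_ub _ nat \oo _ (fun k => \sum_(l < n)
    `|increment (fun y : cube R #|S| => f k (face_embed y)) (B l)|)).
  apply: cvgr_sum => l _; apply: cvg_norm; apply: increment_cvg => y.
  by have [_] := fg (face_embed y).
move=> k; have [x _ <-] := Ff k; exact: box_face_variation.
Qed.

Lemma mono_closure_sub (A : set (cube R d -> R)) : A `<=` mono_closure A.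
Proof.
move=> f Af; exists (fun=> f); split => // x; split => //; exact: cvg_cst.
Qed.

End HKSpace.

(** * Extension of functionals by density *)

Section UltraLimit.
Context (R : realType).

Lemma exists_nat_ultrafilter : exists U : set_system nat,
  UltraFilter U /\ \oo `<=` U.
Proof. exact: ultraFilterLemma. Qed.

(** Limits along this ultrafilter are linear and exist for all bounded
    sequences, which makes it possible to pass to a limit before knowing that
    it exists. *)
Definition nat_ultra : set_system nat := projT1 (cid exists_nat_ultrafilter).

Lemma nat_ultra_ultra : UltraFilter nat_ultra.
Proof. by rewrite /nat_ultra; case: cid => U []. Qed.

Lemma nat_ultra_proper : ProperFilter nat_ultra.
Proof. exact: (@ultra_proper _ _ nat_ultra_ultra). Qed.

Lemma nat_ultra_oo (u : nat -> R) (l : R) :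
  u n @[n --> \oo] --> l -> u n @[n --> nat_ultra] --> l.
Proof.
move=> ul A /ul; rewrite /nbhs/=.
by have : \oo `<=` nat_ultra; [rewrite /nat_ultra; case: cid => U []|exact].
Qed.

Definition ulim (u : nat -> R) : R := lim (u n @[n --> nat_ultra]).

(** By compactness the ultrafilter has a cluster point, and an ultrafilter
    converges to each of its cluster points. *)
Lemma ulim_cvg (u : nat -> R) (M : R) : (forall n, `|u n| <= M) ->
  u n @[n --> nat_ultra] --> ulim u.
Proof.
move=> uM; have UU := nat_ultra_ultra; have UP := nat_ultra_proper.
have [c [_ clc]] : `[- M, M] `&` cluster (u n @[n --> nat_ultra]) !=set0.
  apply: segment_compact.
  have H : nat_ultra (u @^-1` `[- M, M]).
    by apply: filterE => n /=; rewrite in_itv/= -ler_norml.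
  exact: H.
apply/cvg_ex; exists c => B cB.
have [//|UB] := in_ultra_setVsetC (u @^-1` B) UU.
by have [x [nBx Bx]] := clc (~` B) B UB cB; have := nBx Bx.
Qed.

Lemma ulimE (u : nat -> R) l : u n @[n --> nat_ultra] --> l -> ulim u = l.
Proof. by move=> ul; have UP := nat_ultra_proper; apply: cvg_lim. Qed.

End UltraLimit.

Section FunctionalExtension.
Context (R : realType) (d : nat).
Local Notation fn := (cube R d -> R).
Local Notation boxes := (@box_indicators R d).
Local Notation spanG := (fun_span (mono_closure boxes)).

Lemma fun_span_linear (A : set fn) (a b : R) f g : fun_span A f -> fun_span A g ->
  fun_span A (fun x => a * f x + b * g x).
Proof.
move=> [n [p [u [Au ->]]]] [m [q [v [Av ->]]]].
exists (n + m)%N,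
  (fun i : 'I_(n + m) => match fintype.split i with inl k => a * p k | inr k => b * q k end),
  (fun i : 'I_(n + m) => match fintype.split i with inl k => u k | inr k => v k end).
split=> [i|]; first by case: (fintype.split i).
apply/funext => x; rewrite big_split_ord/= !mulr_sumr; congr (_ + _).
  by apply: eq_bigr => i _; rewrite (unsplitK (inl _ i)) mulrA.
by apply: eq_bigr => i _; rewrite (unsplitK (inr _ i)) mulrA.
Qed.

Lemma fun_span_sub (A : set fn) : A `<=` fun_span A.
Proof.
move=> f Af; exists 1%N, (fun=> 1), (fun=> f); split=> //.
by apply/funext => x; rewrite big_ord1 mul1r.
Qed.

Lemma fun_span0 (A : set fn) : fun_span A (fun=> 0).
Proof.
exists 0%N, (fun=> 0), (fun=> fun=> 0); split=> [[]//|].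
by apply/funext => x; rewrite big_ord0.
Qed.

Lemma linear_on0 (A : set fn) phi : A (fun=> 0) -> linear_on A phi -> phi (fun=> 0) = 0.
Proof.
by move=> A0 /(_ 0 0 _ _ A0 A0); rewrite !mul0r !addr0.
Qed.

Lemma linear_on_sum (A : set fn) phi n (a : 'I_n -> R) (g : 'I_n -> fn) :
  linear_on (fun_span A) phi -> (forall i, A (g i)) ->
  phi (fun x => \sum_(i < n) a i * g i x) = \sum_(i < n) a i * phi (g i).
Proof.
move=> lphi; elim: n a g => [|n IH] a g Ag.
  under eq_fun do rewrite big_ord0; rewrite big_ord0.
  exact: linear_on0 (fun_span0 A) lphi.
rewrite big_ord_recl -IH//; under eq_fun do rewrite big_ord_recl -[X in _ + X]mul1r.
rewrite lphi ?mul1r//; first exact: fun_span_sub.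
by exists n, (fun i => a (lift ord0 i)), (fun i => g (lift ord0 i)).
Qed.

Lemma sup_norm_lt (f : fn) (M r : R) : M < r -> (forall x, `|f x| <= M) ->
  (sup_norm f < r%:E)%E.
Proof.
move=> Mr fM; apply: (@le_lt_trans _ _ M%:E); last by rewrite lte_fin.
by apply: ge_ereal_sup => _ [x _ <-]; rewrite lee_fin.
Qed.

Lemma sup_norm_ub (f : fn) x : (`|f x|%:E <= sup_norm f)%E.
Proof. by apply: ereal_sup_ubound; exists x. Qed.

Lemma sup_norm_ub_lt (f : fn) r x : (sup_norm f < r%:E)%E -> `|f x| <= r.
Proof. by move=> fr; rewrite -lee_fin (le_trans (sup_norm_ub f x))// ltW. Qed.

Definition sup_bounded_on (A : set fn) (phi : fn -> R) (C : R) : Prop :=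
  forall g M, A g -> (forall x, `|g x| <= M) -> `|phi g| <= C * M.

(** Continuity at zero, rescaled. *)
Lemma sup_continuous_bounded (A : set fn) phi :
  linear_on (fun_span A) phi -> sup_continuous_on (fun_span A) phi ->
  exists2 C, 0 <= C & sup_bounded_on (fun_span A) phi C.
Proof.
move=> lphi cphi; have phi0 := linear_on0 (fun_span0 A) lphi.
have [r r0 rP] := cphi _ (fun_span0 A) 1 ltr01.
exists (2 / r) => [|g M Ag gM]; first by rewrite divr_ge0// ltW.
have M0 : 0 <= M by exact: le_trans (normr_ge0 _) (gM (fun=> 0%:i01)).
move: M0; rewrite le_eqVlt => /orP[/eqP M0|M0].
  suff -> : g = fun=> 0 by rewrite phi0 normr0 -M0 mulr0.
  by apply/funext => x; apply/eqP; rewrite -normr_le0 M0.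
pose k := r / (2 * M); have k0 : 0 < k by rewrite divr_gt0// mulr_gt0.
have := rP (fun x => k * g x + 0 * g x) (fun_span_linear _ _ Ag Ag).
rewrite lphi// mul0r addr0 phi0 subr0 normrM gtr0_norm// => H.
rewrite -(ler_pM2l k0); apply: le_trans (ltW (H _)) _; last first.
  by rewrite /k le_eqVlt; apply/orP; left; apply/eqP; field; rewrite ?gt_eqF.
apply: (@sup_norm_lt _ (r / 2)) => [|x]; first by lra.
rewrite mul0r addr0 subr0 normrM gtr0_norm//.
apply: (le_trans (ler_wpM2l (ltW k0) (gM x))).
by rewrite /k le_eqVlt; apply/orP; left; apply/eqP; field; rewrite ?gt_eqF.
Qed.

Definition unif_approx (h : fn) (g : nat -> fn) : Prop :=
  (forall N, spanG (g N)) /\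
  forall e : R, 0 < e -> \forall N \near \oo, forall x, `|h x - g N x| <= e.

Definition approximable (h : fn) : Prop := exists g, unif_approx h g.

Definition approximants (h : fn) : nat -> fn := xget (fun=> fun=> 0) (unif_approx h).

Lemma approxP h : approximable h -> unif_approx h (approximants h).
Proof. by move=> /(xgetPex (fun=> fun=> 0)). Qed.

(** The value does not depend on the chosen approximation: see [ext_cvg]. *)
Definition unif_extension (phi : fn -> R) (h : fn) : R := limn (fun N => phi (approximants h N)).

(** The properties of the sample paths that are to be extended. *)
Definition regular_functional (phi : fn -> R) : Prop :=
  [/\ linear_on spanG phi, mono_continuous_on boxes phi & sup_continuous_on spanG phi].

Lemma linear_onB (A : set fn) phi f g : linear_on A phi -> A f -> A g ->
  phi (fun x => f x - g x) = phi f - phi g.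
Proof.
move=> lphi Af Ag; have := lphi 1 (-1) f g Af Ag.
by under eq_fun do rewrite mul1r mulN1r; rewrite mul1r mulN1r.
Qed.

Lemma fun_spanB (A : set fn) f g : fun_span A f -> fun_span A g ->
  fun_span A (fun x => f x - g x).
Proof.
move=> Af Ag; have := fun_span_linear 1 (-1) Af Ag.
by under eq_fun do rewrite mul1r mulN1r.
Qed.

(** Two approximations of the same function are uniformly close to each other,
    and a bounded functional does not separate them in the limit. *)
Lemma ext_cvg phi h g : regular_functional phi -> unif_approx h g ->
  phi (g N) @[N --> \oo] --> unif_extension phi h.
Proof.
move=> [lphi _ cphi] gh; have [C C0 CP] := sup_continuous_bounded lphi cphi.
have ah := approxP (ex_intro _ g gh).
have close g1 g2 : unif_approx h g1 -> unif_approx h g2 -> forall e, 0 < e ->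
    exists N0, forall N1 N2, (N0 <= N1)%N -> (N0 <= N2)%N ->
      `|phi (g1 N1) - phi (g2 N2)| <= e.
  move=> [S1 a1] [S2 a2] e e0.
  pose e' := e / (2 * (C + 1)).
  have e'0 : 0 < e' by rewrite divr_gt0// mulr_gt0// ltr_wpDl.
  have [K1 _ K1P] := a1 _ e'0; have [K2 _ K2P] := a2 _ e'0.
  exists (maxn K1 K2) => N1 N2; rewrite !geq_max => /andP[N11 _] /andP[_ N22].
  rewrite -(linear_onB lphi)//.
  apply: (@le_trans _ _ (C * (2 * e'))).
    apply: CP => [|x]; first exact: fun_spanB.
    have := K1P _ N11 x; have := K2P _ N22 x; rewrite !ler_norml.
    by move=> /andP[? ?] /andP[? ?]; apply/andP; split; lra.
  apply: (@le_trans _ _ ((C + 1) * (2 * e'))).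
    by apply: ler_wpM2r; rewrite ?lerDl// mulr_ge0// ltW.
  rewrite le_eqVlt; apply/orP; left; apply/eqP; rewrite /e'; field.
  by rewrite gt_eqF// ltr_wpDl.
have cvgh : phi (approximants h N) @[N --> \oo] --> unif_extension phi h.
  apply/cauchy_cvgP/cauchy_exP => e e0.
  have e20 : 0 < e / 2 by rewrite divr_gt0.
  have [N0 N0P] := close _ _ ah ah _ e20.
  exists (phi (approximants h N0)); exists N0 => // N /= N0N.
  by rewrite /ball/= (le_lt_trans (N0P _ _ _ _))// ltr_pdivrMr// ltr_pMr// ltr1n.
have : phi (g N) - phi (approximants h N) @[N --> \oo] --> 0.
  apply/cvgrPdist_le => e e0; have [N0 N0P] := close _ _ gh ah _ e0.
  by exists N0 => // N /= N0N; rewrite sub0r normrN N0P.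
move=> /cvgD /(_ cvgh); rewrite add0r; apply: cvg_trans.
by apply: near_eq_cvg; near=> N; rewrite /= subrK.
Unshelve. all: by end_near. Qed.

Lemma unif_approx_cst f : spanG f -> unif_approx f (fun=> f).
Proof.
by move=> Sf; split=> // e e0; apply: nearW => N x; rewrite subrr normr0 ltW.
Qed.

Lemma ext_span phi f : regular_functional phi -> spanG f -> unif_extension phi f = phi f.
Proof.
move=> gphi Sf; apply: (@cvg_unique _ _ (phi f @[N --> \oo])) => //.
  exact: ext_cvg gphi (unif_approx_cst Sf).
exact: cvg_cst.
Qed.

Lemma unif_approx_linear a b f g f_ g_ : unif_approx f f_ -> unif_approx g g_ ->
  unif_approx (fun x => a * f x + b * g x) (fun N x => a * f_ N x + b * g_ N x).
Proof.
move=> [Sf ff] [Sg gg]; split=> [N|e e0]; first exact: fun_span_linear.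
pose e' := e / (`|a| + `|b| + 1).
have ab0 : 0 < `|a| + `|b| + 1 by rewrite ltr_wpDl// addr_ge0.
have e'0 : 0 < e' by rewrite divr_gt0.
have := gg _ e'0; have := ff _ e'0; apply: filterS2 => N fN gN x.
have -> : a * f x + b * g x - (a * f_ N x + b * g_ N x) =
  a * (f x - f_ N x) + b * (g x - g_ N x) by ring.
rewrite (le_trans (ler_normD _ _))// !normrM.
apply: (@le_trans _ _ (`|a| * e' + `|b| * e')).
  by rewrite lerD// ler_wpM2l.
rewrite -mulrDl /e' mulrCA ler_piMr ?ltW// ltr_pdivrMr// mul1r ltrDl//.
Qed.

Lemma ext_linear phi a b f g : regular_functional phi -> approximable f -> approximable g ->
  unif_extension phi (fun x => a * f x + b * g x) =
    a * unif_extension phi f + b * unif_extension phi g.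
Proof.
move=> gphi /approxP af /approxP ag.
have lim1 := ext_cvg gphi (unif_approx_linear a b af ag).
have [lphi _ _] := gphi.
have lim2 : a * phi (approximants f N) + b * phi (approximants g N) @[N --> \oo] -->
    a * unif_extension phi f + b * unif_extension phi g.
  by apply: cvgD; apply: cvgMl_tmp; exact: ext_cvg.
have E : (fun N => phi (fun x => a * approximants f N x + b * approximants g N x)) =
    (fun N => a * phi (approximants f N) + b * phi (approximants g N)).
  by apply/funext => N; rewrite lphi//; [exact: af.1|exact: ag.1].
rewrite E in lim1; exact: (cvg_unique _ lim1 lim2).
Qed.

Lemma ext_bounded phi : regular_functional phi -> exists2 C, 0 <= C &
  sup_bounded_on approximable (unif_extension phi) C.
Proof.
move=> gphi; have [lphi _ cphi] := gphi.
have [C C0 CP] := sup_continuous_bounded lphi cphi.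
exists C => // h M /approxP ah hM.
have := cvg_norm (ext_cvg gphi ah) => lim1.
apply/ler_addgt0Pr => e e0.
pose e' := e / (C + 1).
have C10 : 0 < C + 1 by rewrite ltr_wpDl.
have e'0 : 0 < e' by rewrite divr_gt0.
refine (closed_cvg (fun y : R => y <= C * M + e) (@closed_le _ _) _ _ (lim1 _)).
have := ah.2 _ e'0; apply: filterS => N aN.
apply: (@le_trans _ _ (C * (M + e'))).
  apply: CP => [|x]; first exact: ah.1.
  have := aN x; have := hM x; rewrite !ler_norml.
  by move=> /andP[? ?] /andP[? ?]; apply/andP; split; lra.
rewrite mulrDr lerD2l /e' mulrCA ler_piMr ?ltW//.
by rewrite ltr_pdivrMr// mul1r ltrDl.
Qed.

Lemma ext_sup_continuous phi (A : set fn) : regular_functional phi -> A `<=` approximable ->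
  sup_unif_continuous_on A (unif_extension phi).
Proof.
move=> gphi Aa; have [C C0 CP] := ext_bounded gphi => e e0.
have C10 : 0 < C + 1 by rewrite ltr_wpDl.
exists (e / (C + 1)) => [|f g /Aa af /Aa ag fg]; first by rewrite divr_gt0.
have -> : unif_extension phi g - unif_extension phi f =
    unif_extension phi (fun x => 1 * g x + (-1) * f x).
  by rewrite ext_linear// mul1r mulN1r.
apply: (@le_lt_trans _ _ (C * (e / (C + 1)))).
  apply: CP => [|x].
    by exists (fun N x => 1 * approximants g N x + (-1) * approximants f N x);
      apply: unif_approx_linear; exact: approxP.
  by rewrite mul1r mulN1r; exact: sup_norm_ub_lt fg.
by rewrite mulrCA gtr_pMr// ltr_pdivrMr// mul1r ltrDl.
Qed.

Lemma hk_approx_seq h : @HK R d +oo%E h ->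
  exists (n : nat -> nat) (a : forall N, 'I_(n N) -> R) (g : forall N, 'I_(n N) -> fn),
  [/\ forall N i, mono_closure boxes (g N i),
      forall N, \sum_i `|a N i| <= hk_bound h &
      unif_approx h (fun N x => \sum_i a N i * g N i x)].
Proof.
move=> /HK_ooE hfin.
have wit (N : nat) : {n & {a : 'I_n -> R & {g : 'I_n -> fn |
  [/\ forall i, mono_closure boxes (g i),
      \sum_i `|a i| <= hk_bound h &
      forall x, `|h x - \sum_i a i * g i x| <= N.+1%:R^-1]}}}.
  have N0 : 0 < N.+1%:R^-1 :> R by rewrite invr_gt0.
  by have /cid[n /cid[a /cid[g gP]]] := hk_approximation hfin N0; exists n, a, g.
pose n N := projT1 (wit N); pose a N := projT1 (projT2 (wit N)).
pose g N := sval (projT2 (projT2 (wit N))).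
have gP N := svalP (projT2 (projT2 (wit N))).
exists n, a, g; split=> [N i|N|]; [|by have [_ H _] := gP N; exact: H|].
  by have [H _ _] := gP N; exact: H.
split=> [N|e e0]; first by exists (n N), (a N), (g N); split=> // i; have [H _ _] := gP N; exact: H.
have := near_infty_natSinv_lt (PosNum e0); apply: filterS => N /= Ne x.
by have [_ _ gx] := gP N; exact: le_trans (gx x) (ltW Ne).
Qed.

Lemma HK_approximable : @HK R d +oo%E `<=` approximable.
Proof.
by move=> h /hk_approx_seq[n [a [g [_ _ ?]]]]; exists (fun N x => \sum_i a N i * g N i x).
Qed.

End FunctionalExtension.

(** * Bounded functionals on the space of bounded functions *)

Section DualMap.
Context (R : realType) (d : nat).
Local Notation fn := (cube R d -> R).
Local Notation boxes := (@box_indicators R d).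
Local Notation spanG := (fun_span (mono_closure boxes)).
Local Notation LF := (linfty R boxes).

Definition bounded_functional (l : LF -> R) (K : R) : Prop :=
  (forall a z z', l (a *: z + z') = a * l z + l z') /\
  (forall z, `|l z| <= K * `|z|).

Definition box_point f (Ff : boxes f) : set_type boxes := exist _ f (mem_set Ff).

Lemma linfty_norm_ub (T : Type) (z : linfty R T) t : `|z t| <= `|z|.
Proof. exact: linfty_norm_ubound. Qed.

Lemma linftyB (T : Type) (z v : linfty R T) t : (z - v) t = z t - v t.
Proof. by []. Qed.

Lemma ulim_functional (l : nat -> LF -> R) (K : R) :
  (forall n, bounded_functional (l n) K) ->
  bounded_functional (fun z => ulim (fun n => l n z)) K.
Proof.
move=> lb; have UP := nat_ultra_proper.
have lcvg z : l n z @[n --> nat_ultra] --> ulim (fun n => l n z).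
  by apply: (@ulim_cvg _ _ (K * `|z|)) => n; have [_] := lb n.
split=> [a z z'|z].
  apply: ulimE; under eq_fun do rewrite (lb _).1.
  by apply: cvgD => //; apply: cvgMl_tmp.
by apply: cvgr_norm_ub (lcvg z) _ => n; have [_] := lb n.
Qed.

(** For a monotone limit of boxes the functional is a limit of evaluations,
    taken along the ultrafilter because arbitrary elements of the space need
    not respect monotone limits. *)
Lemma mono_closure_functional g : mono_closure boxes g ->
  exists2 l, bounded_functional l 1 & forall phi z,
    mono_continuous_on boxes phi -> restriction_of phi z -> l z = phi g.
Proof.
move=> [f [Ff fg]].
exists (fun z => ulim (fun k => z (box_point (Ff k)))).
  apply: ulim_functional => k; split=> // z.
  by rewrite mul1r linfty_norm_ub.
move=> phi z mphi zphi; apply: ulimE; apply: nat_ultra_oo.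
under eq_fun do rewrite zphi/=; exact: mphi.
Qed.

(** The approximations of [h] have coefficients of absolute sum at most
    [hk_bound h], so the functionals that represent them are uniformly bounded
    and have a limit along the ultrafilter. *)
Lemma hk_functional h : @HK R d +oo%E h ->
  exists2 l, bounded_functional l (hk_bound h) & forall phi z,
    regular_functional phi -> restriction_of phi z -> l z = unif_extension phi h.
Proof.
move=> /hk_approx_seq[n [a [g [Gg aK gh]]]].
have /choice[l lP] : forall p : {N : nat & 'I_(n N)}, exists l,
    bounded_functional l 1 /\ forall phi z, mono_continuous_on boxes phi ->
      restriction_of phi z -> l z = phi (g (projT1 p) (projT2 p)).
  by move=> p; have [l ? ?] := mono_closure_functional (Gg (projT1 p) (projT2 p)); exists l.
exists (fun z => ulim (fun N => \sum_(i < n N) a N i * l (existT _ N i) z)).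
  apply: ulim_functional => N; split=> [b z z'|z].
    rewrite mulr_sumr -big_split/=; apply: eq_bigr => i _.
    by rewrite (lP _).1.1 mulrDr mulrCA.
  apply: (le_trans (ler_norm_sum _ _ _)).
  apply: (le_trans _ (ler_wpM2r (normr_ge0 z) (aK N))).
  rewrite mulr_suml; apply: ler_sum => i _; rewrite normrM ler_wpM2l//.
  by have := (lP (existT _ N i)).1.2 z; rewrite mul1r.
move=> phi z gphi zphi; apply: ulimE; apply: nat_ultra_oo.
have [lphi mphi _] := gphi.
have -> : (fun N => \sum_(i < n N) a N i * l (existT _ N i) z) =
    (fun N => phi (fun x => \sum_i a N i * g N i x)).
  apply/funext => N; rewrite (linear_on_sum _ lphi)//.
  by apply: eq_bigr => i _; rewrite ((lP _).2 phi).
exact: ext_cvg.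
Qed.

Definition dual_map (z : LF) (h : fn) : R :=
  if pselect (@HK R d +oo%E h) is left Hh
  then s2val (cid2 (hk_functional Hh)) z else 0.

Lemma dual_map_linear h a z z' :
  dual_map (a *: z + z') h = a * dual_map z h + dual_map z' h.
Proof.
rewrite /dual_map; case: pselect => [Hh|_]; last by rewrite mulr0 addr0.
by case: cid2 => l /= [].
Qed.

Lemma dual_map_bound h z : @HK R d +oo%E h ->
  `|dual_map z h| <= hk_bound h * `|z|.
Proof.
by rewrite /dual_map; case: pselect => // Hh _; case: cid2 => l /= [].
Qed.

Lemma dual_map_ext h phi z : @HK R d +oo%E h -> regular_functional phi ->
  restriction_of phi z -> dual_map z h = unif_extension phi h.
Proof.
rewrite /dual_map; case: pselect => // Hh _; case: cid2 => l /= _.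
by move=> H gphi zphi; exact: H.
Qed.

Lemma dual_mapB h z z' : dual_map (z - z') h = dual_map z h - dual_map z' h.
Proof. by rewrite -[z - z']addrC -scaleN1r dual_map_linear mulN1r addrC. Qed.

(** The dual map extends the elements of this set faithfully; the weak limit
    is only known to lie in its closure. *)
Definition regular_elements : set LF :=
  [set z | exists2 phi, regular_functional phi & restriction_of phi z].

Lemma closure_regularP z : closure regular_elements z -> forall e, 0 < e ->
  exists v phi, [/\ regular_functional phi, restriction_of phi v & `|z - v| < e].
Proof.
move=> cz e e0; have [v [[phi gphi vphi] zv]] := cz _ (nbhsx_ballx z _ e0).
by exists v, phi; split=> //; rewrite -ball_normE in zv.
Qed.

Lemma boxes_HK : boxes `<=` @HK R d +oo%E.
Proof. by move=> f /mono_closure_sub/mono_closure_HK. Qed.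

Lemma boxes_span : boxes `<=` spanG.
Proof. by move=> f /mono_closure_sub/fun_span_sub. Qed.

Lemma spanG_HK : spanG `<=` @HK R d +oo%E.
Proof. exact: (HK_span (@mono_closure_HK R d)). Qed.

Lemma hk_bound_ge0 h : @HK R d +oo%E h -> 0 <= hk_bound h.
Proof.
move=> Hh; rewrite addr_ge0// fine_ge0//; apply: sume_ge0 => S _.
exact: vitali_variation_ge0.
Qed.

Lemma dual_map_close h z v e : @HK R d +oo%E h -> 0 < e ->
  `|z - v| < e / (hk_bound h + 1) -> `|dual_map z h - dual_map v h| < e.
Proof.
move=> Hh e0 zv; have K0 := hk_bound_ge0 Hh.
have K1 : 0 < hk_bound h + 1 by rewrite ltr_wpDl.
rewrite -dual_mapB (le_lt_trans (dual_map_bound _ Hh))//.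
apply: (@le_lt_trans _ _ ((hk_bound h + 1) * `|z - v|)).
  by rewrite ler_wpM2r// lerDl.
by rewrite mulrC -ltr_pdivlMr.
Qed.

Section Closure.
Variables (z : LF) (cz : closure regular_elements z).

(** Both sides are continuous in the element and agree on [regular_elements]. *)
Lemma dual_map_box f (Ff : boxes f) : dual_map z f = z (box_point Ff).
Proof.
apply/eqP; rewrite -subr_eq0 -normr_le0; apply/ler_addgt0Pr => e e0; rewrite add0r.
have Hf := boxes_HK Ff; have K0 := hk_bound_ge0 Hf.
have K1 : 0 < hk_bound f + 1 by rewrite ltr_wpDl.
have e2 : 0 < e / 2 by rewrite divr_gt0.
have e' : 0 < Num.min (e / 2) (e / 2 / (hk_bound f + 1)).
  by rewrite lt_min e2 divr_gt0.
have [v [phi [gphi vphi]]] := closure_regularP cz e'.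
rewrite lt_min => /andP[zv1 zv2].
have zv := dual_map_close Hf e2 zv2.
have zfvf := le_lt_trans (linfty_norm_ub (z - v) (box_point Ff)) zv1.
have vE : dual_map v f = v (box_point Ff).
  by rewrite (dual_map_ext Hf gphi vphi) (ext_span gphi (boxes_span Ff)) vphi.
have -> : dual_map z f - z (box_point Ff) = (dual_map z f - dual_map v f) -
  (z - v) (box_point Ff) by rewrite vE linftyB; ring.
by rewrite (le_trans (ler_normB _ _))// (splitr e) lerD// ltW.
Qed.

(** For three fixed functions the identity involves three bounded functionals
    of the element, so it passes from [regular_elements] to the closure. *)
Lemma dual_map_linear_on : linear_on (@HK R d +oo%E) (dual_map z).
Proof.
move=> a b f g Hf Hg; have Hfg := HK_linear a b Hf Hg.
apply/eqP; rewrite -subr_eq0 -normr_le0; apply/ler_addgt0Pr => e e0; rewrite add0r.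
pose e1 := e / (1 + (`|a| + `|b|)).
have e10 : 0 < e1 by rewrite divr_gt0// ltr_pwDl// addr_ge0.
pose K h := @hk_bound R d h + 1.
have K1 h : @HK R d +oo%E h -> 0 < K h by move=> /hk_bound_ge0 ?; rewrite ltr_wpDl.
have e'0 : 0 < Num.min (e1 / K (fun x => a * f x + b * g x))
    (Num.min (e1 / K f) (e1 / K g)).
  by rewrite !lt_min !divr_gt0 ?K1.
have [v [phi [gphi vphi]]] := closure_regularP cz e'0.
rewrite !lt_min => /andP[zv1 /andP[zv2 zv3]].
have {}zv1 := dual_map_close Hfg e10 zv1.
have {}zv2 := dual_map_close Hf e10 zv2.
have {}zv3 := dual_map_close Hg e10 zv3.
have vE : dual_map v (fun x => a * f x + b * g x) = a * dual_map v f + b * dual_map v g.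
  by rewrite !(dual_map_ext _ gphi vphi)// ext_linear//; exact: HK_approximable.
set D := dual_map z _ in zv1 *.
have -> : D - (a * dual_map z f + b * dual_map z g) =
  (D - dual_map v (fun x => a * f x + b * g x)) -
  (a * (dual_map z f - dual_map v f) + b * (dual_map z g - dual_map v g)).
  by rewrite vE; ring.
apply: (le_trans (ler_normB _ _)).
apply: (@le_trans _ _ (e1 + (`|a| * e1 + `|b| * e1))).
  apply: lerD; first exact: ltW.
  by rewrite (le_trans (ler_normD _ _))// !normrM lerD// ler_wpM2l// ltW.
rewrite -mulrDl -{1}[e1]mul1r -mulrDl /e1 mulrC divfK//.
Qed.

(** The values on boxes are evaluations, hence close to those of a nearby
    regular element uniformly along the sequence. *)
Lemma dual_map_mono : mono_continuous_on boxes (dual_map z).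
Proof.
move=> f g Ff fg; have Gg : mono_closure boxes g by exists f.
have Hg := mono_closure_HK Gg.
apply/cvgrPdist_le => e e0.
have e3 : 0 < e / 3 by rewrite divr_gt0.
have K1 : 0 < hk_bound g + 1 by rewrite ltr_wpDl// hk_bound_ge0.
have e'0 : 0 < Num.min (e / 3) (e / 3 / (hk_bound g + 1)).
  by rewrite lt_min e3 divr_gt0.
have [v [phi [gphi vphi]]] := closure_regularP cz e'0.
rewrite lt_min => /andP[zv1 zv2].
have {}zv2 := dual_map_close Hg e3 zv2.
have [_ mphi _] := gphi.
have vg : dual_map v g = phi g.
  by rewrite (dual_map_ext Hg gphi vphi) (ext_span gphi (fun_span_sub Gg)).
have /cvgrPdist_le/(_ _ e3) := mphi f g Ff fg; apply: filterS => k phik.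
have zfk : dual_map z (f k) - phi (f k) = (z - v) (box_point (Ff k)).
  by rewrite dual_map_box linftyB vphi.
have zvk : `|dual_map z (f k) - phi (f k)| <= e / 3.
  by rewrite zfk (le_trans (linfty_norm_ub _ _))// ltW.
have -> : dual_map z g - dual_map z (f k) = (dual_map z g - dual_map v g) +
  (phi g - phi (f k)) - (dual_map z (f k) - phi (f k)) by rewrite vg; ring.
have -> : e = e / 3 + e / 3 + e / 3 by field.
apply: (le_trans (ler_normB _ _)); rewrite lerD//.
by rewrite (le_trans (ler_normD _ _))// lerD// ltW.
Qed.

(** The functionals attached to the functions of the set are uniformly
    bounded, so the element can be replaced by a regular one, whose extension
    is Lipschitz. *)
Lemma dual_map_unif_continuous (A : set fn) (K : R) :
  A `<=` @HK R d +oo%E -> (forall f, A f -> hk_bound f <= K) ->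
  sup_unif_continuous_on A (dual_map z).
Proof.
move=> AH AK e e0; have e3 : 0 < e / 3 by rewrite divr_gt0.
pose K' := `|K| + 1; have K0 : 0 < K' by rewrite ltr_wpDl.
have e'0 : 0 < e / 3 / K' by rewrite divr_gt0.
have [v [phi [gphi vphi zv]]] := closure_regularP cz e'0.
have zvA f : A f -> `|dual_map z f - dual_map v f| <= e / 3.
  move=> Af; have Hf := AH _ Af.
  rewrite -dual_mapB (le_trans (dual_map_bound _ Hf))//.
  apply: (@le_trans _ _ (K' * `|z - v|)).
    rewrite ler_wpM2r// (le_trans (AK _ Af))// /K' (le_trans (ler_norm K))// lerDl//.
  by rewrite mulrC -ler_pdivlMr// ltW.
have [r r0 rP] := ext_sup_continuous gphi (subset_trans AH (@HK_approximable R d)) e3.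
exists r => // f g Af Ag fg.
have {}rP := rP f g Af Ag fg.
have vE h : A h -> dual_map v h = unif_extension phi h.
  by move=> /AH Hh; rewrite (dual_map_ext Hh gphi vphi).
have -> : dual_map z g - dual_map z f = (dual_map z g - dual_map v g) +
  (unif_extension phi g - unif_extension phi f) -
  (dual_map z f - dual_map v f) by rewrite !vE//; ring.
have -> : e = e / 3 + e / 3 + e / 3 by field.
apply: (le_lt_trans (ler_normB _ _)); rewrite ltr_leD ?zvA//.
by rewrite (le_lt_trans (ler_normD _ _))// ler_ltD// zvA.
Qed.

End Closure.

(** By [dual_map_mono] the value on a monotone limit of boxes is a limit of
    evaluations, so it obeys the bound with constant 1, unlike the general one
    with [hk_bound]. *)
Lemma dual_map_mono_closure_close z v g : closure regular_elements z ->
  closure regular_elements v -> mono_closure boxes g ->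
  `|dual_map z g - dual_map v g| <= `|z - v|.
Proof.
move=> cz cv [f [Ff fg]].
apply: (@cvgr_norm_ub _ nat \oo _ (fun k => dual_map z (f k) - dual_map v (f k))).
  by apply: cvgB; exact: dual_map_mono.
by move=> k; rewrite !dual_map_box//; exact: linfty_norm_ub (z - v) _.
Qed.

Lemma linear_on_HK_sum (phi : fn -> R) n (a : 'I_n -> R) (g : 'I_n -> fn) :
  linear_on (@HK R d +oo%E) phi -> (forall i, mono_closure boxes (g i)) ->
  phi (fun x => \sum_i a i * g i x) = \sum_i a i * phi (g i).
Proof.
move=> lphi Gg; apply: (@linear_on_sum _ _ (mono_closure boxes)) => //.
by move=> b c f f' /spanG_HK Hf /spanG_HK Hf'; exact: lphi.
Qed.

(** The sequence is the one of [hk_approx_seq] and the same for all elements.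
    The bound on its coefficients gives a uniform Lipschitz constant in the
    element, so convergence passes from [regular_elements] to the closure. *)
Lemma dual_map_span_cvg h : @HK R d +oo%E h -> exists2 g : nat -> fn,
  (forall N, spanG (g N)) & forall z, closure regular_elements z ->
    dual_map z (g N) @[N --> \oo] --> dual_map z h.
Proof.
move=> Hh; have [n [a [g [Gg aK gh]]]] := hk_approx_seq Hh.
exists (fun N x => \sum_i a N i * g N i x) => [N|z cz]; first exact: gh.1.
apply/cvgrPdist_le => e e0; have e3 : 0 < e / 3 by rewrite divr_gt0.
have K1 : 0 < hk_bound h + 1 by rewrite ltr_wpDl// hk_bound_ge0.
have e'0 : 0 < e / 3 / (hk_bound h + 1) by rewrite divr_gt0.
have [v [phi [gphi vphi zv]]] := closure_regularP cz e'0.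
have cv : closure regular_elements v by apply: subset_closure; exists phi.
have zvh := dual_map_close Hh e3 zv.
have zvg N : `|dual_map z (fun x => \sum_i a N i * g N i x) -
    dual_map v (fun x => \sum_i a N i * g N i x)| <= e / 3.
  rewrite !linear_on_HK_sum//; try exact: dual_map_linear_on.
  rewrite -sumrB; apply: (le_trans (ler_norm_sum _ _ _)).
  apply: (@le_trans _ _ ((hk_bound h + 1) * `|z - v|)); last first.
    by rewrite mulrC -ler_pdivlMr// ltW.
  apply: (@le_trans _ _ (hk_bound h * `|z - v|)); last by rewrite ler_wpM2r// lerDl.
  apply: (le_trans _ (ler_wpM2r (normr_ge0 _) (aK N))).
  rewrite mulr_suml; apply: ler_sum => i _; rewrite -mulrBr normrM ler_wpM2l//.
  exact: dual_map_mono_closure_close.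
have /cvgrPdist_le/(_ _ e3) := ext_cvg gphi gh; apply: filterS => N gN.
have SN : spanG (fun x => \sum_i a N i * g N i x) by exact: gh.1.
rewrite -(ext_span gphi SN) -!(dual_map_ext _ gphi vphi)// in gN; last exact: spanG_HK.
have := zvg N; set A := dual_map z (fun x => _); set B := dual_map v (fun x => _) => AB.
have -> : dual_map z h - A = (dual_map z h - dual_map v h) +
  (dual_map v h - B) - (A - B) by ring.
have -> : e = e / 3 + e / 3 + e / 3 by field.
apply: (le_trans (ler_normB _ _)); rewrite lerD//.
by rewrite (le_trans (ler_normD _ _))// lerD// ltW.
Qed.

End DualMap.

(** * Limits of normal random variables *)

Section LowerSemicontinuity.
Context (R : realType) (dsp : measure_display) (Om : measurableType dsp)
  (P : probability Om R).

Lemma ae_le_measure (A B : set Om) : measurable A -> measurable B ->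
  {ae P, forall w, A w -> B w} -> (P A <= P B)%E.
Proof.
move=> mA mB [N [mN PN0 sub]].
apply: (@le_trans _ _ (P (B `|` N))).
  apply: le_measure; rewrite ?inE//; first exact: measurableU.
  move=> w Aw; have [Bw|nBw] := pselect (B w); [by left|right].
  by apply: sub => /= /(_ Aw).
by rewrite (le_trans (measureU2 _ _ _))// [X in (_ + X)%E]PN0 adde0.
Qed.

(** The events that hold from a given index on increase to a set that contains
    almost all of [A]. *)
Lemma eventually_measure_gt (A : set Om) (A_ : nat -> set Om) (c : \bar R) :
  measurable A -> (forall n, measurable (A_ n)) ->
  {ae P, forall w, A w -> \forall n \near \oo, A_ n w} ->
  (c < P A)%E -> \forall n \near \oo, (c < P (A_ n))%E.
Proof.
move=> mA mA_ AA_ cA.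
pose B n := \bigcap_k A_ (n + k)%N.
have mB n : measurable (B n) by apply: bigcapT_measurable => k.
have mU : measurable (\bigcup_n B n) by exact: bigcupT_measurable.
have PAU : (P A <= P (\bigcup_n B n))%E.
  apply: ae_le_measure => //; apply: filterS AA_ => w H /H[n _ nA].
  by exists n => // k _; apply: nA; rewrite /= leq_addr.
have ndB : {homo B : n m / (n <= m)%N >-> (n <= m)%O}.
  move=> n m nm; apply/subsetPset => w Bw k _.
  by have := Bw (m - n + k)%N I; rewrite addnA subnKC.
have [n cB] : exists n, (c < P (B n))%E.
  apply: contrapT => /forallNP H.
  have PB := nondecreasing_cvg_mu (mu := P) mB mU ndB.
  have : (P (\bigcup_n B n) <= c)%E.
    have <- := cvg_lim (@ereal_hausdorff _) PB.
    apply: lime_le; first by apply/cvg_ex; eexists; exact: PB.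
    by apply: nearW => n; rewrite leNgt; apply/negP/H.
  by rewrite leNgt (lt_le_trans cA PAU).
exists n => // m /= nm; apply: (lt_le_trans cB).
apply: le_measure; rewrite ?inE//.
by move=> w /(_ (m - n)%N I); rewrite subnKC.
Qed.

End LowerSemicontinuity.

Section NormalBounds.
Context (R : realType).
Implicit Types m s a b : R.

(** With a point mass at deviation zero, as in [normal_rv]. *)
Definition normal_law m s (A : set R) : \bar R :=
  if s == 0 then \d_m A else normal_prob m s A.

Lemma normal_peak_le s : s != 0 -> normal_peak s <= `|s|^-1.
Proof.
move=> s0; rewrite /normal_peak lef_pV2 ?posrE ?normr_gt0//; last first.
  by rewrite sqrtr_gt0 pmulrn_lgt0// mulr_gt0 ?pi_gt0// exprn_even_gt0.
rewrite -sqrtr_sqr ler_wsqrtr// -mulrnAr ler_peMr ?sqr_ge0//.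
have : 2 <= pi :> R by exact: pi_ge2.
by rewrite -mulr_natr; lra.
Qed.

Lemma normal_pdf_le m s x : s != 0 -> normal_pdf m s x <= `|s|^-1.
Proof. by move=> s0; rewrite (le_trans (normal_pdf_ub m x s0))// normal_peak_le. Qed.

(** From the inequality of exp(-y) and 1/y for positive y. *)
Lemma normal_pdf_far m s x e : s != 0 -> 0 < e -> e <= `|x - m| ->
  normal_pdf m s x <= 2 * `|s| / e ^+ 2.
Proof.
move=> s0 e0 exm; rewrite normal_pdfE//.
have s20 : 0 < s ^+ 2 *+ 2 by rewrite pmulrn_lgt0// exprn_even_gt0.
have xm0 : 0 < `|x - m| by exact: lt_le_trans exm.
have xm20 : 0 < (x - m) ^+ 2 by rewrite exprn_even_gt0//= -normr_gt0.
have fun_le : normal_fun m s x <= (s ^+ 2 *+ 2) / (x - m) ^+ 2.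
  rewrite /normal_fun mulNr expRN -[leRHS]invrK invf_div.
  rewrite lef_pV2 ?posrE ?expR_gt0 ?divr_gt0//.
  by rewrite (le_trans _ (expR_ge1Dx _))// lerDr.
apply: (le_trans (ler_pM (normal_peak_ge0 s) (normal_fun_ge0 m s x) (normal_peak_le s0) fun_le)).
have -> : `|s|^-1 * (s ^+ 2 *+ 2 / (x - m) ^+ 2) = 2 * `|s| / (x - m) ^+ 2.
  have xm : x - m != 0 by rewrite -normr_gt0.
  have sn : `|s| != 0 by rewrite normr_eq0.
  by rewrite -(real_normK (num_real s)) -mulr_natr; field; rewrite ?xm ?sn.
apply: ler_wpM2l; first by rewrite mulr_ge0.
rewrite lef_pV2 ?posrE ?xm20 ?exprn_gt0//.
by rewrite -[leRHS](real_normK (num_real _)) lerXn2r ?nnegrE// ltW.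
Qed.

(** The bounds [normal_pdf_le] and [normal_pdf_far], whichever is better; it
    is uniform in the deviation and hence controls escaping means. *)
Lemma normal_pdf_far_unif m s x e : s != 0 -> 0 < e -> e <= `|x - m| ->
  normal_pdf m s x <= 2 / e.
Proof.
move=> s0 e0 exm; have [es|se] := leP e `|s|.
  rewrite (le_trans (normal_pdf_le _ _ s0))//.
  apply: (@le_trans _ _ e^-1); first by rewrite lef_pV2 ?posrE ?normr_gt0.
  by rewrite ler_peMl ?invr_ge0 ?ltW// ltr1n.
rewrite (le_trans (normal_pdf_far s0 e0 exm))// expr2 invfM mulrA.
rewrite ler_wpM2r ?invr_ge0 ?(ltW e0)// ler_pdivrMr// ler_wpM2l// ltW//.
Qed.

Lemma normal_prob_itv_le m s a b M : s != 0 -> a <= b -> 0 <= M ->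
  (forall x, a < x < b -> normal_pdf m s x <= M) ->
  (normal_prob m s `]a, b[ <= (M * (b - a))%:E)%E.
Proof.
move=> s0 ab M0 pM; rewrite /normal_prob.
apply: (@le_trans _ _ (\int[lebesgue_measure]_(x in `]a, b[) M%:E)%E); last first.
  rewrite integral_cst//= lebesgue_measure_itv/= lte_fin.
  by case: ltP => ab'; rewrite ?EFinN -?EFinB ?EFinM// mule0 lee_fin mulr_ge0// subr_ge0.
apply: ge0_le_integral => //=.
- by move=> x _; rewrite lee_fin normal_pdf_ge0.
- by apply/measurable_EFinP; apply: measurable_funTS; exact: measurable_normal_pdf.
Qed.

Lemma normal_law_itv_le m s a b : s != 0 -> a <= b ->
  (normal_law m s `]a, b[ <= (`|s|^-1 * (b - a))%:E)%E.
Proof.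
move=> s0 ab; rewrite /normal_law (negPf s0); apply: normal_prob_itv_le => // x _.
exact: normal_pdf_le.
Qed.

Lemma normal_law_far m s a b e : a <= b -> 0 < e ->
  (forall x, a < x < b -> e <= `|x - m|) ->
  (normal_law m s `]a, b[ <= (2 * `|s| / e ^+ 2 * (b - a))%:E)%E /\
  (normal_law m s `]a, b[ <= (2 / e * (b - a))%:E)%E.
Proof.
move=> ab e0 far; rewrite /normal_law; case: eqVneq => [->|s0].
  rewrite diracE memNset/=; last first.
    by rewrite /= in_itv/= => /far; rewrite subrr normr0 leNgt e0.
  by rewrite !lee_fin normr0 mulr0 !mul0r; split=> //; rewrite mulr_ge0 ?subr_ge0// divr_ge0// ltW.
have e2 : 0 <= 2 * `|s| / e ^+ 2 by apply: divr_ge0; [exact: mulr_ge0|exact: sqr_ge0].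
have e1 : 0 <= 2 / e by rewrite divr_ge0// ltW.
split; apply: normal_prob_itv_le => // x xab.
- exact: normal_pdf_far (far _ xab).
- exact: normal_pdf_far_unif (far _ xab).
Qed.

End NormalBounds.

Section NormalParameters.
Context (R : realType).

Lemma normal_pdf_abs (m s x : R) : normal_pdf m `|s| x = normal_pdf m s x.
Proof.
have [->|s0] := eqVneq s 0; first by rewrite normr0.
rewrite !normal_pdfE ?normr_eq0// /normal_peak /normal_fun.
by rewrite real_normK ?num_real.
Qed.

Lemma normal_pdf_cvg (m_ s_ : nat -> R) (m s x : R) : s != 0 ->
  (forall n, s_ n != 0) -> m_ n @[n --> \oo] --> m -> s_ n @[n --> \oo] --> s ->
  normal_pdf (m_ n) (s_ n) x @[n --> \oo] --> normal_pdf m s x.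
Proof.
move=> s0 sn0 mm ss.
have s2 : s_ n ^+ 2 @[n --> \oo] --> s ^+ 2.
  by rewrite expr2; under eq_fun do rewrite expr2; exact: cvgM.
rewrite normal_pdfE//; under eq_fun do rewrite normal_pdfE//.
apply: cvgM.
  apply: cvgV.
    by rewrite gt_eqF// sqrtr_gt0 pmulrn_lgt0// mulr_gt0 ?pi_gt0// exprn_even_gt0.
  apply: continuous_cvg; first exact: sqrt_continuous.
  rewrite mulr2n; under eq_fun do rewrite mulr2n.
  by apply: cvgD; apply: cvgMr_tmp.
apply: continuous_cvg; first exact: continuous_expR.
apply: cvgM.
  rewrite expr2; under eq_fun do rewrite expr2.
  by apply: cvgN; apply: cvgM; apply: cvgB => //; exact: cvg_cst.
apply: cvgV; first by rewrite mulrn_eq0/= sqrf_eq0.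
by rewrite mulr2n; under eq_fun do rewrite mulr2n; exact: cvgD.
Qed.

(** Dominated convergence.  The deviations are truncated from below at half
    their limit so that the densities have a common bound for all indices. *)
Lemma normal_prob_itv_cvg (m_ s_ : nat -> R) (m s a b : R) : 0 < s ->
  m_ n @[n --> \oo] --> m -> `|s_ n| @[n --> \oo] --> s ->
  normal_law (m_ n) (s_ n) `]a, b[ @[n --> \oo] --> normal_prob m s `]a, b[.
Proof.
move=> s0 mm ss; pose t n := Num.max `|s_ n| (s / 2).
have s20 : 0 < s / 2 by rewrite divr_gt0.
have tn0 n : t n != 0 by rewrite gt_eqF// lt_max s20 orbT.
have s2n : \forall n \near \oo, s / 2 < `|s_ n|.
  by move/cvgrPdist_lt : ss => /(_ _ s20); apply: filterS => n; rewrite ltr_norml; lra.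
have tt : t n @[n --> \oo] --> s.
  apply: cvg_trans ss; apply: near_eq_cvg; apply: filterS s2n => n sn.
  by rewrite /t max_l// ltW.
have lim : (\int[lebesgue_measure]_(x in `]a, b[) (normal_pdf (m_ n) (t n) x)%:E)%E
    @[n --> \oo] --> normal_prob m s `]a, b[.
  apply: (@dominated_cvg _ _ _ _ _ _ _ _ (fun=> (s / 2)^-1%:E)) => //.
  - move=> n; apply/measurable_EFinP/measurable_funTS; exact: measurable_normal_pdf.
  - move=> x _; apply: cvg_EFin; first exact: nearW.
    by apply: normal_pdf_cvg => //; rewrite gt_eqF.
  - apply/integrableP; split => //.
    rewrite integral_cst//= lebesgue_measure_itv/=.
    by case: ifP => _; rewrite ?mule0// -?EFinN -?EFinB -?EFinM ltry.
  - move=> n x _; rewrite gee0_abs ?lee_fin ?normal_pdf_ge0//.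
    rewrite (le_trans (normal_pdf_le _ _ (tn0 n)))// lef_pV2 ?posrE ?normr_gt0//.
    by rewrite (le_trans _ (ler_norm _))// le_max lexx orbT.
apply: cvg_trans lim; apply: near_eq_cvg; apply: filterS s2n => n sn.
have sn0 : s_ n != 0 by rewrite -normr_gt0 (lt_trans s20).
rewrite /normal_law (negPf sn0) /normal_prob; apply: eq_integral => x _.
by rewrite /t max_l ?(ltW sn)// normal_pdf_abs.
Qed.

Lemma bounded_subsequence (u : nat -> R) (M : R) : (forall n, `|u n| <= M) ->
  exists2 f : nat -> nat, (forall n, (n <= f n)%N) &
    exists l : R, u (f n) @[n --> \oo] --> l.
Proof.
move=> uM.
have [|f finc /cvg_ex[l fl]] := @bolzano_weierstrass _ u.
  exists M; split; first exact: num_real.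
  by move=> N MN n _; exact: le_trans (uM n) (ltW MN).
exists f; last by exists l.
elim=> // n nf; apply: (leq_ltn_trans nf).
rewrite ltnNge; apply/negP => h; have E := finc n.+1 n.
have : (f n.+1 <= f n)%O := h; by rewrite E ltnn.
Qed.

Lemma subsequence_cvg (f : nat -> nat) : (forall n, (n <= f n)%N) ->
  f n @[n --> \oo] --> \oo.
Proof.
move=> nf A [N _ NA]; exists N => // n /= Nn; apply: NA => /=.
exact: leq_trans (nf n).
Qed.

End NormalParameters.

Section NormalLimit.
Context (R : realType) (dsp : measure_display) (Om : measurableType dsp)
  (P : probability Om R).
Variables (Z_ : nat -> Om -> R) (Z : Om -> R) (m_ s_ : nat -> R).
Hypothesis mZ_ : forall n, measurable_fun [set: Om] (Z_ n).
Hypothesis mZ : measurable_fun [set: Om] Z.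
Hypothesis Z_law : forall n A, measurable A ->
  P (Z_ n @^-1` A) = normal_law (m_ n) (s_ n) A.
Hypothesis Z_cvg : {ae P, forall w, Z_ n w @[n --> \oo] --> Z w}.

Lemma measurable_event (X : Om -> R) A : measurable_fun [set: Om] X ->
  measurable A -> measurable (X @^-1` A).
Proof. by move=> mX mA; rewrite -[_ @^-1` _]setTI; exact: mX. Qed.

Lemma normal_law_eventually_gt a b c : (c < P (Z @^-1` `]a, b[))%E ->
  \forall n \near \oo, (c < normal_law (m_ n) (s_ n) `]a, b[)%E.
Proof.
move=> cP.
have : \forall n \near \oo, (c < P (Z_ n @^-1` `]a, b[))%E.
  apply: eventually_measure_gt cP; [exact: measurable_event|by move=> n; exact: measurable_event|].
  apply: filterS Z_cvg => w Zw Zab;   have nb : nbhs (Z w) `]a, b[%classic.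
    by apply: open_nbhs_nbhs; split => //; exact: itv_open.
  exact: (Zw _ nb).
by apply: filterS => n; rewrite Z_law.
Qed.

Lemma normal_law_tight : exists2 M : R, 0 < M &
  \forall n \near \oo, ((2^-1 : R)%:E < normal_law (m_ n) (s_ n) `](- M)%R, M[)%E.
Proof.
have [n _ /(_ n (leqnn _))/= H] : \forall n \near \oo,
    ((2^-1 : R)%:E < P (Z @^-1` `](- n.+1%:R)%R, n.+1%:R[))%E.
  apply: (@eventually_measure_gt _ _ _ P setT) => //.
  - by move=> n; exact: measurable_event.
  - apply: aeW => w _; have := near_infty_natSinv_lt.
    have [N _ NP] := nbhs_infty_gtr `|Z w|.
    move=> _; exists N => // n /= Nn; rewrite in_itv/= -ltr_norml.
    by rewrite (lt_trans (NP n Nn))// ltr_nat.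
  - by rewrite probability_setT lte_fin invf_lt1// ltr1n.
exists n.+1%:R => //; exact: normal_law_eventually_gt.
Qed.

(** A fixed bounded interval has mass more than one half under all the laws
    from some index on, which excludes both large deviations and large means. *)
Lemma normal_parameters_bounded : exists M : R,
  \forall n \near \oo, `|m_ n| <= M /\ `|s_ n| <= M.
Proof.
have [M M0 Mn] := normal_law_tight.
(* A mean beyond 9 M is at distance 8 M from the interval of length 2 M, and
   there the density is at most 2 / (8 M). *)
exists (9 * M); apply: filterS Mn => n H.
have MM : - M <= M by lra.
split; rewrite leNgt; apply/negP => lt9.
  have M80 : 0 < 8 * M by rewrite mulr_gt0.
  have far x : - M < x < M -> 8 * M <= `|x - m_ n|.
    move=> /andP[x1 x2]; have : `|x| <= M by rewrite ler_norml; lra.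
    by have := lerB_dist (m_ n) x; rewrite distrC; lra.
  have [_ far2] := normal_law_far (s_ n) MM M80 far.
  have := lt_le_trans H far2; rewrite lte_fin.
  suff -> : 2 / (8 * M) * (M - - M) = 2^-1 by rewrite ltxx.
  by field; rewrite gt_eqF.
have M90 : 0 < 9 * M by rewrite mulr_gt0.
have sn : s_ n != 0 by rewrite -normr_gt0 (lt_trans M90).
have := lt_le_trans H (normal_law_itv_le (m_ n) sn MM); rewrite lte_fin.
apply/negP; rewrite -leNgt.
apply: (@le_trans _ _ ((9 * M)^-1 * (M - - M))).
  rewrite ler_wpM2r ?subr_ge0// lef_pV2 ?posrE ?normr_gt0//; exact: ltW.
have -> : (9 * M)^-1 * (M - - M) = 2 / 9 by field; rewrite gt_eqF.
by lra.
Qed.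

Lemma normal_limit_parameters : exists (f : nat -> nat) (m s : R),
  [/\ f n @[n --> \oo] --> \oo, m_ (f n) @[n --> \oo] --> m,
      `|s_ (f n)| @[n --> \oo] --> s & 0 <= s].
Proof.
have [M [n0 _ /= Mn]] := normal_parameters_bounded.
have [|f fn [m fm]] := @bounded_subsequence _ (fun n => m_ (n0 + n)%N) M.
  by move=> n; have [] := Mn (n0 + n)%N (leq_addr _ _).
have [|g gn [s gs]] := @bounded_subsequence _ (fun n => `|s_ (n0 + f n)%N|) M.
  by move=> n; rewrite normr_id; have [] := Mn (n0 + f n)%N (leq_addr _ _).
exists (fun n => n0 + f (g n))%N, m, s; split => //.
- apply: subsequence_cvg => n; rewrite (leq_trans (gn n))// (leq_trans (fn _))//.
  exact: leq_addl.
- exact: cvg_comp (subsequence_cvg gn) fm.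
- refine (closed_cvg (fun y : R => 0 <= y) (@closed_ge _ 0) _ _ gs).
  exact: nearW.
Qed.

Section Limit.
Variables (f : nat -> nat) (m s : R).
Hypothesis f_oo : f n @[n --> \oo] --> \oo.
Hypothesis m_cvg : m_ (f n) @[n --> \oo] --> m.
Hypothesis s_cvg : `|s_ (f n)| @[n --> \oo] --> s.

Lemma normal_law_subseq_gt a b c : (c < P (Z @^-1` `]a, b[))%E ->
  \forall n \near \oo, (c < normal_law (m_ (f n)) (s_ (f n)) `]a, b[)%E.
Proof. by move=> /normal_law_eventually_gt H; exact: (f_oo H). Qed.

(** Only the upper bound on open intervals is available, but it determines the
    limit law: see [law_eq_of_itv_le]. *)
Lemma limit_itv_le a b : 0 < s ->
  (P (Z @^-1` `]a, b[) <= normal_prob m s `]a, b[)%E.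
Proof.
move=> s0; rewrite leNgt; apply/negP => lt1.
have [c /andP[c1 c2]] : exists c, (normal_prob m s `]a, b[ < c < P (Z @^-1` `]a, b[))%E.
  have := lt1; rewrite -(@fineK _ (normal_prob m s _)) ?fin_num_measure//.
  rewrite -(@fineK _ (P _)) ?fin_num_measure//; last exact: measurable_event.
  rewrite lte_fin => lt2.
  exists ((fine (normal_prob m s `]a, b[) + fine (P (Z @^-1` `]a, b[))) / 2)%:E.
  by rewrite !lte_fin !(midf_lt lt2).
have : (c <= normal_prob m s `]a, b[)%E.
  have lim := @normal_prob_itv_cvg _ (fun n => m_ (f n)) (fun n => s_ (f n)) m s a b s0 m_cvg s_cvg.
  rewrite -(cvg_lim (@ereal_hausdorff _) lim); apply: lime_ge.
    by apply/cvg_ex; eexists; exact: lim.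
  by apply: filterS (normal_law_subseq_gt c2) => n /ltW.
by rewrite leNgt c1.
Qed.

(** Laws with deviation tending to zero put no mass away from the limit of
    their means. *)
Lemma limit_itv_null a b : s = 0 -> a <= b -> b < m \/ m < a ->
  P (Z @^-1` `]a, b[) = 0%E.
Proof.
move=> s0 ab mab; apply/eqP; rewrite eq_le measure_ge0 andbT leNgt; apply/negP.
move=> lt0.
have [e e0 me] : exists2 e, 0 < e & forall y x, `|m - y| <= e -> a < x < b -> e <= `|x - y|.
  case: mab => [bm|ma].
    exists ((m - b) / 2) => [|y x]; first by rewrite divr_gt0// subr_gt0.
    rewrite ler_norml => /andP[y1 y2] /andP[x1 x2].
    by rewrite distrC (le_trans _ (ler_norm _))//; lra.
  exists ((a - m) / 2) => [|y x]; first by rewrite divr_gt0// subr_gt0.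
  rewrite ler_norml => /andP[y1 y2] /andP[x1 x2].
  by rewrite (le_trans _ (ler_norm _))//; lra.
pose p := fine (P (Z @^-1` `]a, b[)).
have pE : P (Z @^-1` `]a, b[) = p%:E.
  by rewrite /p fineK// fin_num_measure//; exact: measurable_event.
have p0 : 0 < p by rewrite -lte_fin -pE.
have cP : ((p / 2)%:E < P (Z @^-1` `]a, b[))%E.
  by rewrite pE lte_fin ltr_pdivrMr// ltr_pMr// ltr1n.
pose K := 2 / e ^+ 2 * (b - a) + 1.
have K0 : 0 < K.
  by rewrite ltr_wpDl// mulr_ge0 ?subr_ge0// divr_ge0 ?sqr_ge0.
have pK : 0 < p / 2 / K by rewrite !divr_gt0.
have sm : \forall n \near \oo, `|s_ (f n)| < p / 2 / K.
  move/cvgrPdist_lt : s_cvg => /(_ _ pK); rewrite s0; apply: filterS => n.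
  by rewrite sub0r normrN normr_id.
have mm : \forall n \near \oo, `|m - m_ (f n)| <= e.
  by move/cvgrPdist_le : m_cvg => /(_ _ e0).
have [n [[cn sn] mn]] := filter_ex (filterI (filterI (normal_law_subseq_gt cP) sm) mm).
have [far _] := normal_law_far (s_ (f n)) ab e0 (fun x => me _ x mn).
have := lt_le_trans cn far; rewrite lte_fin; apply/negP; rewrite -leNgt.
have -> : 2 * `|s_ (f n)| / e ^+ 2 * (b - a) = `|s_ (f n)| * (2 / e ^+ 2 * (b - a)) by ring.
apply: (@le_trans _ _ (`|s_ (f n)| * K)); first by rewrite ler_wpM2l// lerDl.
by rewrite -ler_pdivlMr// ltW.
Qed.

End Limit.

End NormalLimit.

Section NormalLimitLaw.
Context (R : realType) (dsp : measure_display) (Om : measurableType dsp)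
  (P : probability Om R).

(** The complement of the point is a countable union of intervals at a
    positive distance from it. *)
Lemma concentrated_law (Z : Om -> R) (m : R) : measurable_fun [set: Om] Z ->
  (forall a b, a <= b -> b < m \/ m < a -> P (Z @^-1` `]a, b[) = 0%E) ->
  forall A, measurable A -> P (Z @^-1` A) = \d_m A.
Proof.
move=> mZ Z0 A mA.
have null_off : P.-negligible (Z @^-1` [set~ m]).
  pose U n := Z @^-1` `]m - n.+2%:R, m - n.+1%:R^-1[.
  pose V n := Z @^-1` `]m + n.+1%:R^-1, m + n.+2%:R[.
  apply: (@negligibleS _ _ _ _ (\bigcup_n (U n `|` V n))).
    move=> w /= /eqP Zm; have [N _ NP] := nbhs_infty_gtr `|Z w - m|.
    have zm0 : 0 < `|Z w - m| by rewrite normr_gt0 subr_eq0.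
    have [K _ KP] := near_infty_natSinv_lt (PosNum zm0).
    have [n n1 n2] : exists2 n, `|Z w - m| < n.+2%:R & n.+1%:R^-1 < `|Z w - m|.
      exists (maxn N K); last exact: KP (leq_maxr _ _).
      rewrite (lt_trans (NP _ (leq_maxl N K)))// ltr_nat.
      by rewrite (ltn_trans (ltnSn _)).
    exists n => //.
    have [Zm'|Zm'] := leP m (Z w); [right|left]; rewrite /U /V /= in_itv/=.
      by rewrite ger0_norm ?subr_ge0// in n1 n2; rewrite -ltrBrDl n2 -ltrBlDl n1.
    rewrite ltr0_norm ?subr_lt0// opprB in n1 n2.
    by rewrite ltrBlDr -ltrBlDl n1 ltrBrDr -ltrBrDl n2.
  apply: negligible_bigcup => n.
  have n0 : 0 < n.+1%:R^-1 :> R by rewrite invr_gt0.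
  have n1 : n.+1%:R^-1 <= n.+2%:R :> R.
    by rewrite (@le_trans _ _ 1)// ?invf_le1 ?ler1n.
  have mU a b : measurable (Z @^-1` `]a, b[) by exact: measurable_event.
  apply: negligibleU; apply/(negligibleP P (mU _ _)).
  - by apply: Z0; [rewrite lerB|left; rewrite gtrBl].
  - by apply: Z0; [rewrite lerD2l|right; rewrite ltrDl].
have mp (B : set R) : measurable B -> ~ B m -> P (Z @^-1` B) = 0%E.
  move=> mB Bm; apply/negligibleP; first exact: measurable_event.
  by apply: negligibleS null_off => w /= Bw Zm; apply: Bm; rewrite -Zm.
rewrite diracE; have [mA'|mA'] := boolP (m \in A); last first.
  by apply: mp => // ?; move/negP : mA'; apply; exact: mem_set.
have := mp (~` A) (measurableC mA); rewrite preimage_setC probability_setC;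
  last exact: measurable_event.
move=> H; have {}H := H (fun nA => nA (set_mem mA')).
rewrite -[P _]fineK ?fin_num_measure//; last exact: measurable_event.
congr EFin; have : fine (1 - P (Z @^-1` A))%E = 0 by rewrite H.
rewrite fineB ?fin_num_measure//; last exact: measurable_event.
by move=> /= /eqP; rewrite subr_eq0 => /eqP <-.
Qed.

(** The bound extends to both open half-lines at a point by monotone limits,
    and the point itself has mass zero for both measures.  The total masses
    being equal, so are those of the half-lines. *)
Lemma law_eq_of_itv_le (mu nu : probability (measurableTypeR R) R) :
  (forall a b : R, a <= b -> (mu `]a, b[%classic <= nu `]a, b[%classic)%E) ->
  (forall a : R, nu [set a] = 0%E) ->
  forall A, measurable A -> mu A = nu A.
Proof.
move=> le_itv nu0.
have fin_prob (p : probability (measurableTypeR R) R) (B : set (measurableTypeR R)) :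
    measurable B -> (p B < +oo)%E.
  by move=> mB; exact: le_lt_trans (probability_le1 p mB) (ltry 1).
have up (a : R) : (mu `]a, +oo[%classic <= nu `]a, +oo[%classic)%E.
  pose U n : set R := `]a, a + n%:R[%classic.
  have UE : \bigcup_n U n = `]a, +oo[%classic.
    apply/seteqP; split=> [x [n _]|x].
      by rewrite /U /= !in_itv/= andbT => /andP[].
    rewrite /= in_itv/= andbT => ax; have [N _ NP] := nbhs_infty_gtr (x - a).
    by exists N => //; rewrite /U /= in_itv/= ax -ltrBlDl; exact: NP (leqnn N).
  have ndU : {homo U : n k / (n <= k)%N >-> (n <= k)%O}.
    move=> n k nk; apply/subsetPset => x; rewrite /U /= !in_itv/= => /andP[-> xn].
    by rewrite (lt_le_trans xn)// lerD2l ler_nat.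
  have mU n : measurable (U n) by exact: measurable_itv.
  have mUU : measurable (\bigcup_n U n) by exact: bigcupT_measurable.
  have c1 := nondecreasing_cvg_mu (mu := mu) mU mUU ndU.
  have c2 := nondecreasing_cvg_mu (mu := nu) mU mUU ndU.
  rewrite -UE -(cvg_lim (@ereal_hausdorff _) c1) -(cvg_lim (@ereal_hausdorff _) c2).
  apply: lee_lim; [by apply/cvg_ex; eexists; exact: c1|by apply/cvg_ex; eexists; exact: c2|].
  by apply: nearW => n; apply: le_itv; rewrite lerDl.
have dn (a : R) : (mu `]-oo, a[%classic <= nu `]-oo, a[%classic)%E.
  pose U n : set R := `]a - n%:R, a[%classic.
  have UE : \bigcup_n U n = `]-oo, a[%classic.
    apply/seteqP; split=> [x [n _]|x].
      by rewrite /U /= !in_itv/= => /andP[].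
    rewrite /= in_itv/= => ax; have [N _ NP] := nbhs_infty_gtr (a - x).
    by exists N => //; rewrite /U /= in_itv/= ax andbT ltrBlDl -ltrBlDr; exact: NP (leqnn N).
  have ndU : {homo U : n k / (n <= k)%N >-> (n <= k)%O}.
    move=> n k nk; apply/subsetPset => x; rewrite /U /= !in_itv/= => /andP[xn ->].
    by rewrite andbT (le_lt_trans _ xn)// lerB// ler_nat.
  have mU n : measurable (U n) by exact: measurable_itv.
  have mUU : measurable (\bigcup_n U n) by exact: bigcupT_measurable.
  have c1 := nondecreasing_cvg_mu (mu := mu) mU mUU ndU.
  have c2 := nondecreasing_cvg_mu (mu := nu) mU mUU ndU.
  rewrite -UE -(cvg_lim (@ereal_hausdorff _) c1) -(cvg_lim (@ereal_hausdorff _) c2).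
  apply: lee_lim; [by apply/cvg_ex; eexists; exact: c1|by apply/cvg_ex; eexists; exact: c2|].
  by apply: nearW => n; apply: le_itv; rewrite lerBlDr lerDl.
have pt (a : R) : mu [set a] = 0%E.
  pose q (n : nat) : R := n.+1%:R^-1.
  have q0 n : 0 < q n by rewrite invr_gt0.
  pose U n : set R := `]a - q n, a + q n[%classic.
  have UE : \bigcap_n U n = [set a].
    apply/seteqP; split=> [x Ux|x -> n _]; last first.
      rewrite /U /= in_itv/=; have := q0 n.
      by move=> ?; apply/andP; split; lra.
    apply/eqP/contraT => xa; have xa0 : 0 < `|x - a| by rewrite normr_gt0 subr_eq0.
    have [K _ KP] := near_infty_natSinv_lt (PosNum xa0).
    have := Ux K I; rewrite /U /= in_itv/= => /andP[x1 x2].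
    have : `|x - a| < q K by rewrite ltr_norml; apply/andP; split; lra.
    by rewrite ltNge (ltW (KP K (leqnn K))).
  have niU : {homo U : n k / (n <= k)%N >-> (k <= n)%O}.
    move=> n k nk; apply/subsetPset => x; rewrite /U /= !in_itv/=.
    have : q k <= q n by rewrite lef_pV2 ?posrE// ler_nat.
    by move=> ? /andP[? ?]; apply/andP; split; lra.
  have mU n : measurable (U n) by exact: measurable_itv.
  have mUU : measurable (\bigcap_n U n) by exact: bigcapT_measurable.
  have f1 : (mu (U 0%N) < +oo)%E by apply: fin_prob; exact: mU.
  have f2 : (nu (U 0%N) < +oo)%E by apply: fin_prob; exact: mU.
  have c1 := nonincreasing_cvg_mu (mu := mu) f1 mU mUU niU.
  have c2 := nonincreasing_cvg_mu (mu := nu) f2 mU mUU niU.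
  apply/eqP; rewrite eq_le measure_ge0 andbT -(nu0 a) -UE.
  rewrite -(cvg_lim (@ereal_hausdorff _) c1) -(cvg_lim (@ereal_hausdorff _) c2).
  apply: lee_lim; [by apply/cvg_ex; eexists; exact: c1|by apply/cvg_ex; eexists; exact: c2|].
  apply: nearW => n; apply: le_itv; have := q0 n; lra.
have ray (a : R) : mu `]a, +oo[%classic = nu `]a, +oo[%classic.
  have split_line (p : probability (measurableTypeR R) R) :
      (1 = p `]-oo, a[%classic + p [set a] + p `]a, +oo[%classic)%E.
    have mI : measurable (`]-oo, a[%classic : set R) by exact: measurable_itv.
    have mJ : measurable (`]a, +oo[%classic : set R) by exact: measurable_itv.
    rewrite -measureU//; last first.
      by rewrite -subset0 => x [] /=; rewrite in_itv/= => /[swap] ->; rewrite ltxx.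
    rewrite -measureU//; last 2 first.
    - exact: measurableU.
    - rewrite -subset0 => x [] /= [|->]; rewrite !in_itv/= ?ltxx ?andbT//.
      by move=> xa; rewrite ltNge (ltW xa).
    rewrite -(probability_setT p); congr (p _); apply/seteqP; split => // x _ /=.
    rewrite !in_itv/= andbT; case: (ltgtP x a) => ?; [by left; left|by right|by left; right].
  apply/eqP; rewrite eq_le up/=.
  have := split_line mu; have := split_line nu; rewrite nu0 pt !adde0.
  move: (dn a) (up a).
  have fm (p : probability (measurableTypeR R) R) (i : interval R) : exists r, p [set` i] = r%:E.
    exists (fine (p [set` i])); rewrite fineK// fin_num_measure//; exact: measurable_itv.
  have [m1 ->] := fm mu `]-oo, a[; have [m2 ->] := fm mu `]a, +oo[.
  have [n1 ->] := fm nu `]-oo, a[; have [n2 ->] := fm nu `]a, +oo[.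
  rewrite -!EFinD !lee_fin => ? ? [E1] [E2]; lra.
move=> A mA.
apply: (@measure_unique _ R (measurableTypeR R) (@RGenOInfty.G R)
  (fun n => `](- n%:R), +oo[%classic)) => //.
- exact: RGenOInfty.measurableE.
- move=> _ _ [a ->] [b ->]; exists (Num.max a b); apply/seteqP; split=> x /=;
    rewrite !in_itv/= !andbT gt_max; [by case=> -> ->|by move=> /andP[]].
- by move=> n; exists (- n%:R).
- apply/seteqP; split=> // x _; have [N _ NP] := nbhs_infty_gtr (- x).
  by exists N => //=; rewrite in_itv/= andbT ltrNl; exact: NP (leqnn N).
- by move=> _ [a ->]; exact: ray.
- by move=> n; apply: fin_prob; exact: measurable_itv.
Qed.

End NormalLimitLaw.

Section NormalLimitConclusion.
Context (R : realType) (dsp : measure_display) (Om : measurableType dsp)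
  (P : probability Om R).

Lemma normal_prob_set1 (m s a : R) : normal_prob m s [set a] = 0%E.
Proof.
have /null_content_dominatesP dom := @normal_prob_dominates R m s.
by apply: dom; [exact: measurable_set1|exact: lebesgue_measure_set1].
Qed.

(** The second part holds because the limiting mean is the limit of a
    subsequence of the given means. *)
Lemma normal_law_limit (Z_ : nat -> Om -> R) (Z : Om -> R) (m_ s_ : nat -> R) :
  (forall n, measurable_fun [set: Om] (Z_ n)) -> measurable_fun [set: Om] Z ->
  (forall n A, measurable A -> P (Z_ n @^-1` A) = normal_law (m_ n) (s_ n) A) ->
  {ae P, forall w, Z_ n w @[n --> \oo] --> Z w} ->
  exists m s, (forall A, measurable A -> P (Z @^-1` A) = normal_law m s A) /\
    ((forall n, m_ n = 0) -> m = 0).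
Proof.
move=> mZ_ mZ Z_law Z_cvg.
have [f [m [s [f_oo mm ss s0]]]] := normal_limit_parameters mZ_ mZ Z_law Z_cvg.
exists m, s; split=> [|m0]; last first.
  have mf0 : (fun n => m_ (f n)) = fun=> 0 by apply/funext.
  rewrite mf0 in mm; apply: (@cvg_unique _ (@norm_hausdorff _ _) _ _ _ _ mm).
  exact: cvg_cst.
move: s0; rewrite le_eqVlt => /orP[/eqP s0|s0] A mA.
  rewrite /normal_law -s0 eqxx; apply: concentrated_law => // a b ab mab.
  exact: (limit_itv_null mZ_ mZ Z_law Z_cvg f_oo mm ss).
rewrite /normal_law gt_eqF//.
have mZR : @measurable_fun _ _ Om (measurableTypeR R) setT Z by exact: mZ.
pose Zm : {mfun Om >-> measurableTypeR R} :=
  @mfun_Sub _ _ Om (measurableTypeR R) Z (mem_set mZR).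
pose mu1 : probability (measurableTypeR R) R := distribution P Zm.
pose nu1 : probability (measurableTypeR R) R := normal_prob m s.
apply: (@law_eq_of_itv_le R mu1 nu1) => //.
- by move=> a b ab; exact: (limit_itv_le mZ_ mZ Z_law Z_cvg f_oo mm ss).
- by move=> a; exact: normal_prob_set1.
Qed.

Lemma normal_rv_limit (Z_ : nat -> Om -> R) (Z : Om -> R) :
  (forall n, normal_rv P (Z_ n)) -> measurable_fun [set: Om] Z ->
  {ae P, forall w, Z_ n w @[n --> \oo] --> Z w} -> normal_rv P Z.
Proof.
move=> nZ mZ Z_cvg; split=> //.
have /choice[m_ mP] : forall n, exists m s, forall A, measurable A ->
  P (Z_ n @^-1` A) = normal_law m s A by move=> n; have [_] := nZ n.
have [s_ sP] := choice mP.
have [|m [s [ZE _]]] := normal_law_limit _ mZ sP Z_cvg; last by exists m, s.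
by move=> n; have [] := nZ n.
Qed.

End NormalLimitConclusion.

Section NormalMean.
Context (R : realType).
Local Notation mu := (@lebesgue_measure R).

(** The density is a Radon-Nikodym derivative. *)
Lemma ge0_integral_normal_prob (m s : R) (f : R -> R) :
  measurable_fun [set: R] f -> (forall x, 0 <= f x) ->
  (\int[normal_prob m s]_x (f x)%:E = \int[mu]_x (f x * normal_pdf m s x)%:E)%E.
Proof.
move=> mf f0; have dom := @normal_prob_dominates R m s.
have mEf : measurable_fun [set: R] (EFin \o f) by exact/measurable_EFinP.
rewrite -(Radon_Nikodym_SigmaFinite.change_of_variables dom)//.
apply: ae_eq_integral => //.
- apply: emeasurable_funM => //.
  exact: measurable_int (Radon_Nikodym_SigmaFinite.f_integrable dom).
- apply/measurable_EFinP; apply: measurable_funM => //; exact: measurable_normal_pdf.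
- have H : ae_eq mu setT (Radon_Nikodym_SigmaFinite.f (normal_prob m s) mu)
      (EFin \o normal_pdf m s).
    apply: integral_ae_eq => //.
    + exact: Radon_Nikodym_SigmaFinite.f_integrable.
    + by apply/measurable_EFinP; exact: measurable_normal_pdf.
    + by move=> E _ mE; rewrite -Radon_Nikodym_SigmaFinite.f_integral.
  by apply: filterS H => x H xT; rewrite H.
Qed.

(** The antiderivative by which the first moments over the half-lines at [m]
    are evaluated. *)
Lemma is_derive_normal_pdf (m s x : R) : s != 0 ->
  is_derive x 1 (fun x => - (s ^+ 2 * normal_pdf m s x))
    ((x - m) * normal_pdf m s x).
Proof.
move=> s0; rewrite normal_pdfE// /normal_fun.
have d1 : is_derive x 1 (fun x : R => - (x - m) ^+ 2 / (s ^+ 2 *+ 2))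
    (- (x - m) / s ^+ 2).
  apply: is_derive_eq.
  rewrite /GRing.scale/=; field; by rewrite s0.
have d2 := is_derive1_comp (is_derive_expR _) d1.
have d3 := is_deriveZ (- (s ^+ 2 * normal_peak s)) d2.
have -> : (fun x => - (s ^+ 2 * (normal_peak s * expR (- (x - m) ^+ 2 / (s ^+ 2 *+ 2))))) =
    - (s ^+ 2 * normal_peak s) \*: (expR \o (fun x : R => - (x - m) ^+ 2 / (s ^+ 2 *+ 2))).
  by apply/funext => y /=; rewrite /GRing.scale/=; ring.
apply: (is_derive_eq d3).
rewrite /GRing.scale/=; field; by rewrite s0.
Qed.

Lemma continuous_moment (m s : R) : s != 0 ->
  continuous (fun x : R => (x - m) * normal_pdf m s x).
Proof.
move=> s0 x; apply: cvgM; last exact: continuous_normal_pdf.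
by apply: cvgB; [exact: cvg_id|exact: cvg_cst].
Qed.

Lemma normal_pdf_cvgy (m s : R) : s != 0 ->
  - (s ^+ 2 * normal_pdf m s x) @[x --> +oo] --> 0.
Proof.
move=> s0; have s20 : 0 < s ^+ 2 by rewrite exprn_even_gt0.
apply/cvgrPdist_le => e e0.
have d0 : 0 < 2 * s ^+ 2 / e by rewrite divr_gt0// mulr_gt0.
near=> x; rewrite sub0r opprK ger0_norm; last first.
  by rewrite mulr_ge0 ?normal_pdf_ge0// ltW.
have xm : 2 * s ^+ 2 / e <= `|x - m|.
  rewrite (le_trans _ (ler_norm _))// lerBrDr.
  by near: x; apply: nbhs_pinfty_ge; rewrite num_real.
apply: (le_trans (ler_wpM2l (ltW s20) (normal_pdf_far_unif s0 d0 xm))).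
by rewrite le_eqVlt; apply/orP; left; apply/eqP; field; rewrite s0 gt_eqF.
Unshelve. all: by end_near. Qed.

Lemma integral_upper_moment (m s : R) : s != 0 ->
  (\int[mu]_(x in `[m, +oo[) ((x - m) * normal_pdf m s x)%:E =
   (s ^+ 2 * normal_pdf m s m)%:E)%E.
Proof.
move=> s0.
rewrite (@ge0_continuous_FTC2y _ _ (fun x => - (s ^+ 2 * normal_pdf m s x)) m 0).
- by rewrite sub0e -EFinN opprK.
- by move=> x mx; rewrite mulr_ge0 ?subr_ge0// normal_pdf_ge0.
- by apply: continuous_subspaceT; exact: continuous_moment.
- exact: normal_pdf_cvgy.
- by move=> x _; have [] := is_derive_normal_pdf m x s0.
- apply: cvg_at_right_filter; apply: cvgN; apply: cvgMl_tmp.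
  exact: continuous_normal_pdf.
- move=> x _; rewrite derive1E; have dx := is_derive_normal_pdf m x s0.
  exact: derive_val.
Qed.

Lemma integral_lower_moment (m s : R) : s != 0 ->
  (\int[mu]_(x in `]-oo, m]) ((m - x) * normal_pdf m s x)%:E =
   (s ^+ 2 * normal_pdf m s m)%:E)%E.
Proof.
move=> s0; rewrite -integral_upper_moment//.
pose F (x : R) := 2 * m - x.
have dF (x : R) : is_derive x 1 F (-1).
  by rewrite /F; apply: is_derive_eq; rewrite add0r mul1r.
have F'E : F^`()%classic = cst (-1).
  by apply/funext => x; rewrite derive1E; have dx := dF x; exact: derive_val.
have Fm : F m = m by rewrite /F; ring.
have cF : continuous F.
  by move=> x; apply: cvgB; [exact: cvg_cst|exact: cvg_id].
rewrite -{1}Fm (@decreasing_ge0_integration_by_substitutiony _ F _ m).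
- apply: eq_integral => x _; congr EFin => /=.
  rewrite F'E /= opprK mulr1 /F; congr (_ * _); first by ring.
  rewrite !normal_pdfE// /normal_fun; congr (_ * expR _).
  by congr (- _ / _); ring.
- by move=> x y _ _ xy; rewrite /F ltrD2l ltrN2.
- by rewrite F'E => x _; exact: cvg_cst.
- by rewrite F'E; exact: is_cvg_cst.
- by rewrite F'E; exact: is_cvg_cst.
- split; first by move=> x _; have [] := dF x.
  by apply: cvg_at_right_filter; exact: cF.
- rewrite /F; apply/cvgrNyPle => A; near=> x.
  rewrite lerBlDr -lerBlDl; near: x; apply: nbhs_pinfty_ge; exact: num_real.
- apply: continuous_subspaceT => x; apply: cvgM; last exact: continuous_normal_pdf.
  by apply: cvgB; [exact: cvg_cst|exact: cvg_id].
- move=> x; rewrite in_itv/= Fm => xm; rewrite mulr_ge0 ?normal_pdf_ge0//.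
  by rewrite subr_ge0 ltW.
Unshelve. all: by end_near. Qed.

End NormalMean.

Section NormalMeanConclusion.
Context (R : realType) (dsp : measure_display) (Om : measurableType dsp)
  (P : probability Om R).

Lemma ge0_integral_law (Z : Om -> R) (nu : {measure set (measurableTypeR R) -> \bar R})
    (f : R -> R) : measurable_fun [set: Om] Z -> measurable_fun [set: R] f ->
  (forall x, 0 <= f x) ->
  (forall A, measurable A -> P (Z @^-1` A) = nu A) ->
  (\int[P]_w (f (Z w))%:E = \int[nu]_x (f x)%:E)%E.
Proof.
move=> mZ mf f0 ZE.
have mZR : @measurable_fun _ _ Om (measurableTypeR R) setT Z by exact: mZ.
pose Zm : {mfun Om >-> measurableTypeR R} :=
  @mfun_Sub _ _ Om (measurableTypeR R) Z (mem_set mZR).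
have := @ge0_integral_distribution _ _ _ _ _ P Zm (EFin \o f).
move=> H; have {}H := H _ (fun y => f0 y).
transitivity (\int[distribution P Zm]_y (f y)%:E)%E.
  rewrite H//; exact/measurable_EFinP.
by apply: eq_measure_integral => A mA _; exact: ZE.
Qed.

(** The positive and negative parts of the centered variable have the same
    finite expectation, by symmetry of the density. *)
Lemma normal_law_moments (Z : Om -> R) (m s : R) : measurable_fun [set: Om] Z ->
  (forall A, measurable A -> P (Z @^-1` A) = normal_law m s A) ->
  exists c : R, (\int[P]_w (Num.max (Z w - m) 0)%:E = c%:E)%E /\
    (\int[P]_w (Num.max (m - Z w) 0)%:E = c%:E)%E.
Proof.
move=> mZ; rewrite /normal_law.
pose up (x : R) := Num.max (x - m) 0; pose dn (x : R) := Num.max (m - x) 0.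
have mup : measurable_fun [set: R] up.
  by apply: measurable_maxr => //; exact: measurable_funB.
have mdn : measurable_fun [set: R] dn.
  by apply: measurable_maxr => //; exact: measurable_funB.
have up0 x : 0 <= up x by rewrite le_max lexx orbT.
have dn0 x : 0 <= dn x by rewrite le_max lexx orbT.
case: eqVneq => [_|s0] ZE.
  pose dm : {measure set (measurableTypeR R) -> \bar R} := @dirac _ (measurableTypeR R) m R.
  exists 0; split.
    rewrite (@ge0_integral_law Z dm up)// integral_dirac//=; last exact/measurable_EFinP.
    by rewrite diracT mul1e /up subrr maxxx.
  rewrite (@ge0_integral_law Z dm dn)// integral_dirac//=; last exact/measurable_EFinP.
  by rewrite diracT mul1e /dn subrr maxxx.
exists (s ^+ 2 * normal_pdf m s m); split.
  rewrite (@ge0_integral_law Z (normal_prob m s) up)// ge0_integral_normal_prob//.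
  rewrite -integral_upper_moment// [RHS]integral_mkcond; apply: eq_integral => x _.
  rewrite patchE; case: ifPn; rewrite /up.
    rewrite inE/= in_itv/= andbT => mx; by rewrite max_l ?subr_ge0.
  rewrite notin_setE/= in_itv/= andbT => /negP; rewrite -ltNge => mx.
  by rewrite max_r ?mul0r// subr_le0 ltW.
rewrite (@ge0_integral_law Z (normal_prob m s) dn)// ge0_integral_normal_prob//.
rewrite -integral_lower_moment// [RHS]integral_mkcond; apply: eq_integral => x _.
rewrite patchE; case: ifPn; rewrite /dn.
  rewrite inE/= in_itv/= => mx; by rewrite max_l ?subr_ge0.
rewrite notin_setE/= in_itv/= => /negP; rewrite -ltNge => mx.
by rewrite max_r ?mul0r// subr_le0 ltW.
Qed.

Lemma normal_law_mean (Z : Om -> R) (m s : R) : measurable_fun [set: Om] Z ->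
  (forall A, measurable A -> P (Z @^-1` A) = normal_law m s A) ->
  P.-integrable [set: Om] (EFin \o Z) /\ ('E_P[Z] = m%:E)%E.
Proof.
move=> mZ /(normal_law_moments mZ)[c [up dn]].
pose pu (w : Om) : R := Num.max (Z w - m) 0.
pose pd (w : Om) : R := Num.max (m - Z w) 0.
have mup : measurable_fun [set: Om] pu.
  by apply: measurable_maxr => //; exact: measurable_funB.
have mdn : measurable_fun [set: Om] pd.
  by apply: measurable_maxr => //; exact: measurable_funB.
have pu0 w : 0 <= pu w by rewrite le_max lexx orbT.
have pd0 w : 0 <= pd w by rewrite le_max lexx orbT.
have ge0int (f : Om -> R) : measurable_fun [set: Om] f -> (forall w, 0 <= f w) ->
    (\int[P]_w (f w)%:E = c%:E)%E -> P.-integrable [set: Om] (EFin \o f).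
  move=> mf f0 fc; apply/integrableP; split; first exact/measurable_EFinP.
  under eq_integral do rewrite /= ger0_norm//.
  by rewrite fc ltry.
have iup := ge0int _ mup pu0 up.
have idn := ge0int _ mdn pd0 dn.
have icst : P.-integrable [set: Om] (EFin \o cst m).
  exact: finite_measure_integrable_cst.
have ZE : EFin \o Z = ((EFin \o pu) \- (EFin \o pd) \+ (EFin \o cst m))%E.
  apply/funext => w /=; congr EFin; rewrite /pu /pd.
  by have [?|?] := leP (Z w - m) 0; have [?|?] := leP (m - Z w) 0; lra.
have iud := integrableB measurableT iup idn.
have iZ : P.-integrable [set: Om] (EFin \o Z).
  by rewrite ZE; apply: integrableD.
split=> //; rewrite unlock.
transitivity (\int[P]_w (EFin \o Z) w)%E; first by [].
rewrite ZE integralD// integralB//.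
rewrite [X in (X - _ + _)%E](_ : _ = c%:E)// [X in (_ - X + _)%E](_ : _ = c%:E)//.
rewrite subee// add0e; have := expectation_cst P m.
by rewrite unlock.
Qed.

(** Mean zero is not stable under almost sure limits by itself; together with
    normality it is. *)
Definition centered_normal_rv (Z : Om -> R) := normal_rv P Z /\ mean_zero_rv P Z.

Lemma centered_normal_rv_limit (Z_ : nat -> Om -> R) (Z : Om -> R) :
  (forall n, centered_normal_rv (Z_ n)) -> measurable_fun [set: Om] Z ->
  {ae P, forall w, Z_ n w @[n --> \oo] --> Z w} -> centered_normal_rv Z.
Proof.
move=> nZ mZ Z_cvg.
have nZ1 n := (nZ n).1; have nZ2 n := (nZ n).2.
split; first exact: normal_rv_limit nZ1 mZ Z_cvg.
have /choice[m_ mP] : forall n, exists m s, forall A, measurable A ->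
  P (Z_ n @^-1` A) = normal_law m s A by move=> n; have [_] := nZ1 n.
have [s_ sP] := choice mP.
have mZ_ n : measurable_fun [set: Om] (Z_ n) by have [] := nZ1 n.
have m0 n : m_ n = 0.
  have [_] := normal_law_mean (mZ_ n) (sP n).
  by have [_ ->] := nZ2 n => -[].
have [m [s [ZE /(_ m0) mE]]] := normal_law_limit mZ_ mZ sP Z_cvg.
by have := normal_law_mean mZ ZE; rewrite mE.
Qed.

End NormalMeanConclusion.

(** * Random elements of a space of bounded functions *)

Section RandomElementFacts.
Context (R : realType).

Lemma lipschitz_continuous (V W : normedModType R) (f : V -> W) (K : R) :
  (forall x y, `|f x - f y| <= K * `|x - y|) -> continuous f.
Proof.
move=> fK x; apply/cvgrPdist_lt => e e0.
have K0 : 0 < `|K| + 1 by rewrite ltr_wpDl.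
have eK : 0 < e / (`|K| + 1) by rewrite divr_gt0.
apply: filterS (nbhsx_ballx x _ eK) => y; rewrite -ball_normE /= => xy.
apply: (le_lt_trans (fK x y)).
apply: (@le_lt_trans _ _ ((`|K| + 1) * `|x - y|)).
  by apply: ler_wpM2r => //; rewrite (le_trans (ler_norm K))// lerDl.
by rewrite mulrC -ltr_pdivlMr.
Qed.

Context (T : Type) (dsp : measure_display) (Om : measurableType dsp).
Local Notation L := (linfty R T).

Lemma borel_measurable_comp (X : Om -> L) (f : L -> R) :
  borel_measurable X -> continuous f -> measurable_fun [set: Om] (f \o X).
Proof.
move=> bX cf; apply: (measurability (@RGenOInfty.G R)).
  exact: RGenOInfty.measurableE.
move=> _ [_ [a ->] <-]; rewrite setTI comp_preimage; apply: bX.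
apply: sub_sigma_algebra => /=; move/continuousP : cf; apply.
exact: rray_open.
Qed.

Lemma borel_closed (A : set L) : closed A -> borel A.
Proof.
move=> cA; rewrite -[A]setCK; apply: (@sigma_algebraC L); apply: sub_sigma_algebra.
exact: closed_openC.
Qed.

Lemma borel_preimage (T' : Type) (f : L -> linfty R T') (B : set (linfty R T')) :
  continuous f -> borel B -> borel (f @^-1` B).
Proof.
move=> cf; pose E := [set B | borel (f @^-1` B)].
move: B.
suff : @borel R T' `<=` E by exact.
apply: smallest_sub; last first.
  move=> A oA; apply: sub_sigma_algebra; move/continuousP : cf; exact.
split.
- by rewrite /E /= preimage_set0; exact: (sigma_algebra0 (G := @open L)).
- by move=> A EA; rewrite /E /= setTD preimage_setC; exact: (@sigma_algebraC L).
- by move=> A EA; rewrite /E /= preimage_bigcup; exact: sigma_algebra_bigcup.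
Qed.

Variable P : probability Om R.

Lemma outer_expectation0 : outer_expectation P (fun=> 0 : R) = 0%E.
Proof.
apply/eqP; rewrite eq_le; apply/andP; split.
  apply: ereal_inf_lbound; exists (cst 0%E); last by rewrite integral0.
  split; [exact: measurable_cst|left|by []].
  rewrite (eq_integral (cst 0%E)) ?integral0//.
  by move=> w _; rewrite funeposE /= maxxx.
apply: le_ereal_inf_tmp => _ [U [mU _ U0] <-].
by apply: integral_ge0 => w _; exact: U0.
Qed.

End RandomElementFacts.

Section ConcentrationOnClosure.
Context (R : realType) (T : Type).
Local Notation L := (linfty R T).
Variables (V : set L) (V0 : V !=set0).

Definition dist_to (z : L) : R := inf [set `|z - v| | v in V].

Lemma dist_to_has_inf z : has_inf [set `|z - v| | v in V].
Proof.
split; first by have [v Vv] := V0; exists `|z - v|, v.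
by exists 0 => _ [v _ <-].
Qed.

Lemma dist_to_ge0 z : 0 <= dist_to z.
Proof. by apply: lb_le_inf => [|_ [v _ <-]//]; exact: (dist_to_has_inf z).1. Qed.

Lemma dist_to_le z v : V v -> dist_to z <= `|z - v|.
Proof. by move=> Vv; apply: ge_inf; [exact: (dist_to_has_inf z).2|exists v]. Qed.

Lemma dist_to_lipschitz x y : `|dist_to x - dist_to y| <= 1 * `|x - y|.
Proof.
have half u v : dist_to u - dist_to v <= `|u - v|.
  rewrite lerBlDl -lerBlDr; apply: lb_le_inf; first exact: (dist_to_has_inf v).1.
  move=> _ [a Va <-]; rewrite lerBlDr (le_trans (dist_to_le u Va))//.
  by rewrite -[u - a](subrKA v) addrC ler_normD.
by rewrite mul1r ler_norml half andbT lerNl opprB distrC half.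
Qed.

Lemma dist_to_closure z : dist_to z = 0 -> closure V z.
Proof.
move=> z0 B /nbhs_ballP[e e0 eB].
have [_ [v Vv <-] ve] : exists2 r, [set `|z - v| | v in V] r & r < e.
  by apply: inf_lt; [exact: (dist_to_has_inf z).1|rewrite [inf _]z0].
by exists v; split=> //; apply: eB; rewrite -ball_normE.
Qed.

(** The truncated distance to [V] is bounded, continuous and vanishes along
    the sequence. *)
Lemma weak_cvg_closure (dsp : nat -> measure_display)
    (Om : forall n, measurableType (dsp n))
    (P : forall n, probability (Om n) R) (X : forall n, Om n -> L)
    (dsp0 : measure_display) (Om0 : measurableType dsp0)
    (P0 : probability Om0 R) (X0 : Om0 -> L) :
  weak_cvg P X P0 X0 -> (forall n w, V (X n w)) ->
  {ae P0, forall w, closure V (X0 w)}.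
Proof.
move=> [bX0 wX] VX.
pose phi z := Num.min (dist_to z) 1.
have min_lip (a b : R) : `|Num.min a 1 - Num.min b 1| <= `|a - b|.
  have := ler_norm (a - b); have := ler_norm (b - a); rewrite (distrC b a) => h1 h2.
  by rewrite ler_norml; have [?|?] := leP a 1; have [?|?] := leP b 1;
    apply/andP; split; lra.
have cphi : continuous (phi : L -> R^o).
  apply: lipschitz_continuous => x y.
  exact: le_trans (min_lip _ _) (dist_to_lipschitz x y).
have phi0 z : 0 <= phi z by rewrite le_min dist_to_ge0 ler01.
have phi1 z : phi z <= 1 by rewrite ge_min lexx orbT.
have mphi := borel_measurable_comp bX0 cphi.
have lim : (\int[P0]_w (phi (X0 w))%:E = 0)%E.
  have phi_bd : exists M : R, forall z, `|phi z| <= M.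
    by exists 1 => z; rewrite ger0_norm.
  have := wX phi cphi phi_bd.
  have -> : (fun n => outer_expectation (P n) (fun w => phi (X n w))) = fun=> 0%E.
    apply/funext => n; rewrite -[RHS](outer_expectation0 (P n)); congr outer_expectation.
    apply/funext => w; apply/eqP; rewrite eq_le phi0 andbT /phi.
    by rewrite ge_min (le_trans (dist_to_le _ (VX n w)))// subrr normr0.
  move=> H; by apply/esym; apply: (cvg_unique _ (cvg_cst 0%E) H).
have mE : measurable_fun [set: Om0] (fun w => (phi (X0 w))%:E) by exact/measurable_EFinP.
have /(ae_eq_integral_abs P0 measurableT mE) : (\int[P0]_w `|(phi (X0 w))%:E| = 0)%E.
  by under eq_integral do rewrite gee0_abs ?lee_fin//.
apply: filterS => w /(_ I) [pw]; apply: dist_to_closure.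
move: pw; rewrite /phi; case: (leP (dist_to (X0 w)) 1) => // _ /eqP.
by rewrite oner_eq0.
Qed.

End ConcentrationOnClosure.

(** * The extension operator and the laws of its images *)

Section DualOperator.
Context (R : realType) (d : nat) (c : R).
Local Notation fn := (cube R d -> R).
Local Notation boxes := (@box_indicators R d).
Local Notation LF := (linfty R boxes).
Local Notation HKc := (@HK R d c%:E).
Local Notation LH := (linfty R HKc).

Lemma HK_finite_sub : HKc `<=` @HK R d +oo%E.
Proof. by move=> h [hc _]; apply/HK_ooE; exact: lt_trans hc (ltry c). Qed.

Lemma hk_bound_HK h : HKc h -> hk_bound h <= c + c.
Proof.
move=> [hc sc]; rewrite /hk_bound lerD//.
  rewrite -lee_fin fineK ?ltW//; rewrite ge0_fin_numE ?(lt_trans hc) ?ltry//.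
  by apply: sume_ge0 => S _; exact: vitali_variation_ge0.
by rewrite -lee_fin (le_trans (sup_norm_ub h _)).
Qed.

Lemma dual_operator_bounded (z : LF) :
  (fun h : HKc => dual_map z (val h) : R^o) \in @linfty_pred R HKc.
Proof.
apply: mem_set; exists ((c + c) * `|z|) => h.
have Hh := set_mem (valP h).
rewrite (le_trans (dual_map_bound z (HK_finite_sub Hh)))// ler_wpM2r//.
exact: hk_bound_HK.
Qed.

Definition dual_operator (z : LF) : LH := Linfty (dual_operator_bounded z).

Lemma dual_operator_linear : linear dual_operator.
Proof.
by move=> a z z'; apply/val_inj/funext => h /=; rewrite dual_map_linear.
Qed.

HB.instance Definition _ :=
  GRing.isLinear.Build R LF LH *:%R dual_operator dual_operator_linear.

Lemma dual_operator_continuous : 0 <= c -> continuous dual_operator.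
Proof.
move=> c0; apply: (@lipschitz_continuous R LF LH _ (c + c)) => x y.
apply: linfty_norm_le => [|h]; first by rewrite mulr_ge0 ?addr_ge0.
have Hh := set_mem (valP h).
rewrite linftyB /= -dual_mapB.
rewrite (le_trans (dual_map_bound _ (HK_finite_sub Hh)))// ler_wpM2r//.
exact: hk_bound_HK.
Qed.

End DualOperator.

Section GaussianTransfer.
Context (R : realType) (d : nat) (dsp : measure_display) (Om : measurableType dsp)
  (P : probability Om R).
Local Notation fn := (cube R d -> R).
Local Notation boxes := (@box_indicators R d).
Local Notation spanG := (fun_span (mono_closure boxes)).
Local Notation LF := (linfty R boxes).
Variable X : Om -> LF.
Hypothesis bX : borel_measurable X.
Hypothesis cX : {ae P, forall w, closure (@regular_elements R d) (X w)}.

Lemma measurable_dual_map h : @HK R d +oo%E h ->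
  measurable_fun [set: Om] (fun w => dual_map (X w) h).
Proof.
move=> Hh; apply: (@borel_measurable_comp _ _ _ _ X (fun z => dual_map z h)) => //.
apply: (@lipschitz_continuous R LF R^o _ (hk_bound h)) => x y.
by rewrite -dual_mapB; exact: dual_map_bound.
Qed.

Variable N : (Om -> R) -> Prop.
Hypothesis N_limit : forall (Z_ : nat -> Om -> R) (Z : Om -> R),
  (forall n, N (Z_ n)) -> measurable_fun [set: Om] Z ->
  {ae P, forall w, Z_ n w @[n --> \oo] --> Z w} -> N Z.
Hypothesis N_boxes : forall n (t : 'I_n -> set_type boxes) (a : 'I_n -> R),
  N (fun w => \sum_(i < n) a i * X w (t i)).

(** By [dual_map_mono], the image is a limit of combinations of evaluations at
    boxes. *)
Lemma dual_map_span_law g : spanG g -> N (fun w => dual_map (X w) g).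
Proof.
move=> Sg; have := Sg => -[n [a [u [Gu gE]]]].
have [f fP] := choice Gu.
have Ff i k : boxes (f i k) by have [] := fP i.
apply: (N_limit (Z_ := fun k w => \sum_(i < n) a i * X w (box_point (Ff i k)))) => //.
  exact: measurable_dual_map (spanG_HK Sg).
apply: filterS cX => w cw.
rewrite gE (linear_on_HK_sum _ (dual_map_linear_on cw) Gu).
apply: cvgr_sum => i _; apply: cvgMl_tmp.
have -> : (fun k => X w (box_point (Ff i k))) = (fun k => dual_map (X w) (f i k)).
  by apply/funext => k; rewrite dual_map_box.
by have H := dual_map_mono cw (Ff i) (fP i).2; exact: H.
Qed.

(** By [dual_map_span_cvg], a second limit leads from the span of the monotone
    limits of boxes to all functions of bounded variation. *)
Lemma dual_map_HK_law n (t : 'I_n -> fn) (a : 'I_n -> R) :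
  (forall i, @HK R d +oo%E (t i)) ->
  N (fun w => \sum_(i < n) a i * dual_map (X w) (t i)).
Proof.
move=> Ht; pose h : fn := fun x => \sum_(i < n) a i * t i x.
have SH : fun_span (@HK R d +oo%E) `<=` @HK R d +oo%E by exact: HK_span.
have Hh : @HK R d +oo%E h by apply: SH; exists n, a, t.
have [g Sg gh] := dual_map_span_cvg Hh.
apply: (N_limit (Z_ := fun k w => dual_map (X w) (g k))).
- by move=> k; exact: dual_map_span_law (Sg k).
- apply: measurable_sum => i; apply: measurable_funM => //.
  exact: measurable_dual_map.
- apply: filterS cX => w cw.
  rewrite -(@linear_on_sum _ _ (@HK R d +oo%E) (dual_map (X w)))//; first exact: gh.
  by move=> b b' f f' /SH Hf /SH Hf'; exact: dual_map_linear_on.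
Qed.

End GaussianTransfer.

Lemma mean_zero_sum (R : realType) (dsp : measure_display) (Om : measurableType dsp)
    (P : probability Om R) n (a : 'I_n -> R) (Z : 'I_n -> Om -> R) :
  (forall i, mean_zero_rv P (Z i)) ->
  mean_zero_rv P (fun w => \sum_(i < n) a i * Z i w).
Proof.
move=> Z0; have E : EFin \o (fun w => \sum_(i < n) a i * Z i w) =
    (fun w => \sum_(i < n) ((a i)%:E * (Z i w)%:E))%E.
  by apply/funext => w /=; rewrite -sumEFin.
have iZ i : P.-integrable [set: Om] (fun w => (a i)%:E * (Z i w)%:E)%E.
  by apply: integrableZl => //; exact: (Z0 i).1.
split; first by rewrite E; exact: integrable_sum.
rewrite unlock; transitivity (\int[P]_w (EFin \o (fun w => \sum_(i < n) a i * Z i w)%R) w)%E.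
  by [].
rewrite E integral_sum// big1// => i _.
rewrite integralZl//; last exact: (Z0 i).1.
have := (Z0 i).2; rewrite unlock => ZE.
by rewrite [X in (_ * X)%E](_ : _ = 0%E) ?mule0.
Qed.

(** * The extension theorem *)

Section ExtensionProcess.
Context (R : realType) (d : nat).
Local Notation fn := (cube R d -> R).
Local Notation boxes := (@box_indicators R d).
Local Notation spanG := (fun_span (mono_closure boxes)).

Lemma unif_continuous_continuous (A : set fn) phi :
  sup_unif_continuous_on A phi -> sup_continuous_on A phi.
Proof.
move=> uphi f Af e e0; have [r r0 rP] := uphi e e0.
by exists r => // g Ag; exact: rP.
Qed.

Lemma ext_extension phi : regular_functional phi ->
  continuous_linear_extension spanG (@HK R d +oo%E) phi (unif_extension phi).
Proof.
move=> gphi; split.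
- by move=> f; exact: ext_span.
- by move=> a b f g /HK_approximable ? /HK_approximable ?; exact: ext_linear.
- apply: unif_continuous_continuous.
  exact: ext_sup_continuous gphi (@HK_approximable R d).
Qed.

(** The approximating functions themselves have bounded variation, so
    continuity on the larger space determines the value at their limit. *)
Lemma extension_unique phi psi : regular_functional phi ->
  continuous_linear_extension spanG (@HK R d +oo%E) phi psi ->
  forall h, @HK R d +oo%E h -> psi h = unif_extension phi h.
Proof.
move=> gphi [psiE _ cpsi] h Hh; have ah := approxP (HK_approximable Hh).
have lim1 := ext_cvg gphi ah.
apply: (cvg_unique _ _ lim1) => //.
apply/cvgrPdist_lt => e e0; have [r r0 rP] := cpsi h Hh e e0.
have r2 : 0 < r / 2 by rewrite divr_gt0.
have := ah.2 _ r2; apply: filterS => N aN.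
rewrite -psiE; last exact: ah.1.
rewrite distrC; apply: rP; first exact: spanG_HK (ah.1 N).
apply: (@sup_norm_lt _ _ _ (r / 2)); first by lra.
by move=> x; rewrite distrC.
Qed.

Lemma regular_zero : @regular_functional R d (fun=> 0).
Proof.
split.
- by move=> a b f g _ _; rewrite !mulr0 addr0.
- by move=> f g _ _; exact: cvg_cst.
- by move=> f _ e e0; exists 1 => // g _ _; rewrite subrr normr0.
Qed.

Lemma regular_elements_nonempty : @regular_elements R d !=set0.
Proof. by exists 0, (fun=> 0); [exact: regular_zero|]. Qed.

End ExtensionProcess.

Theorem theorem3p1 (R : realType) (d : nat) (d_gt0 : (0 < d)%N)
    (F G : set (cube R d -> R))
    (F_def : F = @box_indicators R d) (G_def : G = mono_closure F)
    (dsp : nat -> measure_display) (Om : forall n, measurableType (dsp n))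
    (P : forall n, probability (Om n) R)
    (X : forall n, Om n -> (cube R d -> R) -> R)
    (X_linear : forall n, linear_process_on (fun_span G) (X n))
    (X_mono : forall n w, mono_continuous_on F (X n w))
    (X_sup : forall n w, sup_continuous_on (fun_span G) (X n w))
    (X_one : forall n, {ae P n, forall w, X n w \1_[set: cube R d] = 0}) :
  exists Xbar : forall n, Om n -> (cube R d -> R) -> R,
    [/\ forall n, linear_process_on (@HK R d +oo%E) (Xbar n),
        forall n w, continuous_linear_extension (fun_span G) (@HK R d +oo%E)
          (X n w) (Xbar n w),
        forall n w (phi : (cube R d -> R) -> R),
          continuous_linear_extension (fun_span G) (@HK R d +oo%E)
            (X n w) phi ->
          forall h, @HK R d +oo%E h -> phi h = Xbar n w h &
        forall (c : R), 0 < c ->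
        forall (dsp0 : measure_display) (Om0 : measurableType dsp0)
          (P0 : probability Om0 R) (X0 : Om0 -> linfty R F),
          tight P0 X0 -> restricted_weak_cvg P X P0 X0 ->
        exists (dsp' : measure_display) (Om' : measurableType dsp')
          (P' : probability Om' R) (X' : Om' -> linfty R F)
          (Xext : Om' -> (cube R d -> R) -> R)
          (Xbar' : Om' -> linfty R (@HK R d c%:E)),
          [/\ copy_of P0 X0 P' X',
              [/\ {ae P', forall w, linear_on (@HK R d +oo%E) (Xext w) /\
                    restriction_of (Xext w) (X' w)},
                  forall w, restriction_of (Xext w) (Xbar' w),
                  borel_measurable Xbar' & tight P' Xbar'],
              restricted_weak_cvg P Xbar P' Xbar',
              {ae P', forall w, mono_continuous_on F (Xext w) /\
                sup_unif_continuous_on (@HK R d c%:E) (Xext w)} &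
              [/\ exists2 L : {linear linfty R F -> linfty R (@HK R d c%:E)},
                    continuous L & forall w, Xbar' w = L (X' w),
                  gaussian_process P0 X0 -> gaussian_process P' Xbar',
                  gaussian_process P0 X0 -> mean_zero_process P0 X0 ->
                    mean_zero_process P' Xbar' &
                  mean_zero_element P0 X0 -> mean_zero_element P' Xbar']]].
Proof.
subst F G.
have gX n w : regular_functional (X n w).
  by split; [exact: (X_linear n).2|exact: X_mono|exact: X_sup].
exists (fun n w => unif_extension (X n w)); split.
- move=> n; split=> [h Hh|w]; last by have [] := ext_extension (gX n w).
  have ah := approxP (HK_approximable Hh).
  apply: (@measurable_fun_cvg _ _ R setT (fun N w => X n w (approximants h N))
    (fun w => unif_extension (X n w) h)).
    by move=> N; apply: (X_linear n).1; exact: ah.1.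
  by move=> w _; exact: ext_cvg (gX n w) ah.
- by move=> n w; exact: ext_extension.
- by move=> n w phi; exact: extension_unique.
move=> c c0 dsp0 Om0 P0 X0 tX0 [Y [YX wY]].
have bX0 : borel_measurable X0 by have [] := wY.
have VY n w : @regular_elements R d (Y n w) by exists (X n w).
have cX0 := weak_cvg_closure (@regular_elements_nonempty R d) wY VY.
have cL : continuous (@dual_operator R d c) by apply: dual_operator_continuous; exact: ltW.
have bL : borel_measurable (fun w => dual_operator c (X0 w)).
  by move=> B bB; apply: (bX0 (dual_operator c @^-1` B)); exact: borel_preimage.
exists dsp0, Om0, P0, X0, (fun w => dual_map (X0 w)), (fun w => dual_operator c (X0 w)).
split.
- by split.
- split.
  + apply: filterS cX0 => w cw; split; first exact: dual_map_linear_on.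
    move=> f; rewrite (dual_map_box cw (set_mem (valP f))).
    by congr (X0 w _); apply/val_inj.
  + by move=> w h.
  + exact: bL.
  + move=> e e0; have [K cK PK] := tX0 e e0.
    have cLK : compact (dual_operator c @` K).
      by apply: continuous_compact => //; exact: continuous_subspaceT.
    exists (dual_operator c @` K) => //; apply: (le_trans PK).
    apply: le_measure; rewrite ?inE.
    * by apply: bX0; apply: borel_closed; exact: compact_closed (@norm_hausdorff _ _) cK.
    * by apply: bL; apply: borel_closed; exact: compact_closed (@norm_hausdorff _ _) cLK.
    * by move=> w Kw; exists (X0 w).
- exists (fun n w => dual_operator c (Y n w)); split=> [n w h|].
    by rewrite /= (dual_map_ext _ (gX n w) (YX n w))//; exact: HK_finite_sub (set_mem (valP h)).
  split=> // phi cphi [M phiM]; have [_ H] := wY.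
  apply: (H (fun z => phi (dual_operator c z))); last by exists M.
  by move=> z; apply: continuous_comp; [exact: cL|exact: cphi].
- apply: filterS cX0 => w cw; split; first exact: dual_map_mono.
  apply: (dual_map_unif_continuous cw (K := c + c)).
    exact: HK_finite_sub.
  exact: hk_bound_HK.
have lim_law (N : (Om0 -> R) -> Prop) : (forall (Z_ : nat -> Om0 -> R) (Z : Om0 -> R),
    (forall n, N (Z_ n)) -> measurable_fun [set: Om0] Z ->
    {ae P0, forall w, Z_ n w @[n --> \oo] --> Z w} -> N Z) ->
  (forall n (t : 'I_n -> set_type (@box_indicators R d)) (a : 'I_n -> R),
    N (fun w => \sum_(i < n) a i * X0 w (t i))) ->
  forall n (t : 'I_n -> set_type (@HK R d c%:E)) (a : 'I_n -> R),
    N (fun w => \sum_(i < n) a i * dual_operator c (X0 w) (t i)).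
  move=> Nlim NF n t a.
  have Ht i : @HK R d +oo%E (val (t i)) by exact: HK_finite_sub (set_mem (valP (t i))).
  have H := dual_map_HK_law bX0 cX0 Nlim NF a Ht; exact: H.
split.
- by exists (dual_operator c : {linear _ -> _}).
- move=> gX0; apply: lim_law => //; exact: normal_rv_limit.
- move=> gX0 mX0 t.
  have [|n s a|_] := lim_law (centered_normal_rv P0) _ _ 1%N (fun=> t) (fun=> 1).
  + exact: centered_normal_rv_limit.
  + by split; [exact: gX0|apply: mean_zero_sum => i; exact: mX0].
  + by under eq_fun do rewrite big_ord1 mul1r.
- move=> mX0 phi cphi.
  apply: (mX0 (phi \o dual_operator c : {linear _ -> _})) => z.
  by apply: continuous_comp; [exact: cL|exact: cphi].
Qed.
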